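(* Assume the bandwidths $h_n>0$ satisfy $\lim_n h_n=0$, $\lim_n nh_n=+\infty$ and $\lim_n \frac{\log n}{nh_n}=0$. Assume the kernel $K:\mathbb{R}\to\mathbb{R}$ is a continuously differentiable, compactly supported probability density with $\int_{\mathbb{R}} tK(t)\,dt=0$, $\int_{\mathbb{R}} t^2K(t)\,dt<\infty$ and $\int_{\mathbb{R}} tK^2(t)\,dt<\infty$. Assume that for $\ell=1,2$ the function $\bar r_\ell$ is twice continuously differentiable with $\sup_{x\in\mathcal{C}}|\bar r_\ell''(x)|<+\infty$, and that there exists $\Gamma>0$ such that $\bar r_2(x)>\Gamma$ for all $x\in\mathcal{C}$. Then $$\sup_{x\in\mathcal{C}}|r_n(x)-r(x)|=O_{a.s.}\left\{\max\left(\left(\frac{\log n}{nh_n^2}\right)^{1/2},\,h_n^2\right)\right\}\quad\text{as } n\to\infty.$$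
   Context: Setting. $(X_i,T_i)_{i\ge1}$ are i.i.d. copies of a random vector $(X,T)$ with values in $\mathbb{R}\times(0,\infty)$, having joint density $f_{T,X}(t,x)$; $X$ has density $f$ and $T$ has continuous distribution function $F$. $(C_i)_{i\ge1}$ are i.i.d. censoring variables with continuous distribution function $G$, and $\overline G=1-G$. The sequences $(T_i,X_i)_i$ and $(C_i)_i$ are independent. One observes $(X_i,Y_i,\delta_i)$, $1\le i\le n$, with $Y_i=\min(T_i,C_i)$ and $\delta_i=1_{\{T_i\le C_i\}}$. Let $\tau_F=\sup\{y: F(y)<1\}$; it is assumed that $\tau_F<\infty$, $\overline G(\tau_F)>0$, and that there is a constant $M>0$ with $T^{-\ell}\le M$ almost surely for $\ell=1,2$. $\mathcal{C}$ is a compact subset of the open set $\mathcal{C}_0=\{x\in\mathbb{R}: f(x)>0\}$. Target. For $\ell=1,2$, $r_\ell(x)=\mathbb{E}[T^{-\ell}\mid X=x]$ and $\bar r_\ell(x)=r_\ell(x)f(x)=\int_0^\infty t^{-\ell}f_{T,X}(t,x)\,dt$. The relative-error regression function is $r(x)=\bar r_1(x)/\bar r_2(x)=\mathbb{E}[T^{-1}\mid X=x]/\mathbb{E}[T^{-2}\mid X=x]$. Estimator. With $Y_{(1)}\le\dots\le Y_{(n)}$ the order statistics of $Y_1,\dots,Y_n$ and $\delta_{(i)}$ the indicator attached to $Y_{(i)}$, the Kaplan–Meier estimator of $\overline G$ is $\overline G_n(t)=\prod_{i=1}^n\left(1-\frac{1-\delta_{(i)}}{n-i+1}\right)^{1_{\{Y_{(i)}\le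 t\}}}$ if $t<Y_{(n)}$ and $\overline G_n(t)=0$ otherwise. For $\ell=1,2$, $$\bar r_{\ell,n}(x)=\frac1{nh_n}\sum_{i=1}^n\frac{\delta_iY_i^{-\ell}}{\overline G_n(Y_i)}K\left(\frac{x-X_i}{h_n}\right),\qquad r_n(x)=\frac{\bar r_{1,n}(x)}{\bar r_{2,n}(x)},$$ a quotient with zero denominator being set equal to $0$. $Z_n=O_{a.s.}(a_n)$ means that almost surely $\limsup_n |Z_n|/a_n<\infty$. *)

(* Defs.v *)
From HB Require Import structures.
From mathcomp Require Import all_boot all_order all_algebra.
From mathcomp Require Import all_classical all_reals all_analysis.
Import Order.TTheory GRing.Theory Num.Theory.
Import numFieldNormedType.Exports.

Set Implicit Arguments.
Unset Strict Implicit.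
Unset Printing Implicit Defensive.

Local Open Scope classical_set_scope.
Local Open Scope ring_scope.

Section probability_notions.
Context (R : realType) (d : measure_display) (Omega : measurableType d).
Variable P : probability Omega R.

Definition gen_sigma (d' : measure_display) (S : measurableType d')
    (Z : Omega -> S) : set_system Omega :=
  preimage_set_system setT Z measurable.

Definition gen_sigma_seq (d' : measure_display) (S : measurableType d')
    (Z : nat -> Omega -> S) : set_system Omega :=
  <<s \bigcup_i gen_sigma (Z i) >>.

Definition mutually_independent (d' : measure_display) (S : measurableType d')
    (Z : nat -> Omega -> S) : Prop :=
  forall (J : seq nat) (A : nat -> set Omega), uniq J ->
    (forall j, j \in J -> gen_sigma (Z j) (A j)) ->
    P (\bigcap_(j in [set` J]) A j) = (\prod_(j <- J) P (A j))%E.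

Definition independent_seqs (d1 d2 : measure_display)
    (S1 : measurableType d1) (S2 : measurableType d2)
    (Z1 : nat -> Omega -> S1) (Z2 : nat -> Omega -> S2) : Prop :=
  forall A B, gen_sigma_seq Z1 A -> gen_sigma_seq Z2 B ->
    P (A `&` B) = (P A * P B)%E.

Definition same_law (d' : measure_display) (S : measurableType d')
    (Z1 Z2 : Omega -> S) : Prop :=
  forall A, measurable A -> P (Z1 @^-1` A) = P (Z2 @^-1` A).

Definition has_density (d' : measure_display) (S : measurableType d')
    (mu : set S -> \bar R) (Z : Omega -> S) (p : S -> R) : Prop :=
  [/\ measurable_fun setT p, (forall z, 0 <= p z) &
      forall A, measurable A ->
        P (Z @^-1` A) = (\int[mu]_(z in A) (p z)%:E)%E].

(* [m] is a version of x |-> E[Z | X = x]. *)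
Definition is_regression (X : {RV P >-> R}) (Z : Omega -> R) (m : R -> R) :
    Prop :=
  (distribution P X).-integrable setT (EFin \o m) /\
  forall A : set R, measurable A ->
    (\int[P]_(w in X @^-1` A) (Z w)%:E =
     \int[distribution P X]_(x in A) (m x)%:E)%E.

Definition Oas (Z : nat -> Omega -> \bar R) (a : nat -> R) : Prop :=
  {ae P, forall w,
    (limn_esup (fun n => `|Z n w| * ((a n)^-1)%:E) < +oo)%E}.

End probability_notions.

Section analysis_notions.
Context (R : realType).
Implicit Types (g K : R -> R).

Definition cont_diff g : Prop :=
  (forall x, derivable g x 1) /\ continuous (derive1 g).

Definition twice_cont_diff g : Prop :=
  [/\ (forall x, derivable g x 1), (forall x, derivable (derive1 g) x 1) &
      continuous (derive1n 2 g)].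

(* Supremum of |g| over C, taken in [0, +oo], whence 0 (not -oo) for C empty. *)
Definition sup_abs (C : set R) g : \bar R :=
  maxe 0%E (ereal_sup [set `|g x|%:E | x in C]).

Definition upper_endpoint (F : R -> R) : \bar R :=
  ereal_sup [set y%:E | y in [set y | F y < 1]].

End analysis_notions.

(* Observation number i >= 1 of the mathematical text carries index i - 1. *)
Section estimator.
Context (R : realType).
Implicit Types (y xs : nat -> R) (dl : nat -> bool).

(* The index in the sample of the (k+1)-st order statistic among
   y 0, ..., y n.-1; the sort is stable, so ties are ordered by index. *)
Definition rank_idx (n : nat) y (k : nat) : nat :=
  nth 0%N (sort (fun i j => y i <= y j) (iota 0 n)) k.

(* With k = i - 1, the number at risk n - i + 1 is n - k. *)
Definition kaplan_meier (n : nat) y dl (t : R) : R :=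
  if t < y (rank_idx n y n.-1) then
    \prod_(k < n)
      (1 - (1 - (dl (rank_idx n y k))%:R) / (n - k)%:R)
        ^+ (y (rank_idx n y k) <= t)%R
  else 0.

Definition bar_rn (K : R -> R) (n : nat) (h : R) xs y dl (l : nat) (x : R) : R :=
  (n%:R * h)^-1 *
  \sum_(i < n) (dl i)%:R * y i ^- l / kaplan_meier n y dl (y i)
               * K ((x - xs i) / h).

(* Here and in [bar_rn], a quotient with zero denominator is 0. *)
Definition rn (K : R -> R) (n : nat) (h : R) xs y dl (x : R) : R :=
  bar_rn K n h xs y dl 1 x / bar_rn K n h xs y dl 2 x.

Definition bar_r (r_ : nat -> R -> R) (f : R -> R) (l : nat) (x : R) : R :=
  r_ l x * f x.

Definition rel_regression (r_ : nat -> R -> R) (f : R -> R) (x : R) : R :=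
  bar_r r_ f 1 x / bar_r r_ f 2 x.

End estimator.

(* Main.v *)
From HB Require Import structures.
Require Import Defs.
From mathcomp Require Import all_boot all_order all_algebra.
From mathcomp Require Import all_classical all_reals all_analysis.
From mathcomp Require Import measurable_realfun ring lra zify.
Import Order.TTheory GRing.Theory Num.Theory.
Import numFieldNormedType.Exports.
Set Implicit Arguments.
Unset Strict Implicit.
Unset Printing Implicit Defensive.
Local Open Scope classical_set_scope.
Local Open Scope ring_scope.

(** Write h for the bandwidth and q for [rate n], the square root of
    ln n / n.  After multiplication by h, the numerator and the denominator of
    the estimator are averages of
    1_(T_i <= C_i) T_i^-l K ((x - X_i) / h) / Gn (Y_i), where Gn is the
    Kaplan-Meier estimator of 1 - G.  Each of them is shown to equal
    h * bar_r l x up to an error O (q + h^3), uniformly in x.  Division by h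
    turns this into O (q / h + h^2), the announced order, and the quotient
    inherits it as soon as the denominator stays away from 0.  The error is the
    sum of three.

    Censoring.  Replacing Gn by 1 - G costs at most a constant times the mean
    of 1_(T_i <= C_i) |1 / Gn (Y_i) - 1 / (1 - G (T_i))|, which does not depend
    on x.  In the upper tail of the observations Gn is a poor estimate and no
    uniform bound of order q holds; the mean is O (q) all the same
    ([km_deviation], [ae_km_weights]).  Indeed - ln Gn is close to an empirical
    cumulative hazard, whose fluctuation at a point where the observations have
    survival probability p is q / sqrt p, and the mean of 1 / sqrt p over the
    order statistics is bounded.  The order statistics with p = O (q), where
    this argument fails, have their total weight bounded by a telescoping sum
    ([km_tail]).  The hazard at the order statistics is read off a grid of
    deterministic quantiles, where it is an average of independent variables
    ([at_risk_uniform], [cens_hazard_uniform]).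

    Fluctuation.  With the weights 1 / (1 - G (T_i)), the estimator is an
    average of independent bounded terms that are Lipschitz in x.  An
    exponential inequality on a fine mesh and the Borel-Cantelli lemma bound
    the deviation from its mean by O (q) ([uniform_deviation]).

    Bias.  As C is independent of (T, X), dividing by 1 - G (T) undoes the
    censoring on average ([integral_kernel_term]): the mean is the integral of
    K ((x - u) / h) bar_r l u, and the vanishing first moment of K makes it
    h * bar_r l x + O (h^3) ([kernel_bias]).

    The denominator needs an argument of its own, because q / h may fail to
    tend to 0.  Since Gn <= 1, replacing 1 / Gn by 1 can only lower the
    denominator, except at the largest observation, where Gn vanishes
    ([bar_rn_lower]).  What remains is at least 1 - G tau times the average with
    ideal weights, whose terms have variance O (h), and then ln n / (n h) -> 0
    suffices to bound it from below ([uniform_lower], [bar_rn2_lower]). *)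

(** * Elementary inequalities *)

Section elementary_inequalities.
Context {R : realType}.
Implicit Types x u : R.

(** From expR u = (expR (- u / 2))^-2 and expR (- u / 2) >= 1 - u / 2. *)
Lemma expR_le_quadratic u : `|u| <= 3^-1 -> expR u <= 1 + u + u ^+ 2.
Proof.
rewrite ler_norml => /andP[u1 u2].
have e2 : expR u = ((expR (- (u / 2))) ^+ 2)^-1.
  by rewrite -expRM_natl mulr_natl -expRN; congr expR; rewrite mulr2n; field.
have h1 : 1 - u / 2 <= expR (- (u / 2)) by have := @expR_ge1Dx R (- (u / 2)).
have h2 : 0 < 1 - u / 2 by lra.
have h3 : (1 - u / 2) ^+ 2 <= (expR (- (u / 2))) ^+ 2.
  by rewrite ler_sqr ?nnegrE ?expR_ge0// ltW.
rewrite e2 invf_ple ?posrE ?exprn_gt0 ?expR_gt0//; last by nra.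
apply: le_trans h3.
rewrite -[leLHS]mul1r ler_pdivrMr; last by nra.
have : 0 <= u ^+ 2 * (1 - 3 * u + u ^+ 2) by apply: mulr_ge0; nra.
by nra.
Qed.

Lemma expR_sub1_le u : `|u| <= 3^-1 -> `|expR u - 1| <= 2 * `|u|.
Proof.
move=> u3; have := expR_le_quadratic u3; have := @expR_ge1Dx R u.
have : 0 <= `|u| by [].
have : u ^+ 2 = `|u| ^+ 2 by rewrite real_normK// num_real.
have : u <= `|u| by exact: ler_norm.
have : - u <= `|u| by rewrite -normrN; exact: ler_norm.
move=> a b c d e f.
rewrite ler_norml; apply/andP; split; nra.
Qed.

(** The price of passing from the logarithm of a product-limit factor to the
    corresponding jump of the cumulative hazard. *)
Lemma oppr_ln1B_approx x : 0 <= x <= 2^-1 -> `|- ln (1 - x) - x| <= 2 * x ^+ 2.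
Proof.
move=> /andP[x0 x1].
have le1 : ln (1 - x) <= - x by apply: le_ln1Dx; lra.
have le2 : - ln (1 - x) <= x / (1 - x).
  rewrite -lnV ?posrE; last by lra.
  have e : (1 - x)^-1 = 1 + x / (1 - x) by field; lra.
  rewrite [X in ln X]e.
  apply: le_ln1Dx; apply: (@lt_le_trans _ _ 0) => //.
  by apply: divr_ge0; lra.
have le3 : x / (1 - x) <= x + 2 * x ^+ 2.
  rewrite ler_pdivrMr; last by lra.
  have := mulr_ge0 x0 (mulr_ge0 x0 x0); have := sqr_ge0 x; nra.
rewrite ler_norml; apply/andP; split; last by lra.
have := sqr_ge0 x; lra.
Qed.

(** This keeps the mean of q / sqrt p over the order statistics of order q: a
    singularity of order 1/2 is integrable. *)
Lemma sum_invsqrt_le (n : nat) :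
  \sum_(0 <= k < n) (Num.sqrt ((n - k)%:R : R))^-1 <= 2 * Num.sqrt n%:R.
Proof.
have -> : \sum_(0 <= k < n) (Num.sqrt ((n - k)%:R : R))^-1 =
    \sum_(0 <= k < n) (Num.sqrt (k.+1%:R : R))^-1.
  rewrite big_nat_rev /=; apply: eq_big_nat => k kn; congr (Num.sqrt _%:R)^-1.
  by lia.
elim: n => [|n IH]; first by rewrite big_geq// mulr_ge0// sqrtr_ge0.
rewrite big_nat_recr//=; apply: (le_trans (lerD IH (lexx _))).
set a := Num.sqrt n%:R; set b := Num.sqrt n.+1%:R.
have a0 : 0 <= a by exact: sqrtr_ge0.
have b0 : 0 < b by rewrite sqrtr_gt0.
have a2 : a ^+ 2 = n%:R by rewrite sqr_sqrtr.
have b2 : b ^+ 2 = n%:R + 1 by rewrite sqr_sqrtr// natr1.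
have bi : b * b^-1 = 1 by rewrite divff// gt_eqF.
have bi0 : 0 < b^-1 by rewrite invr_gt0.
rewrite -(ler_pM2r b0) mulrDl mulVf ?gt_eqF//.
have : 0 <= (b - a) ^+ 2 by exact: sqr_ge0.
by nra.
Qed.

End elementary_inequalities.

(** * The product-limit estimator as a function of the rank *)

Section product_limit.
Context {R : realType}.

(** The product-limit estimator of 1 - G over the k smallest observations; [dl j]
    is the indicator attached to the one of rank j. *)
Definition km_prod (n : nat) (dl : nat -> bool) (k : nat) : R :=
  \prod_(0 <= j < k) (1 - (1 - (dl j)%:R) / (n - j)%:R).

Lemma km_factor_bounds n (b : bool) j : (j < n)%N ->
  0 <= 1 - (1 - b%:R) / (n - j)%:R :> R /\
  1 - (1 - b%:R) / (n - j)%:R <= 1 :> R.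
Proof.
move=> jn; have r1 : 1 <= (n - j)%:R :> R by rewrite ler1n subn_gt0.
have r0 : 0 < (n - j)%:R :> R by exact: lt_le_trans r1.
case: b; first by rewrite subrr mul0r subr0; split.
rewrite subr0 mul1r; split; last by rewrite gerBl invr_ge0 ltW.
by rewrite subr_ge0 invf_le1.
Qed.

Lemma km_prod_gt0 n (dl : nat -> bool) k : (k < n)%N -> 0 < km_prod n dl k.
Proof.
move=> kn; rewrite /km_prod big_nat_cond; apply: prodr_gt0 => j /andP[/andP[_ jk] _].
have r1 : 1 < (n - j)%:R :> R by rewrite ltr1n; lia.
have r0 : 0 < (n - j)%:R :> R by apply: lt_trans r1.
case: (dl j); first by rewrite subrr mul0r subr0.
by rewrite subr0 mul1r subr_gt0 invf_lt1.
Qed.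

Lemma km_prod_le1 n (dl : nat -> bool) k : (k <= n)%N -> km_prod n dl k <= 1.
Proof.
move=> kn; rewrite /km_prod big_nat_cond; apply: prodr_ile1 => j /andP[/andP[_ jk] _].
by apply/andP/km_factor_bounds; exact: leq_trans kn.
Qed.

(** With u k = (n - k) / km_prod k, a censored observation leaves u unchanged,
    and an uncensored one lowers it by 1 / km_prod k = 1 / km_prod k.+1.  Hence
    the sum telescopes, and it is controlled by the number of observations left
    although the single summands are unbounded. *)
Lemma km_tail n (dl : nat -> bool) k0 : (k0 <= n.-1)%N -> (0 < n)%N ->
  \sum_(k0 <= k < n.-1) (dl k)%:R / km_prod n dl k.+1
    <= (n - k0)%:R / km_prod n dl k0.
Proof.
move=> kn n0.
pose u k : R := (n - k)%:R / km_prod n dl k.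
have u0 k : (k < n)%N -> 0 <= u k by move=> ?; rewrite divr_ge0// ltW// km_prod_gt0.
have -> : \sum_(k0 <= k < n.-1) (dl k)%:R / km_prod n dl k.+1 = u k0 - u n.-1.
  rewrite -opprB -(telescope_sumr u kn) -sumrN; apply: eq_big_nat => k /andP[k1 k2].
  have g0 : km_prod n dl k != 0 by rewrite gt_eqF// km_prod_gt0//; lia.
  have r0 : (n - k)%:R != 0 :> R by rewrite pnatr_eq0; lia.
  have r1 : (n - k.+1)%:R != 0 :> R by rewrite pnatr_eq0; lia.
  have e : (n - k)%:R = (n - k.+1)%:R + 1 :> R.
    by rewrite natr1; congr _%:R; lia.
  rewrite /u /km_prod big_nat_recr//= -/(km_prod n dl k).
  case: (dl k); rewrite ?subrr ?mul0r ?subr0 ?mulr1 ?mul1r.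
    by rewrite e; field.
  move: r0; rewrite e => r0.
  by field; rewrite g0/= r0/=; apply/eqP; move/eqP : r1 => r1 h; apply: r1; rewrite -h; ring.
by rewrite gerBl u0//; lia.
Qed.

Lemma sum_partial_sums (a : nat -> R) m :
  \sum_(0 <= k < m) \sum_(0 <= j < k.+1) a j
    = \sum_(0 <= j < m) (m - j)%:R * a j.
Proof.
elim: m => [|m IH]; first by rewrite !big_geq.
rewrite big_nat_recr//= IH [RHS]big_nat_recr//= subSnn mul1r.
rewrite [in LHS]big_nat_recr//= addrA -big_split/=; congr (_ + _).
apply: eq_big_nat => j /andP[_ jm].
by rewrite subSn ?(ltnW jm)// -natr1 mulrDl mul1r.
Qed.

(** Here p k and L k are the values, at the order statistic of rank k, of the
    survival function of the observations and of the cumulative hazard of the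
    censoring variable; eps is the rate.  For a rank k below ks, - ln km_prod is
    a sum over j <= k of terms that differ from the increments of the empirical
    hazard by at most some a j, while the empirical hazard differs from L k by
    A eps / sqrt (p k).  Averaging over k, each a j is counted at most n - j
    times, and the sum of (n - j) a j is at most n c1 eps: the quadratic errors
    of the logarithm are summable against n - j, and those of replacing the
    proportion at risk by p j are A eps times a hazard, which is bounded.  The
    second error averages to O (eps) because p k is comparable with (n - k) / n.
    The ranks from ks on are few, and [km_tail] applies to them. *)
Lemma km_deviation (n ks : nat) (dl : nat -> bool) (p L : nat -> R)
    (eps g0 A B : R) :
  let c1 := 4 + A * (ln g0^-1 + 1) in
  0 < eps -> 0 < g0 <= 1 -> 1 <= A -> 2 * A <= B -> 12 * c1 <= B ->
  36 * A ^+ 2 * eps <= B -> eps <= 4^-1 -> 1 <= n%:R * eps ^+ 2 ->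
  (ks <= n)%N ->
  (forall k, (k < ks)%N -> B * eps <= p k) ->
  (forall k, (k < ks)%N -> `|(n - k)%:R / n%:R - p k| <= A * eps) ->
  (forall k, (k < ks)%N ->
     `|n%:R^-1 * \sum_(0 <= j < k.+1) (1 - (dl j)%:R) / p j - L k|
       <= A * eps / Num.sqrt (p k)) ->
  (forall k, (k < n)%N -> 0 <= L k <= ln g0^-1) ->
  (n - ks)%:R / n%:R <= 2 * (B * eps) ->
  n%:R^-1 * \sum_(0 <= k < n.-1)
      (dl k)%:R * `|(km_prod n dl k.+1)^-1 - expR (L k)|
    <= (2 / g0 * (c1 + 4 * A) + 2 * B * (4 / g0)) * eps.
Proof.
move=> c1 e0 /andP[g00 g01] A1 AB cB AeB e4 ne hks hp hR hM hL htail.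
set ell := ln g0^-1 in c1 cB hL *.
have ell0 : 0 <= ell by rewrite ln_ge0// invf_ge1.
have c14 : 4 <= c1 by rewrite /c1; nra.
have B48 : 48 <= B by lra.
have B0 : 0 < B by lra.
set th := B * eps in hp htail *.
have th0 : 0 < th by exact: mulr_gt0.
have n0 : (0 < n)%N.
  by rewrite lt0n; apply/eqP => n0; move: ne; rewrite n0 mul0r; lra.
set N : R := n%:R in hR hM ne htail *.
have N0 : 0 < N by rewrite ltr0n.
have Ne4 : 4 <= N * eps by nra.
have Nth : 1 <= N * th * eps.
  have : N * eps ^+ 2 * 1 <= N * eps ^+ 2 * B by rewrite ler_pM2l; nra.
  rewrite /th; nra.
pose r j : R := (n - j)%:R.
have Aeth : A * eps <= th / 2.
  by rewrite /th ler_pdivlMr// mulrAC ler_pM2r// mulrC.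
(* below ks, r j / N deviates from p j by at most th / 2, half of p j *)
have F1 j : (j < ks)%N -> N * th / 2 <= r j.
  move=> jk; have := hR j jk; rewrite ler_norml => /andP[h1 _].
  have h2 := hp j jk.
  have h3 : th / 2 <= r j / N by rewrite -/(r j) in h1; lra.
  by rewrite -mulrA mulrC -ler_pdivlMr.
have F1' j : (j < ks)%N -> 2 <= r j.
  move=> /F1; apply: le_trans; rewrite /th; nra.
have ksn : (ks <= n.-1)%N.
  rewrite leqNgt; apply/negP => h; have := F1' _ h.
  rewrite /r -subn1 subKn//; clear; lra.
have p0 j : (j < ks)%N -> 0 < p j by move=> /hp; exact: lt_le_trans.
have F2 j : (j < ks)%N -> r j / (4 * N) <= p j.
  move=> jk; have := hR j jk; rewrite -/(r j) ler_norml => /andP[_ h1].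
  have h2 := hp j jk; have h0 := p0 _ jk.
  rewrite invfM mulrCA; move: (r j / N) h1 h2 h0 Aeth => q; clear; lra.
(* the two errors contained in a j, weighted by r j *)
pose l j : R := - ln (1 - (1 - (dl j)%:R) / r j).
pose a j : R := `|l j - (1 - (dl j)%:R) / (N * p j)|.
have a0 j : 0 <= a j by exact: normr_ge0.
have F3 j : (j < ks)%N ->
    r j * a j <= 4 / (N * th) + A * eps * ((1 - (dl j)%:R) / p j).
  move=> jk; have rj2 := F1' _ jk; have rj0 : 0 < r j by lra.
  have pj0 := p0 _ jk.
  rewrite /a /l; case: (dl j).
    rewrite subrr !mul0r !subr0 ln1 oppr0 normr0 !mulr0 addr0.
    by rewrite divr_ge0// mulr_ge0// ltW.
  rewrite subr0 !mul1r.
  apply: (@le_trans _ _ (r j * (`|- ln (1 - (r j)^-1) - (r j)^-1|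
      + `|(r j)^-1 - (N * p j)^-1|))).
    rewrite ler_pM2l//; apply: le_trans (ler_normD _ _).
    by rewrite addrA subrK.
  rewrite mulrDr; apply: lerD.
    apply: (@le_trans _ _ (r j * (2 * (r j)^-1 ^+ 2))).
      rewrite ler_pM2l//; apply: oppr_ln1B_approx; rewrite invr_ge0 ltW//=.
      by rewrite lef_pV2 ?posrE.
    have -> : r j * (2 * (r j)^-1 ^+ 2) = 2 * (r j)^-1 by field; rewrite gt_eqF.
    have := F1 _ jk => h.
    have -> : 4 / (N * th) = 2 * (N * th / 2)^-1 by field; rewrite !gt_eqF.
    by rewrite ler_pM2l// lef_pV2 ?posrE// divr_gt0// mulr_gt0.
  rewrite -[X in X * `|_|](gtr0_norm rj0) -normrM.
  have -> : r j * ((r j)^-1 - (N * p j)^-1) = - (r j / N - p j) / p j.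
    by field; rewrite !gt_eqF.
  rewrite normrM normrN normfV (gtr0_norm pj0) ler_pM2r ?invr_gt0//.
  exact: hR.
(* F5 and F6 keep the exponents within the range of expR_sub1_le *)
have F5 k : (k < ks)%N -> A * eps / Num.sqrt (p k) <= 6^-1.
  move=> kk; have pk0 := p0 _ kk.
  rewrite ler_pdivrMr ?sqrtr_gt0// [leRHS]mulrC ler_pdivlMr//.
  have -> : A * eps * 6 = Num.sqrt ((A * eps * 6) ^+ 2).
    by rewrite sqrtr_sqr ger0_norm//; nra.
  rewrite ler_psqrt ?nnegrE ?sqr_ge0//; last exact: ltW.
  apply: le_trans (hp _ kk); rewrite /th.
  have -> : (A * eps * 6) ^+ 2 = (36 * A ^+ 2 * eps) * eps by ring.
  by rewrite ler_pM2r.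
(* the hazard up to rank ks is at most ell + 1, whence the constant c1 *)
pose V : R := N^-1 * \sum_(0 <= j < ks) r j * a j.
have F4 : V <= c1 * eps.
  rewrite /V.
  have h1 : \sum_(0 <= j < ks) r j * a j <=
     N * (4 * eps) + A * eps * \sum_(0 <= j < ks) (1 - (dl j)%:R) / p j.
    rewrite mulr_sumr; apply: (@le_trans _ _ (\sum_(0 <= j < ks)
        (4 / (N * th) + A * eps * ((1 - (dl j)%:R) / p j)))).
      by apply: ler_sum_nat => j /andP[_ ?]; exact: F3.
    rewrite big_split/=; apply: lerD => //.
    rewrite big_const_nat iter_addr_0 subn0 -[_ *+ ks]mulr_natl.
    apply: ler_pM => //.
    - by rewrite divr_ge0// ltW// mulr_gt0.
    - by rewrite ler_nat.
    - by rewrite ler_pM2l// -[leLHS]div1r ler_pdivrMr ?mulr_gt0// mulrC.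
  rewrite mulrC ler_pdivrMr//; apply: (le_trans h1).
  have h2 : \sum_(0 <= j < ks) (1 - (dl j)%:R) / p j <= N * (ell + 1).
    case: ks hks htail hp hR hM ksn F1 F1' p0 F2 F3 F5 V h1 => [|m] hks htail hp hR hM ksn F1 F1' p0 F2 F3 F5 V h1.
      by rewrite big_geq// mulr_ge0 ?ltW// ltr_wpDl.
    have mm : (m < m.+1)%N by [].
    have := hM _ mm; rewrite ler_norml => /andP[_ h].
    have h3 := F5 _ mm.
    have /andP[_ h4] := hL m (leq_trans mm hks).
    by rewrite mulrC -ler_pdivrMr// mulrC; lra.
  have h3 : A * eps * \sum_(0 <= j < ks) (1 - (dl j)%:R) / p j
     <= A * eps * (N * (ell + 1)) by rewrite ler_pM2l//; nra.
  by rewrite /c1; lra.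
have V0 : 0 <= V.
  by rewrite mulr_ge0 ?invr_ge0 ?(ltW N0)//; apply: sumr_ge0 => j _; rewrite mulr_ge0.
have NV : \sum_(0 <= j < ks) r j * a j = N * V.
  by rewrite /V mulrA divff ?gt_eqF// mul1r.
(* r is decreasing and at least N th / 2, so that V controls the sum of a *)
have F6 k : (k < ks)%N -> \sum_(0 <= j < k.+1) a j <= 6^-1.
  move=> kk.
  have h1 : r k * \sum_(0 <= j < k.+1) a j <= N * V.
    rewrite -NV mulr_sumr (big_cat_nat _ kk)//=.
    apply: ler_wpDr; first by apply: sumr_ge0 => j _; rewrite mulr_ge0.
    apply: ler_sum_nat => j /andP[_ jk]; apply: ler_wpM2r => //.
    by rewrite ler_nat leq_sub2l.
  have s0 : 0 <= \sum_(0 <= j < k.+1) a j by exact: sumr_ge0.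
  have h2 := F1 _ kk.
  have h3 : (N * th / 2) * \sum_(0 <= j < k.+1) a j <= N * V.
    by apply: le_trans h1; apply: ler_wpM2r.
  have h4 : th / 2 * \sum_(0 <= j < k.+1) a j <= V.
    by rewrite -(ler_pM2l N0) mulrA mulrA.
  have h5 : th / 2 * \sum_(0 <= j < k.+1) a j <= th / 12.
    apply: (le_trans h4); apply: (le_trans F4); rewrite /th.
    by rewrite mulrAC ler_pM2r//; lra.
  by rewrite -(ler_pM2l th0); lra.
pose Lh k := \sum_(0 <= j < k.+1) l j.
have kmE k : (k < ks)%N -> (km_prod n dl k.+1)^-1 = expR (Lh k).
  move=> kk; rewrite /Lh expR_sum /km_prod -prodfV.
  apply: eq_big_nat => j /andP[_ jk].
  rewrite /l expRN lnK// posrE -/(r j).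
  have h := F1' j (leq_trans jk kk).
  case: (dl j); first by rewrite subrr mul0r subr0.
  by rewrite subr0 mul1r subr_gt0 invf_lt1; move: h; clear; lra.
have F7 k : (k < ks)%N ->
    `|Lh k - L k| <= \sum_(0 <= j < k.+1) a j + A * eps / Num.sqrt (p k).
  move=> kk.
  have -> : Lh k - L k = (Lh k - \sum_(0 <= j < k.+1) (1 - (dl j)%:R) / (N * p j))
    + (\sum_(0 <= j < k.+1) (1 - (dl j)%:R) / (N * p j) - L k) by ring.
  apply: le_trans (ler_normD _ _) _; apply: lerD.
    by rewrite /Lh -sumrB; exact: ler_norm_sum.
  have -> : \sum_(0 <= j < k.+1) (1 - (dl j)%:R) / (N * p j)
     = N^-1 * \sum_(0 <= j < k.+1) (1 - (dl j)%:R) / p j.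
    rewrite mulr_sumr; apply: eq_bigr => j _.
    by rewrite invfM mulrCA.
  exact: hM.
have eL k : (k < n)%N -> expR (L k) <= g0^-1.
  move=> /hL /andP[_ h]; rewrite -[leRHS](@lnK R) ?posrE ?invr_gt0//.
  by rewrite ler_expR.
have F8 k : (k < ks)%N -> `|(km_prod n dl k.+1)^-1 - expR (L k)|
    <= 2 / g0 * (\sum_(0 <= j < k.+1) a j + A * eps / Num.sqrt (p k)).
  move=> kk; rewrite kmE//.
  have h7 := F7 _ kk.
  have -> : expR (Lh k) - expR (L k) = expR (L k) * (expR (Lh k - L k) - 1).
    by rewrite mulrBr mulr1 -expRD addrCA subrr addr0.
  rewrite normrM ger0_norm ?expR_ge0//.
  have h8 : `|expR (Lh k - L k) - 1| <= 2 * `|Lh k - L k|.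
    apply: expR_sub1_le; apply: (le_trans h7).
    by have := F6 _ kk; have := F5 _ kk; lra.
  have -> : 2 / g0 * (\sum_(0 <= j < k.+1) a j + A * eps / Num.sqrt (p k)) =
    g0^-1 * (2 * (\sum_(0 <= j < k.+1) a j + A * eps / Num.sqrt (p k))) by ring.
  apply: ler_pM; [exact: expR_ge0 | exact: normr_ge0 | |].
    by apply: eL; exact: leq_trans kk hks.
  by apply: (le_trans h8); rewrite ler_pM2l.
(* the starting value of the telescoping tail; ks = 0 gives an empty product *)
have kmks : (km_prod n dl ks)^-1 <= 3 / g0.
  have g1 : 1 <= g0^-1 by rewrite invf_ge1.
  case: ks hks kmE F5 F6 F7 {hp hR hM htail F1 F1' ksn p0 F2 F3 V F4 V0 NV F8} => [|m] hks kmE F5 F6 F7.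
    by rewrite /km_prod big_geq// invr1; lra.
  have mm : (m < m.+1)%N by [].
  rewrite kmE//.
  have h7 := F7 _ mm; have h6 := F6 _ mm; have h5 := F5 _ mm.
  have -> : Lh m = L m + (Lh m - L m) by ring.
  rewrite expRD mulrC.
  have h1 := eL m (leq_trans mm hks).
  have n3 : `|Lh m - L m| <= 3^-1 by lra.
  have h2 := expR_le_quadratic n3.
  have h4 : expR (Lh m - L m) <= 3.
    apply: (le_trans h2); move: n3; rewrite ler_norml.
    by move: (Lh m - L m) => u /andP[? ?]; nra.
  by apply: ler_pM => //; rewrite expR_ge0.
rewrite (@big_cat_nat _ _ _ ks)//= mulrDr mulrDl; apply: lerD.
  rewrite mulrC ler_pdivrMr//.
  apply: (@le_trans _ _ (\sum_(0 <= k < ks) 2 / g0 *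
     (\sum_(0 <= j < k.+1) a j + A * eps / Num.sqrt (p k)))).
    apply: ler_sum_nat => k /andP[_ kk].
    by apply: le_trans (F8 _ kk); case: (dl k); rewrite ?mul1r ?mul0r.
  rewrite -mulr_sumr -!mulrA ler_pM2l// ler_pM2l ?invr_gt0//.
  rewrite big_split/= mulrDl; apply: lerD.
    apply: (@le_trans _ _ (N * V)); last by rewrite mulrC [X in _ <= X]mulrA ler_pM2r.
    rewrite sum_partial_sums -NV; apply: ler_sum_nat => j /andP[_ jk].
    by apply: ler_wpM2r => //; rewrite ler_nat leq_sub2r.
  rewrite -mulr_sumr.
  have h1 : \sum_(0 <= k < ks) (Num.sqrt (p k))^-1 <= 4 * N.
    apply: (@le_trans _ _ (\sum_(0 <= k < n) 2 * Num.sqrt N * (Num.sqrt (r k))^-1)).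
      rewrite [leRHS](big_cat_nat _ hks)//=.
      apply: ler_wpDr.
        by apply: sumr_ge0 => j _; rewrite mulr_ge0 ?invr_ge0 ?sqrtr_ge0// mulr_ge0// sqrtr_ge0.
      apply: ler_sum_nat => k /andP[_ kk].
      have rk0 : 0 < r k by have := F1' _ kk; lra.
      have sr0 : 0 < Num.sqrt (r k) by rewrite sqrtr_gt0.
      have sN0 : 0 < Num.sqrt N by rewrite sqrtr_gt0.
      have -> : 2 * Num.sqrt N * (Num.sqrt (r k))^-1 = (Num.sqrt (r k) / (2 * Num.sqrt N))^-1.
        by rewrite invfM invrK mulrC.
      rewrite lef_pV2 ?posrE ?sqrtr_gt0 ?p0//; last by rewrite divr_gt0// mulr_gt0.
      apply: (@le_trans _ _ (Num.sqrt (r k / (4 * N)))).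
        rewrite sqrtrM ?(ltW rk0)// sqrtrV ?sqrtrM//; last by rewrite mulr_ge0// ltW.
        rewrite (_ : Num.sqrt 4 = 2)//.
        by rewrite (_ : 4 = 2 ^+ 2 :> R) ?sqrtr_sqr ?ger0_norm//; ring.
      by rewrite ler_sqrt ?F2// ltW// p0.
    rewrite -mulr_sumr.
    apply: (@le_trans _ _ (2 * Num.sqrt N * (2 * Num.sqrt N))).
      rewrite ler_pM2l ?mulr_gt0 ?sqrtr_gt0//; exact: sum_invsqrt_le.
    have -> : 2 * Num.sqrt N * (2 * Num.sqrt N) = 4 * Num.sqrt N ^+ 2 by ring.
    by rewrite sqr_sqrtr ?(ltW N0).
  apply: (@le_trans _ _ (A * eps * (4 * N))); last by rewrite mulrA; lra.
  by rewrite ler_pM2l//; nra.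
(* beyond ks both weights are bounded separately, without cancellation *)
have tail2 : \sum_(ks <= k < n.-1) (dl k)%:R *
    `|(km_prod n dl k.+1)^-1 - expR (L k)| <= r ks * (4 / g0).
  apply: (@le_trans _ _ (\sum_(ks <= k < n.-1)
      ((dl k)%:R / km_prod n dl k.+1 + g0^-1))).
    apply: ler_sum_nat => k /andP[k1 k2].
    have h1 : 0 <= (km_prod n dl k.+1)^-1.
      by rewrite invr_ge0 ltW// km_prod_gt0// -ltn_predRL.
    have h2 : expR (L k) <= g0^-1 by apply/eL/(leq_trans k2)/leq_pred.
    have h3 := expR_ge0 (L k).
    case: (dl k); last by rewrite !mul0r add0r invr_ge0 ltW.
    by rewrite !mul1r ler_norml; apply/andP; split; lra.
  rewrite big_split/= big_const_nat iter_addr_0.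
  have -> : r ks * (4 / g0) = r ks * (3 / g0) + r ks * g0^-1 by ring.
  apply: lerD.
    apply: (le_trans (km_tail dl ksn n0)); rewrite -/(r ks).
    by apply: ler_wpM2l => //; exact: ler0n.
  rewrite -[_ *+ (_ - _)]mulr_natl; apply: ler_wpM2r; first by rewrite invr_ge0 ltW.
  by rewrite ler_nat leq_sub2r ?leq_pred.
have : N^-1 * (\sum_(ks <= k < n.-1) (dl k)%:R *
    `|(km_prod n dl k.+1)^-1 - expR (L k)|) <= N^-1 * (r ks * (4 / g0)).
  by rewrite ler_pM2l ?invr_gt0.
move/le_trans; apply.
have -> : N^-1 * (r ks * (4 / g0)) = r ks / N * (4 / g0) by ring.
have -> : 2 * B * (4 / g0) * eps = 2 * (B * eps) * (4 / g0) by ring.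
by rewrite ler_pM2r// divr_gt0.
Qed.

End product_limit.

(** * Ranks of a sample without ties *)

Section ranks.
Context {R : realType}.
Variables (n : nat) (y : nat -> R).
Hypothesis y_inj : forall i j, (i < n)%N -> (j < n)%N -> y i = y j -> i = j.

Local Notation rk := (rank_idx n y).

Let s := sort (fun i j => y i <= y j) (iota 0 n).

Let perm_s : perm_eq s (iota 0 n).
Proof. by rewrite /s perm_sort. Qed.

Let size_s : size s = n.
Proof. by rewrite (perm_size perm_s) size_iota. Qed.

Lemma rank_idx_lt k : (k < n)%N -> (rk k < n)%N.
Proof.
move=> kn; have : nth 0%N s k \in s by rewrite mem_nth// size_s.
by rewrite (perm_mem perm_s) mem_iota.
Qed.

Lemma rank_idx_le j k : (j < n)%N -> (k < n)%N ->
  (y (rk j) <= y (rk k)) = (j <= k)%N.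
Proof.
have ss : sorted (fun i j => y i <= y j) s.
  by apply: sort_sorted => a b /=; exact: le_total.
have tr : transitive (fun i j => y i <= y j) by move=> b a c; exact: le_trans.
have re : reflexive (fun i j => y i <= y j) by move=> a; exact: lexx.
have us : uniq s by rewrite (perm_uniq perm_s) iota_uniq.
have mono a b : (a <= b)%N -> (b < n)%N -> y (rk a) <= y (rk b).
  move=> ab bn; apply: (sorted_leq_nth tr re 0%N ss) => //.
    by rewrite inE size_s (leq_ltn_trans ab).
  by rewrite inE size_s.
move=> jn kn; apply/idP/idP => [h|]; last by move=> ?; exact: mono.
rewrite leqNgt; apply/negP => kj.
have e : y (rk j) = y (rk k) by apply/eqP; rewrite eq_le h mono// ltnW.
have := y_inj (rank_idx_lt jn) (rank_idx_lt kn) e.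
by move/eqP; rewrite nth_uniq ?size_s// => /eqP jk; rewrite jk ltnn in kj.
Qed.

Lemma sum_rank_idx (phi : nat -> R) :
  \sum_(i < n) phi i = \sum_(0 <= k < n) phi (rk k).
Proof.
rewrite -(big_mkord xpredT phi) /index_iota subn0.
have -> : \sum_(i <- iota 0 n) phi i = \sum_(i <- s) phi i.
  by apply/esym; exact: perm_big perm_s.
by rewrite (big_nth 0%N) size_s /index_iota subn0.
Qed.

Lemma sum_rank_idx_le (phi : nat -> R) k : (k < n)%N ->
  \sum_(i < n) (y i <= y (rk k))%R%:R * phi i = \sum_(0 <= j < k.+1) phi (rk j).
Proof.
move=> kn; rewrite (sum_rank_idx (fun i => (y i <= y (rk k))%R%:R * phi i)).
rewrite (big_cat_nat _ kn)//= [X in _ + X](_ : _ = 0) ?addr0; last first.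
  rewrite big_nat_cond big1// => j /andP[/andP[kj jn] _]; rewrite rank_idx_le//.
  by rewrite leqNgt kj mul0r.
apply: eq_big_nat => j /andP[_ jk].
by rewrite rank_idx_le ?(leq_trans jk)// -ltnS jk mul1r.
Qed.

Lemma card_rank_idx_ge k : (k < n)%N ->
  \sum_(i < n) (y (rk k) <= y i)%R%:R = (n - k)%:R :> R.
Proof.
move=> kn; rewrite (sum_rank_idx (fun i => (y (rk k) <= y i)%R%:R)).
rewrite (big_cat_nat _ (ltnW kn))//= [X in X + _](_ : _ = 0) ?add0r; last first.
  rewrite big_nat_cond big1// => j /andP[/andP[_ jk] _]; rewrite rank_idx_le ?(ltn_trans jk)//.
  by rewrite leqNgt jk.
rewrite big_nat_cond (eq_bigr (fun=> 1)) -?big_nat_cond; last first.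
  by move=> j /andP[/andP[kj jn] _]; rewrite rank_idx_le// kj.
by rewrite big_const_nat iter_addr_0.
Qed.

(** The exponents in the definition select the ranks up to k.  Its strict
    inequality sends the largest observation to 0, hence the bound n.-1. *)
Lemma kaplan_meier_rank (dl : nat -> bool) k : (k < n)%N ->
  kaplan_meier n y dl (y (rk k)) =
  if (k < n.-1)%N then km_prod n (dl \o rk) k.+1 else 0.
Proof.
move=> kn; have n0 : (0 < n)%N by case: (n) kn.
have n1n : (n.-1 < n)%N by rewrite prednK.
rewrite /kaplan_meier ltNge rank_idx_le// -ltnNge.
case: ifP => // kn1.
rewrite -(big_mkord xpredT (fun k0 => (1 - (1 - (dl (rk k0))%:R) / (n - k0)%:R) ^+
   (y (rk k0) <= y (rk k))%R)) (big_cat_nat _ kn)//=.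
rewrite [X in _ * X](_ : _ = 1) ?mulr1; last first.
  rewrite big_nat_cond big1// => j /andP[/andP[kj jn] _]; rewrite rank_idx_le//.
  by rewrite leqNgt kj expr0.
apply: eq_big_nat => j /andP[_ jk].
by rewrite rank_idx_le ?(leq_trans jk)// -ltnS jk expr1.
Qed.

End ranks.

(** * Measurability and transfer of integrals *)

Lemma measurable_invr {R : realType} : measurable_fun setT (@GRing.inv R).
Proof.
have -> : [set: R] = [set x | x != 0] `|` [set 0].
  by apply/seteqP; split => x //= _; have [->|] := eqVneq x 0; [right|left].
have o : open [set x : R | x != 0] by exact: open_neq.
apply/measurable_funU; [exact: open_measurable|exact: measurable_set1|split].
  apply: open_continuous_measurable_fun => // x; rewrite inE /= => x0.
  exact: inv_continuous.
exact: measurable_fun_set1.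
Qed.

Lemma measurable_funV {R : realType} {d} {T : measurableType d} (f : T -> R) :
  measurable_fun setT f -> measurable_fun setT (fun x => (f x)^-1).
Proof. by move=> mf; apply: (measurableT_comp measurable_invr). Qed.

Section boolean_indicators.
Context {R : realType} {d : measure_display} {T : measurableType d}.

Lemma measurable_natb (b : T -> bool) : measurable [set x | b x] ->
  measurable_fun setT (fun x => (b x)%:R : R).
Proof.
move=> mb; have -> : (fun x => (b x)%:R : R) = \1_[set x | b x].
  by apply/funext => x; rewrite indicE; congr (nat_of_bool _)%:R;
    apply/idP/idP; rewrite inE.
exact: measurable_indic.
Qed.

Lemma Rintegral_natb (m : {measure set T -> \bar R}) (b : T -> bool) :
  measurable [set x | b x] -> \int[m]_x ((b x)%:R : R) = fine (m [set x | b x]).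
Proof.
move=> mb; have -> : (fun x => (b x)%:R : R) = \1_[set x | b x].
  by apply/funext => x; rewrite indicE; congr (nat_of_bool _)%:R;
    apply/idP/idP; rewrite inE.
by rewrite /Rintegral integral_indic// setIT.
Qed.

End boolean_indicators.

Section rays.
Context {R : realType}.
Implicit Types s t : R.

Lemma measurable_set_ge t : measurable [set c : R | (t <= c)%R].
Proof.
have -> : [set c : R | (t <= c)%R] = `[t, +oo[%classic.
  by apply/seteqP; split => c /=; rewrite in_itv/= andbT.
exact: measurable_itv.
Qed.

Lemma measurable_set_gt t : measurable [set c : R | (t < c)%R].
Proof.
have -> : [set c : R | (t < c)%R] = `]t, +oo[%classic.
  by apply/seteqP; split => c /=; rewrite in_itv/= andbT.
exact: measurable_itv.
Qed.

End rays.

Lemma measurable_set_ltf {R : realType} {d} {T : measurableType d} (f g : T -> R) :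
  measurable_fun setT f -> measurable_fun setT g ->
  measurable [set x | (f x < g x)%R].
Proof.
move=> mf mg; have mh : measurable_fun setT (fun x => g x - f x).
  exact: measurable_funB.
have -> : [set x | (f x < g x)%R] = (fun x => g x - f x) @^-1` [set c | (0 < c)%R].
  by apply/seteqP; split => x /=; rewrite subr_gt0.
rewrite -[X in measurable X]setTI; apply: mh => //; exact: measurable_set_gt.
Qed.

Lemma measurable_set_lef {R : realType} {d} {T : measurableType d} (f g : T -> R) :
  measurable_fun setT f -> measurable_fun setT g ->
  measurable [set x | (f x <= g x)%R].
Proof.
move=> mf mg; have mh : measurable_fun setT (fun x => g x - f x).
  exact: measurable_funB.
have -> : [set x | (f x <= g x)%R] = (fun x => g x - f x) @^-1` [set c | (0 <= c)%R].
  by apply/seteqP; split => x /=; rewrite subr_ge0.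
rewrite -[X in measurable X]setTI; apply: mh => //; exact: measurable_set_ge.
Qed.

Lemma measurable_set_le {R : realType} (t : R) : measurable [set c : R | (c <= t)%R].
Proof. exact: measurable_set_lef. Qed.

Lemma measurable_set_oc {R : realType} (s t : R) :
  measurable [set c : R | (s < c <= t)%R].
Proof.
have -> : [set c : R | (s < c <= t)%R] = `]s, t]%classic.
  by apply/seteqP; split => c /=; rewrite in_itv.
exact: measurable_itv.
Qed.

Lemma measurable_bigprod {R : realType} {d} {T : measurableType d} (I : Type)
    (r : seq I) (p : pred I) (f : I -> T -> R) :
  (forall i, measurable_fun setT (f i)) ->
  measurable_fun setT (fun x => \prod_(i <- r | p i) f i x).
Proof.
move=> mf; elim: r => [|i r IH].
  by under eq_fun do rewrite big_nil; exact: measurable_cst.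
under eq_fun do rewrite big_cons.
by case: (p i) => //; exact: measurable_funM.
Qed.

Lemma measurable_bigsum {R : realType} {d} {T : measurableType d} (I : Type)
    (r : seq I) (f : I -> T -> R) :
  (forall i, measurable_fun setT (f i)) ->
  measurable_fun setT (fun x => \sum_(i <- r) f i x).
Proof.
move=> mf; elim: r => [|i r IH].
  by under eq_fun do rewrite big_nil; exact: measurable_cst.
by under eq_fun do rewrite big_cons; exact: measurable_funD.
Qed.

Section transfer.
Import HBSimple HBNNSimple.
Context {R : realType} {d1 d2 d : measure_display}.
Context {T1 : measurableType d1} {T2 : measurableType d2} {S : measurableType d}.
Variables (m1 : {measure set T1 -> \bar R}) (m2 : {measure set T2 -> \bar R}).
Variables (p1 : T1 -> S) (p2 : T2 -> S) (v1 : T1 -> R) (v2 : T2 -> R).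
Hypotheses (mp1 : measurable_fun setT p1) (mp2 : measurable_fun setT p2).
Hypotheses (mv1 : measurable_fun setT v1) (mv2 : measurable_fun setT v2).
Hypotheses (v1_ge0 : forall x, 0 <= v1 x) (v2_ge0 : forall x, 0 <= v2 x).

Hypothesis transfer_indic : forall A, measurable A ->
  (\int[m1]_x (v1 x * \1_A (p1 x))%:E = \int[m2]_x (v2 x * \1_A (p2 x))%:E)%E.

Let int_nnsfun d' (T : measurableType d') (m : {measure set T -> \bar R})
    (p : T -> S) (v : T -> R) (f : {nnsfun S >-> R}) :
  measurable_fun setT p -> measurable_fun setT v -> (forall x, 0 <= v x) ->
  (\int[m]_x (v x * f (p x))%:E =
   \sum_(y \in range f) y%:E * \int[m]_x (v x * \1_(f @^-1` [set y]) (p x))%:E)%E.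
Proof.
move=> mp mv v0.
have mi A : measurable A -> measurable_fun setT (fun x => (v x * \1_A (p x))%:E : \bar R).
  move=> mA; apply/measurable_EFinP; apply: measurable_funM => //.
  by apply: measurableT_comp.
transitivity (\int[m]_x (\sum_(y \in range f)
    y%:E * (v x * \1_(f @^-1` [set y]) (p x))%:E)%E)%E.
  apply: eq_integral => x _; rewrite fimfunE.
  rewrite fsumEFin// mulr_fsumr; congr EFin.
  by apply: eq_fsbigr => y _; rewrite mulrCA.
rewrite ge0_integral_fsum//; last 2 first.
- by move=> y; apply: measurable_funeM; exact: mi.
- move=> y x _; rewrite EFinM muleCA mule_ge0 ?lee_fin//.
  exact: nnfun_muleindic_ge0.
apply: eq_fsbigr => y; rewrite inE => -[s _ <-].
by rewrite ge0_integralZl//; [exact: mi|move=> x _; rewrite lee_fin mulr_ge0|rewrite lee_fin].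
Qed.

(** Both sides are limits along the same simple functions increasing to g, so
    that agreement on indicators is enough.  The weights v1 and v2 make the
    statement serve for densities, for affine substitutions and for freezing
    all factors of a product but one. *)
Lemma ge0_integral_transfer (g : S -> R) :
  measurable_fun setT g -> (forall s, 0 <= g s) ->
  (\int[m1]_x (v1 x * g (p1 x))%:E = \int[m2]_x (v2 x * g (p2 x))%:E)%E.
Proof.
move=> mg g0.
have mEg : measurable_fun setT (EFin \o g) by exact/measurable_EFinP.
pose a := nnsfun_approx measurableT mEg.
have key d' (T : measurableType d') (m : {measure set T -> \bar R})
    (p : T -> S) (v : T -> R) :
  measurable_fun setT p -> measurable_fun setT v -> (forall x, 0 <= v x) ->
  ((\int[m]_x (v x * a n (p x))%:E)%E @[n --> \oo] -->
    (\int[m]_x (v x * g (p x))%:E)%E).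
  move=> mp mv v0.
  have -> : (\int[m]_x (v x * g (p x))%:E)%E =
      (\int[m]_x limn (fun n => (v x * a n (p x))%:E))%E.
    apply: eq_integral => x _; apply/esym/cvg_lim => //.
    have h : (a n (p x))%:E @[n --> \oo] --> (g (p x))%:E.
      by apply: (cvg_nnsfun_approx measurableT mEg) => // ? _; rewrite lee_fin.
    apply: (cvg_trans _ (cvgeZl (_ : (v x)%:E \is a fin_num) h)) => //.
  apply: cvg_monotone_convergence => //.
  - move=> n; apply/measurable_EFinP; apply: measurable_funM => //.
    exact: measurableT_comp.
  - by move=> n x _; rewrite lee_fin mulr_ge0.
  - move=> x _ n k nk; rewrite lee_fin ler_wpM2l//.
    by have /lefP := nd_nnsfun_approx measurableT mEg nk; exact.
have := key _ _ m1 _ _ mp1 mv1 v1_ge0.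
have := key _ _ m2 _ _ mp2 mv2 v2_ge0.
have -> : (fun n => (\int[m1]_x (v1 x * a n (p1 x))%:E)%E) =
  (fun n => (\int[m2]_x (v2 x * a n (p2 x))%:E)%E).
  apply/funext => n; rewrite !int_nnsfun//.
  by apply: eq_fsbigr => y _; rewrite transfer_indic.
by move=> h2 h1; exact: (cvg_unique _ h1 h2).
Qed.

End transfer.

(** * Independence of the observed triples *)

Section independent_pairs.
Context {R : realType} {d d1 d2 : measure_display}.
Context {Omega : measurableType d} {S1 : measurableType d1} {S2 : measurableType d2}.
Variable P : probability Omega R.
Variables (Z1 : nat -> Omega -> S1) (Z2 : nat -> Omega -> S2).
Hypotheses (mZ1 : forall i, measurable_fun setT (Z1 i))
           (mZ2 : forall i, measurable_fun setT (Z2 i)).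
Variables (mu1 : probability S1 R) (mu2 : probability S2 R).
Hypothesis Z1_law : forall i A, measurable A -> P (Z1 i @^-1` A) = mu1 A.
Hypothesis Z2_law : forall i A, measurable A -> P (Z2 i @^-1` A) = mu2 A.
Hypotheses (Z1_indep : mutually_independent P Z1)
           (Z2_indep : mutually_independent P Z2)
           (Z12_indep : independent_seqs P Z1 Z2).

Let W i w := (Z1 i w, Z2 i w).
Local Notation Q := (mu1 \x mu2)%E.

Let mW i : measurable_fun setT (W i).
Proof. exact: measurable_fun_pair. Qed.

Let prod_EFin (I : Type) (r : seq I) (x : I -> R) :
  (\prod_(i <- r) (x i)%:E)%E = (\prod_(i <- r) x i)%:E.
Proof. by apply/esym; exact: (big_morph EFin (@EFinM R) erefl). Qed.

Let gen_sigma_bigcap d' (S : measurableType d') (Z : nat -> Omega -> S)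
    (A : nat -> set S) (J : seq nat) : (forall i, measurable (A i)) ->
  gen_sigma_seq Z (\bigcap_(j in [set` J]) (Z j @^-1` A j)).
Proof.
move=> mA; rewrite /gen_sigma_seq.
set G := \bigcup_i _.
have : measurable ((\bigcap_(j in [set` J]) (Z j @^-1` A j))
    : set (g_sigma_algebraType G)).
  apply: fin_bigcap_measurable => // j _.
  apply: sub_sigma_algebra; exists j => //.
  by exists (A j) => //; rewrite setTI.
by [].
Qed.

Let Q_rect A B : measurable A -> measurable B ->
  fine (Q (A `*` B)) = fine (mu1 A) * fine (mu2 B).
Proof.
move=> mA mB; rewrite product_measure1E//.
by rewrite -fineM// fin_num_measure.
Qed.

Let independent_rect n (A : nat -> set S1) (B : nat -> set S2) :
  (forall i, measurable (A i)) -> (forall i, measurable (B i)) ->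
  P [set w | forall i, (i < n)%N -> (A i `*` B i) (W i w)] =
  (\prod_(i < n) fine (Q (A i `*` B i)))%:E.
Proof.
move=> mA mB.
pose EA := \bigcap_(j in [set` iota 0 n]) (Z1 j @^-1` A j).
pose EB := \bigcap_(j in [set` iota 0 n]) (Z2 j @^-1` B j).
have -> : [set w | forall i, (i < n)%N -> (A i `*` B i) (W i w)] = EA `&` EB.
  apply/seteqP; split => [w h|w [ha hb] i ni].
    by split=> j /=; rewrite mem_iota/= => jn; have [] := h j jn.
  by split; [apply: ha|apply: hb]; rewrite /= mem_iota.
rewrite Z12_indep; [|exact: gen_sigma_bigcap..].
rewrite Z1_indep ?iota_uniq//; last by move=> j _; exists (A j) => //; rewrite setTI.
rewrite Z2_indep ?iota_uniq//; last by move=> j _; exists (B j) => //; rewrite setTI.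
rewrite (eq_bigr (fun j => (fine (mu1 (A j)))%:E)); last first.
  by move=> j _; rewrite Z1_law// fineK// fin_num_measure.
rewrite [X in (_ * X)%E](eq_bigr (fun j => (fine (mu2 (B j)))%:E)); last first.
  by move=> j _; rewrite Z2_law// fineK// fin_num_measure.
rewrite !prod_EFin -EFinM -big_split/= -(big_mkord xpredT
  (fun i => fine (Q (A i `*` B i)))) /index_iota subn0.
by congr EFin; apply: eq_bigr => j _; rewrite Q_rect.
Qed.

Let measurable_constraints n (k : nat) (D : nat -> set (S1 * S2)) :
  (forall i, measurable (D i)) ->
  measurable [set w | forall i, (i < n)%N -> i != k -> D i (W i w)].
Proof.
move=> mD.
have -> : [set w | forall i, (i < n)%N -> i != k -> D i (W i w)] =
   \bigcap_(i in [set i | (i < n)%N && (i != k)]) (W i @^-1` D i).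
  apply/seteqP; split => [w h i /= /andP[]|w h i ni ik]; first exact: h.
  by apply: h; apply/andP.
apply: bigcap_measurableType => i _.
by rewrite -[X in measurable X]setTI; exact: mW.
Qed.

Let Q_setT : Q setT = 1%E.
Proof.
rewrite -setXTT product_measure1E//.
transitivity ((mu1 setT) * (mu2 setT))%E; first by []. by rewrite !probability_setT mule1.
Qed.

Let Q_ge0 A : 0 <= fine (Q A). Proof. exact: fine_ge0. Qed.

Let Q_fin A : measurable A -> Q A \is a fin_num.
Proof.
move=> mA; rewrite ge0_fin_numE//.
apply: (@le_lt_trans _ _ (Q setT)); first by apply: le_measure; rewrite ?inE.
by rewrite Q_setT ltry.
Qed.

(** Independence is assumed on rectangles only.  The first k of them are
    replaced by arbitrary sets one index at a time: with the other constraints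
    fixed, both sides are finite measures of the remaining set, and they agree
    on rectangles by induction. *)
Let independent_sets_upto n k (D : nat -> set (S1 * S2)) :
  (forall i, measurable (D i)) ->
  (forall i, (k <= i < n)%N -> exists A B, [/\ measurable A, measurable B & D i = A `*` B]) ->
  P [set w | forall i, (i < n)%N -> D i (W i w)] =
  (\prod_(i < n) fine (Q (D i)))%:E.
Proof.
elim: k D => [|k IH] D mD rD.
  have : forall i, exists AB : set S1 * set S2, [/\ measurable AB.1, measurable AB.2 &
      (i < n)%N -> D i = AB.1 `*` AB.2].
    move=> i; have [ni|_] := boolP (i < n)%N; last first.
      by exists (setT, setT); split=> /=; [exact: measurableT|exact: measurableT|].
    by have [A [B [mA mB e]]] := rD i ni; exists (A, B); split.
  move=> /choice[AB hAB].
  have := @independent_rect n (fun i => (AB i).1) (fun i => (AB i).2).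
  move=> /(_ (fun i => let: And3 a _ _ := hAB i in a)).
  move=> /(_ (fun i => let: And3 _ a _ := hAB i in a)).
  have -> : [set w | forall i, (i < n)%N -> ((AB i).1 `*` (AB i).2) (W i w)] =
      [set w | forall i, (i < n)%N -> D i (W i w)].
    by apply/seteqP; split => w h i ni; have [_ _ e] := hAB i;
      [rewrite e//; exact: h|rewrite -e//; exact: h].
  move=> ->; congr EFin; apply: eq_bigr => i _.
  by have [_ _ <-] := hAB i.
have [kn|nk] := ltnP k n; last first.
  by apply: IH => // i /andP[ki ni]; move: (leq_trans nk ki); rewrite leqNgt ni.
pose k0 := Ordinal kn.
pose c := \prod_(i < n | i != k0) fine (Q (D i)).
have c0 : 0 <= c by apply: prodr_ge0.
pose Rest := [set w | forall i, (i < n)%N -> i != k -> D i (W i w)].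
have mRest : measurable Rest by exact: measurable_constraints.
pose m1 := pushforward (mrestr P mRest) (W k).
pose m2 := mscale (NngNum c0) Q.
have upd E : measurable E -> m1 E =
   P [set w | forall i, (i < n)%N -> (if i == k then E else D i) (W i w)].
  move=> mE; rewrite /m1 /pushforward /mrestr; congr (P _).
  apply/seteqP; split => [w [/= he hr] i ni|w h].
    by case: eqP => [->//|/eqP ik]; exact: hr.
  split; first by have := h k kn; rewrite eqxx.
  by move=> i ni ik; have := h i ni; rewrite (negbTE ik).
have m2E E : measurable E -> m2 E = (c * fine (Q E))%:E.
  by move=> mE; rewrite /m2 /mscale/= EFinM fineK//; exact: Q_fin.
have -> : [set w | forall i, (i < n)%N -> D i (W i w)] =
   [set w | forall i, (i < n)%N -> (if i == k then D k else D i) (W i w)].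
  by apply/seteqP; split => w h i ni; have := h i ni; case: eqP => // ->.
rewrite -upd//.
have -> : \prod_(i < n) fine (Q (D i)) = c * fine (Q (D k)).
  by rewrite (bigD1 k0)//= mulrC.
rewrite -m2E//.
apply: (@measure_unique _ _ _ [set A `*` B | A in measurable & B in measurable]
   (fun=> setT)) => //.
- by rewrite measurable_prod_measurableType.
- move=> _ _ [A1 mA1 [B1 mB1 <-]] [A2 mA2 [B2 mB2 <-]].
  exists (A1 `&` A2); first exact: measurableI.
  by exists (B1 `&` B2); [exact: measurableI|rewrite setXI].
- by move=> _; exists setT => //; exists setT => //; rewrite setXTT.
- by rewrite bigcup_const.
- move=> _ [A mA [B mB <-]]; change (m1 (A `*` B) = m2 (A `*` B)).
  rewrite upd ?m2E//; try exact: measurableX.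
  rewrite (IH (fun i => if i == k then A `*` B else D i)).
  + rewrite (bigD1 k0)//= eqxx mulrC; congr (_ * _)%:E.
    by apply: eq_bigr => i ik; rewrite -val_eqE/= in ik; rewrite (negbTE ik).
  + by move=> i; case: ifP => // _; exact: measurableX.
  + move=> i /andP[ki ni]; case: eqP => [_|/eqP ik]; first by exists A, B.
    by apply: rD; rewrite ni andbT ltn_neqAle eq_sym ik.
- move=> _; change (m1 setT < +oo)%E.
  rewrite /m1 /pushforward /mrestr preimage_setT setTI.
  by apply: (le_lt_trans (probability_le1 _ mRest)); rewrite ltry.
Qed.

Lemma independent_sets n (D : nat -> set (S1 * S2)) :
  (forall i, measurable (D i)) ->
  P [set w | forall i, (i < n)%N -> D i (W i w)] =
  (\prod_(i < n) fine (Q (D i)))%:E.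
Proof.
move=> mD; apply: (@independent_sets_upto n n) => // i /andP[ni].
by rewrite ltnNge ni.
Qed.

(** The same scheme, from indicators to bounded functions: with the other
    factors fixed, both sides are integrals of the remaining function, and they
    agree on indicators by induction. *)
Let expectation_prod_upto n k (f : nat -> S1 * S2 -> R) :
  (forall i, measurable_fun setT (f i)) -> (forall i z, 0 <= f i z) ->
  (forall i, exists b, forall z, f i z <= b) ->
  (forall i, (k <= i < n)%N -> exists2 A, measurable A & f i = \1_A) ->
  (\int[P]_w (\prod_(i < n) f i (W i w))%:E =
   (\prod_(i < n) fine (\int[Q]_z (f i z)%:E))%:E)%E.
Proof.
elim: k f => [|k IH] f mf f0 fb fD.
  have : forall i, exists A, measurable A /\ ((i < n)%N -> f i = \1_A).
    move=> i; have [ni|_] := boolP (i < n)%N; last by exists setT.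
    by have [A mA e] := fD i ni; exists A.
  move=> /choice[D hD].
  have mD i : measurable (D i) by have [] := hD i.
  have mE : measurable [set w | forall i, (i < n)%N -> D i (W i w)].
    have -> : [set w | forall i, (i < n)%N -> D i (W i w)] =
       \bigcap_(i in [set i | (i < n)%N]) (W i @^-1` D i) by [].
    apply: bigcap_measurableType => i _.
    by rewrite -[X in measurable X]setTI; exact: mW.
  transitivity (\int[P]_w (\1_[set w | forall i, (i < n)%N -> D i (W i w)] w)%:E)%E.
    apply: eq_integral => w _; congr EFin.
    transitivity (\prod_(i < n) (\1_(D i) (W i w)) : R).
      by apply: eq_bigr => i _; have [_ ->] := hD i.
    have [h|h] := pselect (forall i, (i < n)%N -> D i (W i w)).
      rewrite indicE mem_set// big1// => i _.
      by rewrite indicE mem_set//; exact: h.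
    rewrite [RHS]indicE memNset//.
    apply/eqP; rewrite prodf_seq_eq0.
    apply: contrapT => /negP/hasPn h'; apply: h => i ni.
    have := h' (Ordinal ni) (mem_index_enum _); rewrite /= indicE.
    by case: (boolP (W i w \in D i)) => [|_]; [rewrite inE|rewrite eqxx].
  rewrite integral_indic// setIT.
  transitivity (P [set w | forall i, (i < n)%N -> D i (W i w)]); first by [].
  rewrite independent_sets//; congr EFin.
  apply: eq_bigr => i _; have [_ ->] := hD i => //.
  by rewrite integral_indic// setIT.
have [kn|nk] := ltnP k n; last first.
  by apply: IH => // i /andP[ki ni]; move: (leq_trans nk ki); rewrite leqNgt ni.
pose k0 := Ordinal kn.
pose c := \prod_(i < n | i != k0) fine (\int[Q]_z (f i z)%:E)%E.
have If0 i : 0 <= fine (\int[Q]_z (f i z)%:E)%E.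
  by apply/fine_ge0/integral_ge0 => z _; rewrite lee_fin.
have c0 : 0 <= c by apply: prodr_ge0.
pose v w := \prod_(i < n | i != k0) f i (W i w).
have mv : measurable_fun setT v.
  apply: measurable_bigprod => i.
  by apply: measurableT_comp.
have -> : (\int[P]_w (\prod_(i < n) f i (W i w))%:E)%E =
    (\int[P]_w (v w * f k (W k w))%:E)%E.
  by apply: eq_integral => w _; rewrite (bigD1 k0)//= mulrC.
have [b fbk] := fb k.
transitivity (\int[Q]_z (c * f k z)%:E)%E; last first.
  under eq_integral do rewrite EFinM.
  rewrite ge0_integralZl//; last 2 first.
  - exact/measurable_EFinP.
  - by move=> z _; rewrite lee_fin.
  have -> : \prod_(i < n) fine (\int[Q]_z (f i z)%:E)%E =
      c * fine (\int[Q]_z (f k z)%:E)%E.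
    by rewrite (bigD1 k0) 1?mulrC.
  rewrite EFinM fineK//.
  rewrite ge0_fin_numE; last by apply: integral_ge0 => z _; rewrite lee_fin.
  apply: (@le_lt_trans _ _ (\int[Q]_z (cst b%:E z))%E).
    apply: ge0_le_integral => //.
    - by move=> z _; rewrite lee_fin.
    - exact/measurable_EFinP.
    - by move=> z _; rewrite lee_fin.
  rewrite integral_cst//; change (b%:E * Q setT < +oo)%E.
  by rewrite Q_setT mule1 ltry.
transitivity (\int[Q]_z (cst c z * f k (id z))%:E)%E; last by [].
apply: (@ge0_integral_transfer _ _ _ _ _ _ _ P Q (W k) id v (cst c)) => //.
- by move=> w; apply: prodr_ge0.
- move=> A mA.
  have := IH (fun i => if i == k then \1_A else f i).
  have -> : (\int[P]_w (\prod_(i < n) (if nat_of_ord i == k then \1_A else f i) (W i w))%:E)%E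
     = (\int[P]_w (v w * \1_A (W k w))%:E)%E.
    apply: eq_integral => w _; rewrite (bigD1 k0)//= eqxx mulrC; congr (_ * _)%:E.
    apply: eq_bigr => i; rewrite -val_eqE/= => ik.
    by rewrite (negbTE ik).
  move=> ->; last first.
  + move=> i /andP[ki ni]; case: eqP => [_|/eqP ik]; first by exists A.
    by apply: fD; rewrite ni andbT ltn_neqAle eq_sym ik.
  + move=> i; case: ifP => _ //; exists 1 => z.
    by rewrite indicE lern1 leq_b1.
  + by move=> i z; case: ifP => _ //; rewrite indicE.
  + by move=> i; case: ifP => _ //.
  have -> : (\int[Q]_x (cst c x * \1_A (id x))%:E)%E = (c%:E * Q A)%E.
    transitivity (\int[Q]_x (c%:E * (\1_A x)%:E))%E.
      by apply: eq_integral => x _; rewrite EFinM.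
    rewrite ge0_integralZl//; last exact/measurable_EFinP/measurable_indic.
    by rewrite integral_indic// setIT.
  rewrite (bigD1 k0)//= eqxx integral_indic// setIT EFinM muleC; congr (_ * _)%E.
    congr EFin; apply: eq_bigr => i; rewrite -val_eqE/= => ik.
    by rewrite (negbTE ik).
  by rewrite fineK//; exact: Q_fin.
Qed.

Lemma expectation_prod n (f : nat -> S1 * S2 -> R) :
  (forall i, measurable_fun setT (f i)) -> (forall i z, 0 <= f i z) ->
  (forall i, exists b, forall z, f i z <= b) ->
  (\int[P]_w (\prod_(i < n) f i (W i w))%:E =
   (\prod_(i < n) fine (\int[Q]_z (f i z)%:E))%:E)%E.
Proof.
move=> mf f0 fb; apply: (@expectation_prod_upto n n) => // i /andP[ni].
by rewrite ltnNge ni.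
Qed.

Lemma independent_two i j A B : measurable A -> measurable B -> i != j ->
  P (W i @^-1` A `&` W j @^-1` B) = (Q A * Q B)%E.
Proof.
move=> mA mB ij.
pose D k := if k == i then A else if k == j then B else setT.
have mD k : measurable (D k) by rewrite /D; do 2 case: ifP => // _.
pose n := (maxn i j).+1.
have ni : (i < n)%N by rewrite ltnS leq_maxl.
have nj : (j < n)%N by rewrite ltnS leq_maxr.
have -> : W i @^-1` A `&` W j @^-1` B = [set w | forall i, (i < n)%N -> D i (W i w)].
  apply/seteqP; split => [w [hA hB] k kn|w h].
    by rewrite /D; case: eqP => [->//|_]; case: eqP => [->//|_].
  split; first by have := h i ni; rewrite /D eqxx.
  by have := h j nj; rewrite /D eqxx eq_sym (negbTE ij).
rewrite independent_sets// (bigD1 (Ordinal ni))//= (bigD1 (Ordinal nj))/=; last first.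
  by rewrite -val_eqE/= eq_sym.
rewrite big1 ?mulr1; last first.
  move=> k /andP[]; rewrite -!val_eqE/= => ki kj.
  by rewrite /D (negbTE ki) (negbTE kj) Q_setT.
rewrite /D eqxx eq_sym (negbTE ij) eqxx EFinM !fineK//; exact: Q_fin.
Qed.

End independent_pairs.

(** * Exponential deviations and Borel-Cantelli *)

Lemma eq_leR {R : realType} (x y : R) : x = y -> x <= y.
Proof. by move=> ->. Qed.

Section borel_cantelli.
Context {R : realType} {d : measure_display} {Omega : measurableType d}.
Variable P : probability Omega R.

(** Borel-Cantelli; 1 / k^2 is compared with 2 (1 / k - 1 / k.+1), whose sum
    telescopes. *)
Lemma ae_eventually_not (E : nat -> set Omega) (c : R) :
  (forall n, measurable (E n)) ->
  (\forall n \near \oo, (P (E n) <= (c / n%:R ^+ 2)%:E)%E) ->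
  {ae P, forall w, \forall n \near \oo, ~ E n w}.
Proof.
move=> mE [N _ hN].
pose M := N.+1.
have hM n : (M <= n)%N -> (P (E n) <= (c / n%:R ^+ 2)%:E)%E.
  by move=> Mn; apply: hN; exact: ltnW.
have c0 : 0 <= c.
  have := le_trans (measure_ge0 P (E M)) (hM M (leqnn _)).
  by rewrite lee_fin pmulr_lge0// invr_gt0 exprn_gt0.
have sumle n : (M <= n)%N -> (\sum_(0 <= k < n) P (E k) <=
    (M%:R + 2 * c * (M%:R^-1 - n%:R^-1))%:E)%E.
  elim: n => // n IH; rewrite leq_eqVlt => /predU1P[<-|].
    rewrite subrr mulr0 addr0.
    apply: (@le_trans _ _ (\sum_(0 <= k < M) (1%:E : \bar R))%E).
      by apply: lee_sum => k _; exact: probability_le1.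
    by rewrite sumEFin lee_fin sumr_const_nat subn0.
  rewrite ltnS => Mn; rewrite big_nat_recr//=.
  apply: (le_trans (leeD (IH Mn) (hM n Mn))).
  rewrite -EFinD lee_fin -addrA lerD2l.
  have n0 : (0 < n)%N by exact: leq_trans Mn.
  have n0' : 0 < n%:R :> R by rewrite ltr0n.
  have n1' : n.+1%:R = n%:R + 1 :> R by rewrite natr1.
  have n1 : 1 <= n%:R :> R by rewrite ler1n.
  have key : (n%:R ^+ 2)^-1 <= 2 * (n%:R^-1 - n.+1%:R^-1) :> R.
    have -> : 2 * (n%:R^-1 - n.+1%:R^-1) = 2 / (n%:R * n.+1%:R) :> R.
      by rewrite n1'; field; rewrite !gt_eqF//; lra.
    rewrite ler_pdivlMr; last by rewrite mulr_gt0// ltr0n.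
    have -> : (n%:R ^+ 2)^-1 * (n%:R * n.+1%:R) = n.+1%:R / n%:R :> R.
      by field; rewrite gt_eqF.
    by rewrite ler_pdivrMr// n1'; lra.
  have : c * (n%:R ^+ 2)^-1 <= c * (2 * (n%:R^-1 - n.+1%:R^-1)).
    exact: ler_wpM2l.
  move: (n%:R ^+ 2)^-1 M%:R^-1 n%:R^-1 n.+1%:R^-1 => x1 x2 x3 x4; nra.
have : P (lim_sup_set E) = 0%E.
  apply: lim_sup_set_cvg0 => //.
  apply: (@le_lt_trans _ _ (M%:R + 2 * c * M%:R^-1)%:E); last by rewrite ltry.
  apply: lime_le; first by apply: is_cvg_nneseries => *; exact: measure_ge0.
  exists M => // n /= Mn; apply: (le_trans (sumle n Mn)).
  rewrite lee_fin lerD2l; apply: ler_wpM2l; first by rewrite mulr_ge0.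
  by rewrite gerBl invr_ge0.
move=> h0; exists (lim_sup_set E); split => //.
  apply: bigcap_measurable => //k _; exact: bigcup_measurable.
move=> w /= h n _ /=; apply: contrapT => h1; apply: h.
by exists n => // k /= nk Ek; apply: h1; exists k.
Qed.

End borel_cantelli.

Section deviation.
Context {R : realType} {d d' : measure_display}.
Context {Omega : measurableType d} {S : measurableType d'}.
Variables (P : probability Omega R) (Q : {measure set S -> \bar R}).
Variable W : nat -> Omega -> S.
Hypothesis mW : forall i, measurable_fun setT (W i).
Hypothesis Q1 : Q setT = 1%E.
(* The data are independent with law Q; exponential moments see this only
   through products of one bounded function. *)
Hypothesis W_prod : forall n (f : S -> R), measurable_fun setT f ->
  (forall z, 0 <= f z) -> (exists b, forall z, f z <= b) ->
  (\int[P]_w (\prod_(i < n) f (W i w))%:E = ((\int[Q]_z f z)%R ^+ n)%:E)%E.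

Definition avg n (g : S -> R) w := n%:R^-1 * \sum_(i < n) g (W i w).

Lemma bounded_Qintegrable (g : S -> R) b : measurable_fun setT g ->
  (forall z, `|g z| <= b) -> Q.-integrable setT (EFin \o g).
Proof.
move=> mg gb; apply: measurable_bounded_integrable => //.
  by rewrite Q1 ltry.
exists b; split; first exact: num_real.
by move=> x bx z _; exact: le_trans (gb z) (ltW bx).
Qed.

Lemma measurable_avg n g : measurable_fun setT g -> measurable_fun setT (avg n g).
Proof.
move=> mg; apply: measurable_funM => //.
by apply: measurable_bigsum => i; exact: measurableT_comp.
Qed.

(** Markov's inequality for the exponential of n l times the average, whose
    expectation is a product.  As l g is small, [expR_le_quadratic] bounds each
    factor by expR (l E g + l^2 v). *)
Lemma chernoff_avg n (g : S -> R) (l v s : R) : (0 < n)%N ->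
  measurable_fun setT g -> 0 < l -> (forall z, l * `|g z| <= 3^-1) ->
  \int[Q]_z (g z ^+ 2) <= v ->
  (P [set w | (\int[Q]_z g z + s <= avg n g w)%R] <=
     (expR (- (n%:R * (l * s - l ^+ 2 * v))))%:E)%E.
Proof.
move=> n0 mg l0 lg gv.
have n0' : 0 < n%:R :> R by rewrite ltr0n.
have gb z : `|g z| <= l^-1 * 3^-1 by rewrite ler_pdivlMl.
have ig : Q.-integrable setT (EFin \o g) by exact: bounded_Qintegrable gb.
have mg2 : measurable_fun setT (fun z => g z ^+ 2) by exact: measurable_funX.
have ig2 : Q.-integrable setT (EFin \o (fun z => g z ^+ 2)).
  apply: (@bounded_Qintegrable _ ((l^-1 * 3^-1) ^+ 2)) => // z.
  by rewrite normrX ler_sqr ?nnegrE// (le_trans (normr_ge0 _) (gb z)).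
pose f z := expR (l * g z).
have mf : measurable_fun setT f.
  by apply: measurableT_comp => //; exact: measurable_funM.
have f0 z : 0 <= f z by exact: expR_ge0.
have fb z : f z <= expR 3^-1.
  rewrite ler_expR; apply: le_trans (lg z).
  by rewrite ler_pM2l// ler_norm.
have jf : Q.-integrable setT (EFin \o f).
  by apply: (@bounded_Qintegrable _ (expR 3^-1)) => // z; rewrite ger0_norm.
set m := \int[Q]_z g z.
have Ef : \int[Q]_z f z <= expR (l * m + l ^+ 2 * v).
  apply: (@le_trans _ _ (1 + (l * m + l ^+ 2 * v))); last exact: expR_ge1Dx.
  apply: (@le_trans _ _ (\int[Q]_z (1 + (l * g z + l ^+ 2 * g z ^+ 2)))).
    apply: le_Rintegral => //.
      apply: (@bounded_Qintegrable _ 2).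
        apply: measurable_funD => //; apply: measurable_funD; exact: measurable_funM.
      move=> z; have := lg z.
      have -> : l * g z + l ^+ 2 * g z ^+ 2 = l * g z + (l * g z) ^+ 2 by ring.
      rewrite -[X in X * `|_|](gtr0_norm l0) -normrM.
      move: (l * g z) => u; rewrite !ler_norml => /andP[? ?].
      by apply/andP; split; nra.
    move=> z _; rewrite /f.
    have -> : 1 + (l * g z + l ^+ 2 * g z ^+ 2) = 1 + l * g z + (l * g z) ^+ 2 by ring.
    by apply: expR_le_quadratic; rewrite normrM gtr0_norm.
  rewrite RintegralD//; last 2 first.
  - apply: (@bounded_Qintegrable _ 1) => // z; by rewrite normr1.
  - apply: (@bounded_Qintegrable _ 1).
      apply: measurable_funD; exact: measurable_funM.
    move=> z; have := lg z.
    have -> : l * g z + l ^+ 2 * g z ^+ 2 = l * g z + (l * g z) ^+ 2 by ring.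
    rewrite -[X in X * `|_|](gtr0_norm l0) -normrM.
    move: (l * g z) => u; rewrite !ler_norml => /andP[? ?].
    by apply/andP; split; nra.
  rewrite Rintegral_cst// Q1 /= mulr1 lerD2l.
  rewrite RintegralD//; last 2 first.
  - apply: (@bounded_Qintegrable _ 3^-1); first exact: measurable_funM.
    by move=> z; rewrite normrM gtr0_norm.
  - apply: (@bounded_Qintegrable _ (3^-1 ^+ 2)); first exact: measurable_funM.
    by move=> z; rewrite -exprMn normrX ler_sqr ?nnegrE// normrM gtr0_norm.
  by rewrite !RintegralZl// lerD2l ler_wpM2l// sqr_ge0.
pose E := [set w | (m + s <= avg n g w)%R].
have mE : measurable E by apply: measurable_set_lef => //; exact: measurable_avg.
pose Y w := \prod_(i < n) f (W i w).
have Y0 w : 0 <= Y w by apply: prodr_ge0.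
have mY : measurable_fun setT Y.
  by apply: measurable_bigprod => i; exact: measurableT_comp.
have YE w : Y w = expR (n%:R * l * avg n g w).
  rewrite /Y /f -expR_sum -mulr_sumr /avg; congr expR.
  by field; rewrite gt_eqF.
set c := expR (n%:R * l * (m + s)).
have cP : (c%:E * P E <= (expR (n%:R * (l * m + l ^+ 2 * v)))%:E)%E.
  apply: (@le_trans _ _ (\int[P]_w (Y w)%:E)%E).
    rewrite -(setIT E) -integral_indic// -ge0_integralZl//; last 2 first.
    - exact/measurable_EFinP/measurable_indic.
    - by rewrite lee_fin expR_ge0.
    apply: ge0_le_integral => //.
    - by move=> w _; rewrite -EFinM lee_fin mulr_ge0// expR_ge0.
    - apply: measurable_funeM; exact/measurable_EFinP/measurable_indic.
    - exact/measurable_EFinP.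
    - move=> w _; rewrite -EFinM lee_fin indicE.
      have [|_] := boolP (w \in E); last by rewrite mulr0.
      rewrite inE mulr1 => Ew; rewrite YE ler_expR ler_wpM2l//.
      by rewrite mulr_ge0// ltW.
  rewrite W_prod//; last by exists (expR 3^-1).
  rewrite lee_fin expRM_natl lerXn2r// nnegrE ?expR_ge0//.
  by apply: Rintegral_ge0 => z _; exact: f0.
rewrite -(fineK (fin_num_measure P _ mE)) in cP *.
rewrite -EFinM !lee_fin in cP *.
rewrite -(ler_pM2l (expR_gt0 (n%:R * l * (m + s)))); apply: (le_trans cP).
by rewrite -expRD ler_expR; apply: eq_leR; ring.
Qed.

Lemma chernoff_avg_abs n (g : S -> R) (l v s : R) : (0 < n)%N ->
  measurable_fun setT g -> 0 < l -> (forall z, l * `|g z| <= 3^-1) ->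
  \int[Q]_z (g z ^+ 2) <= v ->
  (P [set w | (s <= `|avg n g w - \int[Q]_z g z|)%R] <=
     (2 * expR (- (n%:R * (l * s - l ^+ 2 * v))))%:E)%E.
Proof.
move=> n0 mg l0 lg gv.
have gb z : `|g z| <= l^-1 * 3^-1 by rewrite ler_pdivlMl.
have ig : Q.-integrable setT (EFin \o g) by exact: bounded_Qintegrable gb.
pose g' z := - 1 * g z.
have mg' : measurable_fun setT g' by exact: measurable_funM.
have avg' w : avg n g' w = - avg n g w.
  rewrite /avg -mulrN; congr (_ * _).
  by rewrite -mulr_sumr mulN1r.
have Eg' : \int[Q]_z g' z = - \int[Q]_z g z by rewrite RintegralZl// mulN1r.
have h1 := chernoff_avg s n0 mg l0 lg gv.
have h2 := chernoff_avg s n0 mg' l0.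
rewrite mulr_natl mulr2n EFinD.
set A1 := [set w | (\int[Q]_z g z + s <= avg n g w)%R] in h1.
set A2 := [set w | (\int[Q]_z g' z + s <= avg n g' w)%R] in h2.
have mA1 : measurable A1 by apply: measurable_set_lef => //; exact: measurable_avg.
have mA2 : measurable A2 by apply: measurable_set_lef => //; exact: measurable_avg.
have sub : [set w | (s <= `|avg n g w - \int[Q]_z g z|)%R] = A1 `|` A2.
  apply/seteqP; split => w /=.
    rewrite ler_normr => /orP[h|h]; [left|right]; rewrite /A1 /A2 /= ?Eg' ?avg'; lra.
  rewrite ler_normr => -[h|h]; apply/orP; [left|right]; move: h; rewrite /A1 /A2 /= ?Eg' ?avg'; lra.
rewrite sub; apply: (le_trans (measureU2 _ mA1 mA2)).
apply: leeD => //; apply: h2.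
  by move=> z; rewrite /g' mulN1r normrN.
by under eq_Rintegral do rewrite /g' mulN1r sqrrN.
Qed.

(** At each n there are at most c n^3 averages, each of which deviates with
    probability at most 2 n^-5; a union bound leaves 2 c n^-2, which is summable.
    The parameter l, limited by the size of g, is to be chosen in each
    application; D selects the indices for which an admissible l exists. *)
Lemma ae_deviations (c : R) (N : nat -> nat) (g : nat -> nat -> S -> R)
    (D : nat -> nat -> bool) (l v s : nat -> nat -> R) :
  (forall n k, measurable_fun setT (g n k)) ->
  (forall n, (N n)%:R <= c * n%:R ^+ 3) ->
  (\forall n \near \oo, forall k, (k < N n)%N -> D n k ->
    [/\ 0 < l n k, forall z, l n k * `|g n k z| <= 3^-1,
        \int[Q]_z (g n k z ^+ 2) <= v n k &
        5 * ln n%:R <= n%:R * (l n k * s n k - l n k ^+ 2 * v n k)]) ->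
  {ae P, forall w, \forall n \near \oo, forall k, (k < N n)%N -> D n k ->
     `|avg n (g n k) w - \int[Q]_z g n k z| < s n k}.
Proof.
move=> mg Nc [n0 _ hn].
pose B n k := if D n k then [set w | (s n k <= `|avg n (g n k) w - \int[Q]_z g n k z|)%R]
  else set0.
have mB n k : measurable (B n k).
  rewrite /B; case: ifP => // _.
  apply: measurable_set_lef => //; apply: measurableT_comp => //.
  by apply: measurable_funB => //; exact: measurable_avg.
have := @ae_eventually_not _ _ _ P (fun n => \big[setU/set0]_(k < N n) B n k) (2 * c).
move=> /(_ (fun n => ltac:(by apply: bigsetU_measurable => k _; exact: mB)))[].
  exists n0.+1 => // n /= n0n.
  have n1 : (0 < n)%N by exact: leq_trans n0n.
  have n1' : 0 < n%:R :> R by rewrite ltr0n.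
  apply: (le_trans (Boole_inequality _ _)) => //.
  apply: (@le_trans _ _ (\sum_(k < N n) (2 * (n%:R ^+ 5)^-1)%:E)%E).
    apply: lee_sum => k _; rewrite /B; case: ifPn => Dk; last first.
      by rewrite measure0 lee_fin.
    have [l0 lg gv e5] := hn n (ltnW n0n) k (ltn_ord k) Dk.
    apply: (le_trans (chernoff_avg_abs _ n1 (mg n k) l0 lg gv)).
    rewrite lee_fin ler_pM2l//.
    have -> : (n%:R ^+ 5)^-1 = expR (- (5 * ln n%:R)) :> R.
      by rewrite expRN expRM_natl lnK.
    by rewrite ler_expR lerN2.
  rewrite sumEFin lee_fin sumr_const card_ord -[_ *+ N n]mulr_natl.
  apply: (@le_trans _ _ (c * n%:R ^+ 3 * (2 * (n%:R ^+ 5)^-1))).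
    by apply: ler_wpM2r.
  by apply: eq_leR; field; rewrite gt_eqF.
move=> Z [mZ Z0 hZ]; exists Z; split => //.
move=> w /= nh; apply: hZ => /= -[m _ hm]; apply: nh.
exists m => // n /= mn k kN Dk; rewrite ltNge; apply/negP => h.
apply: (hm n mn); rewrite -bigcup_mkord; exists k => //.
by rewrite /B Dk.
Qed.

End deviation.

(** * Continuous distribution functions and their hazard *)

Section continuous_cdf.
Context {R : realType} {d : measure_display} {Omega : measurableType d}.
Variables (P : probability Omega R) (Y : {RV P >-> R}) (G : R -> R).
Hypothesis Y_cdf : forall t, cdf Y t = (G t)%:E.
Hypothesis G_cont : continuous G.
Local Notation nu := (distribution P Y).

Lemma cdf_le1_real t : G t <= 1.
Proof. by rewrite -lee_fin -Y_cdf cdf_le1. Qed.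

Lemma cdf_ge0_real t : 0 <= G t.
Proof. by rewrite -lee_fin -Y_cdf cdf_ge0. Qed.

Lemma cdf_mono s t : s <= t -> G s <= G t.
Proof. by move=> st; rewrite -lee_fin -!Y_cdf; exact: cdf_nondecreasing. Qed.

Lemma cdf_small e : 0 < e -> exists a, G a < e.
Proof.
move=> e0; have := @cvg_cdfNy0 _ _ _ _ Y.
have -> : cdf Y = EFin \o G by apply/funext => t; rewrite Y_cdf.
move=> /fine_cvg /= h.
have : \forall x \near -oo, G x < e.
  by move: h => /cvgr_lt; apply.
move=> [M [_ hM]]; exists (M - 1); apply: hM.
by rewrite ltrBlDr ltrDl.
Qed.

Lemma cdf_ivt a b u : a <= b -> G a <= u <= G b ->
  exists2 c, a <= c <= b & G c = u.
Proof.
move=> ab /andP[h1 h2].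
have := @IVT R G a b u ab.
case.
- by apply: continuous_subspaceT => x; exact: G_cont.
- by rewrite ge_min h1/= le_max h2 orbT.
- by move=> c; rewrite in_itv/= => cab e; exists c.
Qed.

Lemma law_le t : nu [set c | (c <= t)%R] = (G t)%:E.
Proof.
by rewrite -Y_cdf /cdf; congr (nu _).
Qed.

Lemma law_gt t : nu [set c | (t < c)%R] = (1 - G t)%:E.
Proof.
have -> : [set c | (t < c)%R] = ~` [set c | (c <= t)%R].
  by apply/seteqP; split => c /=; rewrite ltNge => /negP.
transitivity (1 - nu [set c | (c <= t)%R])%E; last by rewrite law_le EFinB.
exact: (probability_setC nu (measurable_set_le t)).
Qed.

Lemma law_oc s t : s <= t -> nu [set c | (s < c <= t)%R] = (G t - G s)%:E.
Proof.
move=> st.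
have -> : [set c | (s < c <= t)%R] = [set c | (c <= t)%R] `\` [set c | (c <= s)%R].
  apply/seteqP; split => c /=; first by move=> /andP[sc ->]; rewrite leNgt sc.
  by move=> [-> /negP]; rewrite -ltNge => ->.
have e : [set c | (c <= t)%R] `&` [set c | (c <= s)%R] = [set c | (c <= s)%R].
  apply/seteqP; split => c /=; first by case.
  by move=> cs; split => //; exact: le_trans st.
transitivity (nu [set c | (c <= t)%R] - nu [set c | (c <= s)%R])%E.
  rewrite -[X in (_ - nu X)%E]e; apply: (measureD (mu := nu)) => //; try exact: measurable_set_le.
  by apply: (@le_lt_trans _ _ (G t)%:E); [rewrite -law_le|rewrite ltry].
by rewrite !law_le EFinB.
Qed.

(** Continuity of G from the left at t squeezes the mass of the point. *)
Lemma law_point t : nu [set t] = 0%E.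
Proof.
apply/eqP; rewrite eq_le measure_ge0 andbT.
apply/lee_addgt0Pr => e e0; rewrite add0e.
have : \forall x \near t^'-, G t - e < G x.
  have : G x @[x --> t^'-] --> G t by apply: cvg_at_left_filter; exact: G_cont.
  by move=> /cvgr_gt; apply; rewrite gtrBl.
move=> h.
have : \forall x \near t^'-, x < t by exact: nbhs_left_lt.
move=> h'; have [s [st sG]] : exists s, s < t /\ G t - e < G s.
  by apply: (@filter_ex _ (t^'-)); near=> s; split; near: s.
apply: (@le_trans _ _ (nu [set c | (s < c <= t)%R])).
  apply: le_measure; rewrite ?inE//; first exact: measurable_set_oc.
  by move=> c /= ->; rewrite st lexx.
by rewrite law_oc ?(ltW st)// lee_fin; lra.
Unshelve. all: by end_near. Qed.

Lemma law_ge t : nu [set c | (t <= c)%R] = (1 - G t)%:E.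
Proof.
have -> : [set c | (t <= c)%R] = [set t] `|` [set c | (t < c)%R].
  apply/seteqP; split => c /=.
    by rewrite le_eqVlt => /predU1P[->|]; [left|right].
  by move=> [->|/ltW].
transitivity (nu [set t] + nu [set c | (t < c)%R])%E; last first.
  by rewrite law_point law_gt add0e.
apply: (measureU nu) => //; first exact: measurable_set_gt.
by rewrite -subset0 => c [/= ->]; rewrite ltxx.
Qed.

Definition hazard_integrand t c : R := (c <= t)%R%:R / (1 - G c).

Let meas_G : measurable_fun setT G.
Proof. exact: continuous_measurable_fun. Qed.

Lemma measurable_hazard_integrand t : measurable_fun setT (hazard_integrand t).
Proof.
apply: measurable_funM; first by apply: measurable_natb; exact: measurable_set_le.
by apply: measurable_funV; apply: measurable_funB.
Qed.

Lemma hazard_integrand_bound t c : G t < 1 ->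
  0 <= hazard_integrand t c <= (1 - G t)^-1.
Proof.
move=> Gt; rewrite /hazard_integrand; have [ct|tc] := leP c t; last first.
  by rewrite mul0r lexx invr_ge0; lra.
have h := cdf_mono ct.
rewrite mul1r invr_ge0; apply/andP; split; first by lra.
by rewrite lef_pV2 ?posrE; lra.
Qed.

Let nu1 : nu setT = 1%E. Proof. exact: probability_setT. Qed.

Lemma integrable_hazard_integrand t : G t < 1 ->
  nu.-integrable setT (EFin \o hazard_integrand t).
Proof.
move=> Gt; apply: (bounded_Qintegrable nu1 (measurable_hazard_integrand t)).
by move=> c; have /andP[h1 h2] := hazard_integrand_bound c Gt; rewrite ger0_norm//; exact: h2.
Qed.

(** The defect of the identity to be proved, [integral_hazard].  On ]s, t] both
    parts of it increase by (G t - G s) / (1 - G) up to a quadratic error, and a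
    function with a quadratic modulus of continuity in G is constant. *)
Let gap t := \int[nu]_c hazard_integrand t c + ln (1 - G t).

Let gap_quadratic s t : s <= t -> G t < 1 ->
  `|gap t - gap s| <= (1 - G t)^-1 ^+ 2 * (G t - G s) ^+ 2.
Proof.
move=> st Gt1; have Gst := cdf_mono st.
have Gs1 : G s < 1 by lra.
set a := 1 - G s; set b := 1 - G t.
have b0 : 0 < b by rewrite /b; lra.
have ba : b <= a by rewrite /a /b; lra.
have a0 : 0 < a by lra.
have is' := integrable_hazard_integrand Gs1.
have it' := integrable_hazard_integrand Gt1.
have dE : \int[nu]_c hazard_integrand t c - \int[nu]_c hazard_integrand s c =
   \int[nu]_c (hazard_integrand t c - hazard_integrand s c) by rewrite RintegralB.
have ifd : nu.-integrable setT (EFin \o (fun c => hazard_integrand t c - hazard_integrand s c)).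
  by have := integrableB measurableT it' is'; apply: eq_integrable.
have moc : measurable [set c : R | (s < c <= t)%R] by exact: measurable_set_oc.
have cstE k : \int[nu]_c (k * (s < c <= t)%R%:R) = k * (a - b).
  rewrite RintegralZl//; last first.
    apply: (bounded_Qintegrable nu1 (b := 1)); first exact: measurable_natb.
    by move=> c; rewrite normr_nat lern1 leq_b1.
  transitivity (k * fine (nu [set c | (s < c <= t)%R])).
    by rewrite (Rintegral_natb _ moc).
  by rewrite law_oc//= /a /b; congr (_ * _); ring.
have ik k : nu.-integrable setT (EFin \o (fun c => k * (s < c <= t)%R%:R)).
  apply: (bounded_Qintegrable nu1 (b := `|k|)).
    by apply: measurable_funM => //; exact: measurable_natb.
  by move=> c; rewrite normrM ler_piMr// normr_nat lern1 leq_b1.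
have dval c : a^-1 * (s < c <= t)%R%:R <= hazard_integrand t c - hazard_integrand s c
     <= b^-1 * (s < c <= t)%R%:R.
  rewrite /hazard_integrand; have [ct|tc] := leP c t; last first.
    by rewrite (lt_geF (le_lt_trans st tc)) andbF !mulr0 !mul0r subr0 lexx.
  have [cs|sc] := leP c s; first by rewrite /= !mulr0 subrr lexx.
  rewrite /= mul0r subr0 !mulr1 mul1r.
  have h1 := cdf_mono ct; have h2 := cdf_mono (ltW sc).
  by apply/andP; split; rewrite lef_pV2 ?posrE /a /b; lra.
have lb : a^-1 * (a - b) <= \int[nu]_c hazard_integrand t c - \int[nu]_c hazard_integrand s c.
  rewrite dE -cstE; apply: le_Rintegral => // c _.
  by have /andP[] := dval c.
have ub : \int[nu]_c hazard_integrand t c - \int[nu]_c hazard_integrand s c <= b^-1 * (a - b).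
  rewrite dE -cstE; apply: le_Rintegral => // c _.
  by have /andP[] := dval c.
have l1 : ln a - ln b <= b^-1 * (a - b).
  rewrite -ln_div ?posrE//.
  have -> : a / b = 1 + b^-1 * (a - b) by field; rewrite gt_eqF.
  apply: le_ln1Dx; apply: (@lt_le_trans _ _ 0) => //.
  by rewrite mulr_ge0 ?invr_ge0; lra.
have l2 : a^-1 * (a - b) <= ln a - ln b.
  rewrite -[leRHS]opprB -ln_div ?posrE// lerNr.
  have -> : b / a = 1 + - (a^-1 * (a - b)) by field; rewrite gt_eqF.
  apply: le_ln1Dx.
  have -> : a^-1 * (a - b) = 1 - b / a by field; rewrite gt_eqF.
  have : 0 < b / a by exact: divr_gt0.
  lra.
have e : b^-1 * (a - b) - a^-1 * (a - b) <= b^-1 ^+ 2 * (a - b) ^+ 2.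
  have -> : b^-1 * (a - b) - a^-1 * (a - b) = (a - b) ^+ 2 * b^-1 * a^-1.
    by field; rewrite !gt_eqF.
  rewrite -mulrA mulrC ler_wpM2r ?sqr_ge0// expr2 ler_pM2l ?invr_gt0//.
  by rewrite lef_pV2.
have eab : G t - G s = a - b by rewrite /a /b; ring.
rewrite eab /gap -/a -/b.
move: e lb ub l1 l2.
set I := \int[nu]_c hazard_integrand t c; set J := \int[nu]_c hazard_integrand s c.
move: (b^-1 ^+ 2 * (a - b) ^+ 2) (b^-1 * (a - b)) (a^-1 * (a - b)) (ln a) (ln b) I J.
move=> x1 x2 x3 x4 x5 I J h1 h2 h3 h4 h5.
by rewrite ler_norml; apply/andP; split; lra.
Qed.

(** Each bisection, at a point where G is halfway, halves a quadratic bound. *)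
Let gap_halving m t0 s t : s <= t -> t <= t0 -> G t0 < 1 ->
  `|gap t - gap s| <= (1 - G t0)^-1 ^+ 2 * (G t - G s) ^+ 2 / 2 ^+ m.
Proof.
elim: m s t => [|m IH] s t st tt0 Gt0.
  have h := cdf_mono tt0.
  rewrite expr0 divr1; apply: (le_trans (gap_quadratic st _)); first lra.
  apply: ler_wpM2r; first exact: sqr_ge0.
  rewrite ler_sqr ?nnegrE ?invr_ge0; [|lra..].
  by rewrite lef_pV2 ?posrE; lra.
have Gst := cdf_mono st.
have [|r /andP[sr rt] Gr] := @cdf_ivt s t ((G s + G t) / 2) st; first by apply/andP; split; lra.
have h1 := IH s r sr (le_trans rt tt0) Gt0.
have h2 := IH r t rt tt0 Gt0.
have -> : gap t - gap s = (gap t - gap r) + (gap r - gap s) by ring.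
apply: (le_trans (ler_normD _ _)); apply: (le_trans (lerD h2 h1)).
rewrite Gr; apply: eq_leR; rewrite [2 ^+ m.+1]exprS.
have : 2 ^+ m != 0 :> R by rewrite expf_neq0.
move: (2 ^+ m) ((1 - G t0)^-1 ^+ 2) (G s) (G t) => u q x y u0.
by field.
Qed.

(** The cumulative hazard of a continuous law is minus the logarithm of its
    survival function: the defect is constant, and it is small where G is. *)
Lemma integral_hazard t : G t < 1 ->
  \int[nu]_c hazard_integrand t c = - ln (1 - G t).
Proof.
move=> Gt; suff : gap t = 0 by rewrite /gap => /eqP; rewrite addr_eq0 => /eqP.
have gapst s : s <= t -> gap s = gap t.
  move=> st; apply/eqP; rewrite eq_sym -subr_eq0 -normr_le0.
  set c := (1 - G t)^-1 ^+ 2 * (G t - G s) ^+ 2.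
  have c0 : 0 <= c by rewrite mulr_ge0 ?sqr_ge0.
  apply/ler_addgt0Pr => e e0; rewrite add0r.
  have [m hm] : exists m, c / e < 2 ^+ m.
    exists (Num.truncn (c / e)).+1.
    have h1 : c / e < (Num.truncn (c / e)).+1%:R by apply: truncnS_gt.
    apply: (lt_trans h1); rewrite -natrX ltr_nat; exact: ltn_expl.
  apply: (le_trans (gap_halving m st (lexx t) Gt)); rewrite -/c.
  by rewrite ler_pdivrMr ?exprn_gt0// mulrC -ler_pdivrMr// ltW.
apply/eqP; rewrite -normr_le0; apply/ler_addgt0Pr => e e0; rewrite add0r.
have [a Ga] : exists a, G a < Num.min (2^-1) (e / 4).
  by apply: cdf_small; rewrite lt_min; apply/andP; split; lra.
have [s [st Gs]] : exists s, s <= t /\ G s < Num.min (2^-1) (e / 4).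
  exists (Num.min a t); split; first by rewrite ge_min lexx orbT.
  by apply: le_lt_trans Ga; apply: cdf_mono; rewrite ge_min lexx.
move: Gs; rewrite lt_min => /andP[Gs1 Gs2].
have Gs0 := cdf_ge0_real s.
rewrite -(gapst s st) /gap.
have Gs1' : G s < 1 by lra.
have i2 : (1 - G s)^-1 * G s <= 2 * G s.
  apply: ler_wpM2r => //; rewrite -[leRHS]invrK lef_pV2 ?posrE ?invr_gt0//; lra.
have l1 : ln (1 - G s) <= - G s by apply: le_ln1Dx; lra.
have l2 : - ln (1 - G s) <= (1 - G s)^-1 * G s.
  rewrite -lnV ?posrE; last lra.
  have e1 : (1 - G s)^-1 = 1 + (1 - G s)^-1 * G s by field; lra.
  rewrite [X in ln X]e1; apply: le_ln1Dx; apply: (@lt_le_trans _ _ 0) => //.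
  by rewrite mulr_ge0 ?invr_ge0; lra.
have i0 : 0 <= \int[nu]_c hazard_integrand s c.
  by apply: Rintegral_ge0 => c _; have /andP[] := hazard_integrand_bound c Gs1'.
have i1 : \int[nu]_c hazard_integrand s c <= (1 - G s)^-1 * G s.
  apply: (@le_trans _ _ (\int[nu]_c ((1 - G s)^-1 * (c <= s)%R%:R))).
    apply: le_Rintegral => //; first exact: integrable_hazard_integrand.
      apply: (bounded_Qintegrable nu1 (b := (1 - G s)^-1)).
        apply: measurable_funM => //; apply: measurable_natb; exact: measurable_set_le.
      move=> c; rewrite normrM normr_nat ger0_norm ?invr_ge0; last lra.
      by rewrite ler_piMr ?invr_ge0 ?lern1 ?leq_b1//; lra.
    move=> c _; have [cs|sc] := leP c s; last first.
      by rewrite /hazard_integrand (lt_geF sc) mul0r mulr0.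
    by rewrite mulr1; have /andP[] := hazard_integrand_bound c Gs1'.
  rewrite RintegralZl//; last first.
    apply: (bounded_Qintegrable nu1 (b := 1)).
      apply: measurable_natb; exact: measurable_set_le.
    by move=> c; rewrite normr_nat lern1 leq_b1.
  apply: eq_leR; transitivity ((1 - G s)^-1 * fine (nu [set c | (c <= s)%R])).
    by rewrite (Rintegral_natb _ (measurable_set_le s)).
  by rewrite law_le.
move: (\int[nu]_c hazard_integrand s c) i0 i1 => I i0 i1.
by rewrite ler_norml; apply/andP; split; lra.
Qed.

End continuous_cdf.

(** * From empirical processes to Kaplan-Meier weights *)

Section censored_sample.
Context {R : realType}.
Variables (F G : R -> R) (tau : R) (n : nat) (tt cc : nat -> R).
Hypotheses (F_mono : {homo F : x y / x <= y}) (G_mono : {homo G : x y / x <= y}).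
Hypotheses (F_ge0 : forall t, 0 <= F t) (F_le1 : forall t, F t <= 1).
Hypotheses (G_ge0 : forall t, 0 <= G t) (G_le1 : forall t, G t <= 1).
Hypothesis F_tau : F tau = 1.
Hypothesis G_tau : 0 < 1 - G tau.
Hypothesis n_gt0 : (0 < n)%N.

(** The survival function of min (T, C). *)
Definition surv (t : R) : R := (1 - F t) * (1 - G t).
Local Notation g0 := (1 - G tau).

Let yy i := Num.min (tt i) (cc i).

Definition at_risk (t : R) : R := n%:R^-1 * \sum_(i < n) (t <= yy i)%R%:R.
(** The empirical cumulative hazard of the censoring variable, with the
    proportion at risk replaced by its limit [surv]: this makes it an average
    of independent terms. *)
Definition cens_hazard (t : R) : R :=
  n%:R^-1 * \sum_(i < n) (cc i < tt i)%R%:R * (cc i <= t)%R%:R / surv (cc i).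

(* Control at n quantiles of the observations is extended to all points. *)
Variables (grid : nat -> R) (eps a b theta : R).
Hypothesis gridE : forall k, (0 < k < n)%N -> surv (grid k) = 1 - k%:R / n%:R.
Hypothesis at_risk_grid : forall k, (0 < k < n)%N ->
  `|at_risk (grid k) - surv (grid k)| <= a * eps.
Hypothesis cens_grid : forall k, (0 < k < n)%N -> theta / 2 <= surv (grid k) ->
  `|cens_hazard (grid k) + ln (1 - G (grid k))| <= b * eps / Num.sqrt (surv (grid k)).
Hypotheses (eps0 : 0 < eps) (neps : 1 <= n%:R * eps ^+ 2) (eps4 : eps <= 4^-1)
  (a0 : 0 <= a) (b0 : 0 <= b) (th8 : 8 * eps <= theta).

Let N0 : 0 < n%:R :> R. Proof. by rewrite ltr0n. Qed.

Let inv_n_eps : n%:R^-1 <= eps.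
Proof.
rewrite -div1r ler_pdivrMr//.
have : eps * eps <= eps * 1 by rewrite ler_pM2l//; have := eps4; lra.
have := neps; rewrite expr2 mulrA => h1 h2.
by apply: (le_trans h1); rewrite -mulrA mulrC ler_pM2r// -[leRHS]mulr1.
Qed.

Lemma surv_mono s t : s <= t -> surv t <= surv s.
Proof.
move=> st; apply: ler_pM; rewrite ?subr_ge0//; apply: lerB => //; [exact: F_mono|exact: G_mono].
Qed.

Lemma surv_ge0 t : 0 <= surv t.
Proof. by rewrite mulr_ge0 ?subr_ge0. Qed.

Lemma surv_le1 t : surv t <= 1.
Proof. by apply: mulr_ile1; rewrite ?subr_ge0 ?gerBl. Qed.

Lemma surv_gt0_le_tau t : 0 < surv t -> t <= tau.
Proof.
move=> st; rewrite leNgt; apply/negP => /ltW/F_mono; rewrite F_tau => F1.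
move: st; rewrite /surv (_ : F t = 1) ?subrr ?mul0r ?ltxx//.
by apply/eqP; rewrite eq_le F_le1.
Qed.

Let at_risk_mono s t : s <= t -> at_risk t <= at_risk s.
Proof.
move=> st; apply: ler_wpM2l; first by rewrite invr_ge0 ltW.
apply: ler_sum => i _; rewrite ler_nat.
by case: (leP t (yy i)) => [/(le_trans st) ->|].
Qed.

Let cens_mono s t : s <= t -> cens_hazard s <= cens_hazard t.
Proof.
move=> st; apply: ler_wpM2l; first by rewrite invr_ge0 ltW.
apply: ler_sum => i _; apply: ler_wpM2r; first by rewrite invr_ge0 surv_ge0.
apply: ler_wpM2l => //; rewrite ler_nat.
by case: (leP (cc i) s) => [/le_trans ->|].
Qed.

Let at_risk_ge0 t : 0 <= at_risk t.
Proof. by rewrite mulr_ge0 ?invr_ge0 ?(ltW N0)//; apply: sumr_ge0. Qed.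

Let cens_ge0 t : 0 <= cens_hazard t.
Proof.
rewrite mulr_ge0 ?invr_ge0 ?(ltW N0)//; apply: sumr_ge0 => i _.
by rewrite mulr_ge0 ?invr_ge0 ?surv_ge0// mulr_ge0.
Qed.

Let at_risk_le1 t : at_risk t <= 1.
Proof.
rewrite /at_risk mulrC ler_pdivrMr// mul1r.
apply: (@le_trans _ _ (\sum_(i < n) 1)).
  by apply: ler_sum => i _; rewrite lern1 leq_b1.
by rewrite sumr_const card_ord.
Qed.

Let cell t : exists k : nat, k%:R / n%:R <= 1 - surv t < k.+1%:R / n%:R.
Proof.
exists (Num.truncn (n%:R * (1 - surv t))).
have p0 : 0 <= n%:R * (1 - surv t) by rewrite mulr_ge0 ?(ltW N0)// subr_ge0 surv_le1.
have /andP[h1 h2] := truncn_itv p0.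
by rewrite ler_pdivrMr// ltr_pdivlMr// ![(1 - surv t) * _]mulrC h1 h2.
Qed.

Let grid_gt t k : (0 < k < n)%N -> surv (grid k) < surv t -> t < grid k.
Proof. by move=> _ h; rewrite ltNge; apply/negP => /surv_mono; rewrite leNgt h. Qed.

Let grid_lt t k : (0 < k < n)%N -> surv t < surv (grid k) -> grid k < t.
Proof. by move=> _ h; rewrite ltNge; apply/negP => /surv_mono; rewrite leNgt h. Qed.

(** Both functions are monotone and [surv] moves by 1 / n between neighbouring
    grid points.  In the extreme cells [surv] is within 2 / n of 1 or 0, and one of
    the two bounds comes from 0 <= at_risk <= 1. *)
Lemma at_risk_uniform t : `|at_risk t - surv t| <= (a + 2) * eps.
Proof.
have [k /andP[k1 k2]] := cell t.
have kS : k.+1%:R = k%:R + 1 :> R by rewrite natr1.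
have q0 : 0 < n%:R^-1 :> R by rewrite invr_gt0.
have qe := inv_n_eps.
have nq : n%:R * n%:R^-1 = 1 :> R by rewrite divff// gt_eqF.
rewrite kS in k2.
have aeps0 : 0 <= a * eps by rewrite mulr_ge0// ltW.
have p0 := surv_ge0 t; have r0 := at_risk_ge0 t; have r1 := at_risk_le1 t.
have kn : (k <= n)%N.
  by rewrite -(ler_nat R) -[leRHS]mul1r -ler_pdivrMr//; apply: (le_trans k1); lra.
rewrite ler_norml; apply/andP; split.
  have [kn1|nk] := ltnP k.+1 n.
    have kk : (0 < k.+1 < n)%N by [].
    have gE := gridE kk; rewrite kS in gE.
    have h1 : t < grid k.+1 by apply: grid_gt => //; rewrite gE; move: k1 k2 q0; lra.
    have := at_risk_mono (ltW h1).
    have := at_risk_grid kk; rewrite gE ler_norml => /andP[h2 _].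
    move: k1 k2 h2 q0 qe aeps0; move: (n%:R^-1) => q; nra.
  have : n%:R <= k%:R + 1 :> R by rewrite -kS ler_nat.
  move=> h; have : n%:R * n%:R^-1 <= (k%:R + 1) * n%:R^-1 :> R by rewrite ler_pM2r.
  move: k1 k2 nq q0 qe aeps0 p0 r0; move: (n%:R^-1) => q; nra.
have [k2'|k2'] := leqP 2 k; last first.
  have : k%:R <= 1 :> R by rewrite lern1 -ltnS.
  move: k1 k2 nq q0 qe aeps0 p0 r1; move: (n%:R^-1) => q; nra.
have kk : (0 < k.-1 < n)%N.
  by rewrite -ltnS prednK ?k2' ?(ltn_trans _ k2')//= (leq_trans _ kn)// prednK ?(ltn_trans _ k2').
have kP : k.-1%:R = k%:R - 1 :> R by rewrite -subn1 natrB// (ltn_trans _ k2').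
have gE := gridE kk; rewrite kP in gE.
have h1 : grid k.-1 < t by apply: grid_lt => //; rewrite gE; move: k1 k2 q0; lra.
have := at_risk_mono (ltW h1).
have := at_risk_grid kk; rewrite gE ler_norml => /andP[_ h2].
move: k1 k2 h2 q0 qe aeps0; move: (n%:R^-1) => q; nra.
Qed.

Let ln_diff s t : s <= t -> t <= tau ->
  0 <= ln (1 - G s) - ln (1 - G t) <= (G t - G s) / g0.
Proof.
have Gtau := G_tau.
move=> st ttau; have h1 := G_mono st; have h2 := G_mono ttau.
rewrite subr_ge0 ler_ln ?posrE; [|lra..].
apply/andP; split; first lra.
rewrite -ln_div ?posrE; [|lra..].
have gt0 : 0 < 1 - G t by lra.
have -> : (1 - G s) / (1 - G t) = 1 + (G t - G s) / (1 - G t).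
  by field; rewrite gt_eqF.
apply: (@le_trans _ _ ((G t - G s) / (1 - G t))).
  apply: le_ln1Dx; apply: (@lt_le_trans _ _ 0) => //.
  by rewrite mulr_ge0 ?invr_ge0; lra.
by apply: ler_wpM2l; [lra|rewrite lef_pV2 ?posrE; lra].
Qed.

(** Again by monotonicity; here the increment of the cumulative hazard over a
    cell is 1 / (n p) up to a factor, p being the survival probability, and it
    is at most eps / sqrt p as long as p exceeds eps. *)
Lemma cens_hazard_uniform t : theta <= surv t ->
  `|cens_hazard t + ln (1 - G t)| <= (2 * b + 2 / g0) * eps / Num.sqrt (surv t).
Proof.
have [e0 e4 t8 Gtau] := And4 eps0 eps4 th8 G_tau.
move=> pth; set p := surv t in pth *.
have [k] := cell t; rewrite -/p => /andP[k1 k2].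
have kS : k.+1%:R = k%:R + 1 :> R by rewrite natr1.
have q0 : 0 < n%:R^-1 :> R by rewrite invr_gt0.
have qe := inv_n_eps.
rewrite kS in k2.
have p0 : 0 < p by lra.
have ttau : t <= tau by exact: surv_gt0_le_tau.
have p1 : p <= 1 := surv_le1 t.
pose sp := Num.sqrt p.
have sp0 : 0 < sp by rewrite sqrtr_gt0.
have sp2 : sp ^+ 2 = p by rewrite sqr_sqrtr// ltW.
have psp : p <= sp by rewrite -sp2; nra.
have g0i : 0 < g0^-1 by rewrite invr_gt0.
(* since 1 / n <= eps ^+ 2 and eps <= sqrt p *)
have qp : n%:R^-1 / p <= eps / sp.
  rewrite ler_pdivrMr// mulrAC ler_pdivlMr// -sp2.
  have : n%:R^-1 <= eps ^+ 2.
    by rewrite -div1r ler_pdivrMr// mulrC.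
  have es : eps <= sp by lra.
  move=> h; apply: (le_trans (ler_wpM2r (ltW sp0) h)).
  by rewrite expr2 -mulrA ler_pM2l// expr2 ler_pM2r.
have F1 : p <= 1 - F t.
  by rewrite /p /surv ler_piMr ?subr_ge0// gerBl.
have Gp : G t <= 1 - p.
  have := F_ge0 t; have := F_le1 t; have := G_ge0 t; have := G_le1 t.
  by rewrite /p /surv; nra.
have bs0 : 0 <= b * eps / sp by rewrite !mulr_ge0 ?invr_ge0// ltW.
have es0 : 0 <= eps / sp by rewrite divr_ge0 ?(ltW eps0) ?(ltW sp0).
have -> : (2 * b + 2 / g0) * eps / Num.sqrt p = 2 * (b * eps / sp) + 2 * (g0^-1 * (eps / sp)).
  by rewrite -/sp; ring.
(* an increment of G is at most that of surv divided by 1 - F u *)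
have hz s u (c : R) : s <= u -> u <= tau -> 0 < c -> c <= 1 - F u ->
    ln (1 - G s) - ln (1 - G u) <= (surv s - surv u) / c * g0^-1.
  move=> su ut c0 cF; have /andP[_ h] := ln_diff su ut.
  apply: (le_trans h); rewrite ler_pM2r// ler_pdivlMr//.
  have := F_mono su; have := G_mono su; rewrite /surv.
  have := G_le1 u; have := F_le1 s; have := G_le1 s.
  nra.
have ge0 x : 0 <= x -> 0 <= g0^-1 * x by move=> ?; rewrite mulr_ge0// ltW.
have gqp : g0^-1 * (n%:R^-1 / p) <= g0^-1 * (eps / sp) by rewrite ler_pM2l.
have sub_sqrt x (y : R) : 0 < y -> y <= x -> b * eps / Num.sqrt x <= b * eps / Num.sqrt y.
  move=> y0 yx; apply: ler_wpM2l; first by rewrite mulr_ge0// ltW.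
  by rewrite lef_pV2 ?posrE ?sqrtr_gt0 ?(lt_le_trans y0)// ler_sqrt// (le_trans (ltW y0)).
have kn8 : k%:R + 8 <= n%:R :> R.
  have nq : n%:R * n%:R^-1 = 1 :> R by rewrite divff// gt_eqF.
  rewrite -(ler_pM2r q0) nq mulrDl.
  move: k1 pth qe t8; move: (n%:R^-1) => q; lra.
rewrite ler_norml; apply/andP; split.
  have [k2'|k2'] := leqP 2 k; last first.
    have k1' : k%:R <= 1 :> R by rewrite lern1 -ltnS.
    have Gt1 : 0 < 1 - G t by have := G_mono ttau; lra.
    have l1 : - ln (1 - G t) <= G t * g0^-1.
      rewrite -lnV ?posrE//.
      have -> : (1 - G t)^-1 = 1 + G t / (1 - G t) by field; rewrite gt_eqF.
      apply: (@le_trans _ _ (G t / (1 - G t))).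
        apply: le_ln1Dx; apply: (@lt_le_trans _ _ 0) => //.
        by rewrite mulr_ge0 ?invr_ge0//; lra.
      apply: ler_wpM2l => //; rewrite lef_pV2 ?posrE//.
      by have := G_mono ttau; lra.
    have l2 : G t * g0^-1 <= 2 * (g0^-1 * (n%:R^-1 / p)).
      rewrite mulrC [2 * _]mulrCA ler_pM2l//.
      have : n%:R^-1 <= n%:R^-1 / p :> R.
        by rewrite ler_pdivlMr// ler_piMr// ltW.
      move: Gp k2 k1' q0; move: (n%:R^-1 / p) (n%:R^-1) => x q; nra.
    have c0 := cens_ge0 t.
    by move: l1 l2 c0 gqp bs0; lra.
  have kk : (0 < k.-1 < n)%N.
    have kn : (k < n)%N by rewrite -(ltr_nat R); move: kn8; lra.
    by rewrite -subn1 subn_gt0 k2' (leq_ltn_trans (leq_subr _ _) kn).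
  have kP : k.-1%:R = k%:R - 1 :> R by rewrite -subn1 natrB// (ltn_trans _ k2').
  have gE := gridE kk; rewrite kP in gE.
  have gp : p < surv (grid k.-1) by rewrite gE; move: k1 q0; move: n%:R^-1 => q; lra.
  have h1 : grid k.-1 < t by apply: grid_lt.
  have hth : theta / 2 <= surv (grid k.-1).
    by move: gp pth t8 e0; lra.
  have := cens_mono (ltW h1).
  have := cens_grid kk hth; rewrite ler_norml => /andP[h2 _] h3.
  have h4 := sub_sqrt _ _ p0 (ltW gp).
  have h5 := hz _ _ p (ltW h1) ttau p0 F1.
  have h6 : (surv (grid k.-1) - surv t) / p * g0^-1 <= 2 * (g0^-1 * (n%:R^-1 / p)).
    rewrite mulrC [2 * _]mulrCA ler_pM2l// mulrA ler_pM2r ?invr_gt0//.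
    rewrite gE -/p; move: k2 q0; move: n%:R^-1 => q; lra.
  rewrite -/sp in h4.
  by move: h2 h3 h4 h5 h6 gqp bs0; lra.
have kk : (0 < k.+1 < n)%N.
  by rewrite /= -(ltr_nat R) kS; move: kn8; lra.
have gE := gridE kk; rewrite kS in gE.
have gp : surv (grid k.+1) < p by rewrite gE; move: k2; move: n%:R^-1 => q; lra.
have gp2 : p / 2 <= surv (grid k.+1).
  by rewrite gE; move: k1 q0 pth qe t8; move: n%:R^-1 => q; lra.
have gp0 : 0 < surv (grid k.+1) by move: gp2 p0; lra.
have h1 : t < grid k.+1 by apply: grid_gt.
have utau : grid k.+1 <= tau by exact: surv_gt0_le_tau.
have hth : theta / 2 <= surv (grid k.+1) by move: gp2 pth; lra.
have := cens_mono (ltW h1).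
have := cens_grid kk hth; rewrite ler_norml => /andP[_ h2] h3.
have p40 : 0 < p / 4 by rewrite divr_gt0.
have p4 : p / 4 <= surv (grid k.+1) by move: gp2 p0; lra.
have h4 := sub_sqrt _ _ p40 p4.
have es4 : b * eps / Num.sqrt (p / 4) = 2 * (b * eps / sp).
  have -> : p / 4 = (sp / 2) ^+ 2 by rewrite expr_div_n sp2; congr (_ / _); ring.
  rewrite sqrtr_sqr ger0_norm ?divr_ge0 ?(ltW sp0)//.
  by field; rewrite gt_eqF.
have Fu : surv (grid k.+1) <= 1 - F (grid k.+1).
  by rewrite /surv ler_piMr ?subr_ge0// gerBl.
have h5 := hz _ _ _ (ltW h1) utau gp0 Fu.
have h6 : (surv t - surv (grid k.+1)) / surv (grid k.+1) * g0^-1 <= 2 * (g0^-1 * (n%:R^-1 / p)).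
  rewrite mulrC [2 * _]mulrCA ler_pM2l// -/p.
  apply: (@le_trans _ _ (n%:R^-1 / (p / 2))).
    apply: ler_pM; rewrite ?invr_ge0 ?(ltW gp0) ?subr_ge0 ?(ltW gp)//.
      by rewrite gE; move: k1; move: n%:R^-1 => q; lra.
    by rewrite lef_pV2 ?posrE// divr_gt0.
  apply: eq_leR; field; rewrite gt_eqF//=; by rewrite gt_eqF.
rewrite es4 in h4.
by move: h2 h3 h4 h5 h6 gqp bs0; lra.
Qed.

Let dl i := tt i <= cc i.

Hypothesis yy_inj : forall i j, (i < n)%N -> (j < n)%N -> yy i = yy j -> i = j.
Hypothesis tt_tau : forall i, (i < n)%N -> tt i <= tau.

(** [km_deviation] along the order statistics, with ks the first rank where
    [surv] falls below theta.  The largest observation, which gets the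
    Kaplan-Meier value 0, contributes g0^-1 / n at most. *)
Lemma km_weights_deviation (A B : R) :
  let c1 := 4 + A * (ln g0^-1 + 1) in
  1 <= A -> a + 2 <= A -> 2 * b + 2 / g0 <= A ->
  theta = B * eps -> 2 * A <= B -> 12 * c1 <= B -> 36 * A ^+ 2 * eps <= B ->
  n%:R^-1 * \sum_(i < n) (dl i)%:R *
      `|(kaplan_meier n yy dl (yy i))^-1 - (1 - G (tt i))^-1|
    <= (2 / g0 * (c1 + 4 * A) + 2 * B * (4 / g0) + g0^-1) * eps.
Proof.
move=> c1 A1 Aa Ab thB AB cB AeB.
have [e0 e4 t8 Gtau] := And4 eps0 eps4 th8 G_tau.
have g01 : 0 < g0 <= 1 by rewrite Gtau gerBl G_ge0.
have g0i : 0 < g0^-1 by rewrite invr_gt0.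
pose rk := rank_idx n yy.
have rkn k : (k < n)%N -> (rk k < n)%N by exact: rank_idx_lt.
have yy_tau i : (i < n)%N -> yy i <= tau.
  by move=> /tt_tau; apply: le_trans; rewrite ge_min lexx.
pose p k := surv (yy (rk k)).
pose L k := - ln (1 - G (yy (rk k))).
pose ks := find (fun k => p k < theta) (iota 0 n).
have hks : (ks <= n)%N by rewrite -[leqRHS](size_iota 0) find_size.
have pks k : (k < ks)%N -> B * eps <= p k.
  move=> kk; have := before_find 0%N kk.
  by rewrite nth_iota ?(leq_trans kk)// add0n -thB => /negbT; rewrite -leNgt.
have riskE k : (k < n)%N -> (n - k)%:R / n%:R = at_risk (yy (rk k)).
  by move=> kn; rewrite /at_risk card_rank_idx_ge// mulrC.
have hR0 k : (k < n)%N -> `|(n - k)%:R / n%:R - p k| <= A * eps.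
  move=> kn; rewrite riskE//; apply: (le_trans (at_risk_uniform _)).
  by rewrite ler_pM2r.
have hM k : (k < ks)%N ->
   `|n%:R^-1 * \sum_(0 <= j < k.+1) (1 - (dl (rk j))%:R) / p j - L k|
       <= A * eps / Num.sqrt (p k).
  move=> kk; have kn : (k < n)%N by exact: leq_trans hks.
  have -> : n%:R^-1 * \sum_(0 <= j < k.+1) (1 - (dl (rk j))%:R) / p j =
      cens_hazard (yy (rk k)).
    rewrite -(sum_rank_idx_le yy_inj (fun i => (1 - (dl i)%:R) / surv (yy i)) kn).
    congr (_ * _); apply: eq_bigr => i _.
    rewrite /dl; have [ct|tc] := ltP (cc i) (tt i); last first.
      by rewrite subrr !mul0r mulr0.
    have -> : yy i = cc i by rewrite /yy min_r// ltW.
    by rewrite subr0 !mul1r.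
  rewrite /L opprK; apply: (le_trans (cens_hazard_uniform _)).
    by rewrite thB; exact: pks.
  rewrite -/(p k) ler_wpM2r ?invr_ge0 ?sqrtr_ge0// ler_pM2r//.
have hL k : (k < n)%N -> 0 <= L k <= ln g0^-1.
  move=> kn; have h := G_mono (yy_tau _ (rkn _ kn)).
  have Gl : 0 < 1 - G (yy (rk k)) by lra.
  rewrite /L lnV ?posrE// lerN2 ler_ln ?posrE// oppr_ge0.
  by rewrite ln_le0 ?gerBl//=; lra.
have htail : (n - ks)%:R / n%:R <= 2 * (B * eps).
  move: hks; rewrite leq_eqVlt => /predU1P[->|ksn].
    by rewrite subnn mul0r -thB; lra.
  have := hR0 _ ksn; rewrite ler_norml => /andP[_ h].
  have hp : p ks < theta.
    have : has (fun k => p k < theta) (iota 0 n) by rewrite has_find size_iota.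
    by move/(nth_find 0%N); rewrite -/ks nth_iota.
  have AeBe : A * eps <= B * eps by rewrite ler_pM2r//; lra.
  by rewrite thB in hp; lra.
have := km_deviation e0 g01 A1 AB cB AeB e4 neps hks pks
  (fun k kk => hR0 k (leq_trans kk hks)) hM hL htail.
rewrite -/c1 => main.
have eL k : (k < n)%N -> dl (rk k) -> expR (L k) = (1 - G (tt (rk k)))^-1.
  move=> kn dk; have yt : yy (rk k) = tt (rk k) by rewrite /yy min_l.
  rewrite /L yt expRN lnK// posrE.
  by have := G_mono (tt_tau (rkn _ kn)); lra.
rewrite (sum_rank_idx n yy (fun i => (dl i)%:R *
   `|(kaplan_meier n yy dl (yy i))^-1 - (1 - G (tt i))^-1|)).
have n1 : n = n.-1.+1 by rewrite prednK.
rewrite [X in index_iota 0 X]n1 big_nat_recr//= mulrDr mulrDl; apply: lerD.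
  apply: le_trans main; apply: ler_wpM2l; first by rewrite invr_ge0 ltW.
  apply: ler_sum_nat => k /andP[_ kn1].
  have kn : (k < n)%N by rewrite (leq_trans kn1)// leq_pred.
  rewrite kaplan_meier_rank// kn1.
  have [dk|_] := boolP (dl (rk k)); last by rewrite !mul0r.
  by rewrite !mul1r eL.
rewrite mulrC; apply: ler_pM; rewrite ?mulr_ge0 ?invr_ge0 ?(ltW N0)//.
  have n1n : (n.-1 < n)%N by rewrite prednK.
  rewrite kaplan_meier_rank// ltnn invr0 sub0r normrN.
  have h := G_mono (tt_tau (rkn _ n1n)).
  have gt0 : 0 < 1 - G (tt (rk n.-1)) by lra.
  rewrite gtr0_norm ?invr_gt0//.
  apply: (@le_trans _ _ (1 * (1 - G (tt (rk n.-1)))^-1)).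
    by apply: ler_wpM2r; rewrite ?invr_ge0 ?(ltW gt0)// lern1 leq_b1.
  by rewrite mul1r lef_pV2 ?posrE//; lra.
Qed.

End censored_sample.

(** * Integrals under the law of one censored triple *)

(** Half-open intervals are stable under intersection and generate the Borel sets. *)
Lemma cdf_same_law {R : realType} {d : measure_display} {Omega : measurableType d}
    (P : probability Omega R) (Y Y' : {RV P >-> R}) (G : R -> R) :
  (forall t, cdf Y t = (G t)%:E) -> (forall t, cdf Y' t = (G t)%:E) ->
  forall A, measurable A -> P (Y @^-1` A) = P (Y' @^-1` A).
Proof.
move=> hY hY' A mA.
change (distribution P Y A = distribution P Y' A).
have oc (Z : {RV P >-> R}) (hZ : forall t, cdf Z t = (G t)%:E) a b :
    distribution P Z `]a, b]%classic = if a <= b then (G b - G a)%:E else 0%E.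
  case: ifPn => ab; last first.
    by rewrite set_itv_ge ?measure0// bnd_simp -leNgt ltW// ltNge.
  rewrite -(law_oc hZ ab).
  have -> : `]a, b]%classic = [set c | (a < c <= b)%R] by [].
  by [].
apply: (@measure_unique _ _ _ (@ocitv R) (fun n => `]- n%:R, n%:R]%classic)) => //.
- exact: ocitvI.
- by move=> i; exists (- i%:R, i%:R).
- exact: bigcup_itvT.
- by move=> _ [[a b] _ <-]; rewrite /= !oc.
- by move=> k; apply: (@le_lt_trans _ _ 1%E); [exact: probability_le1|rewrite ltry].
Qed.

Section pair_rv.
Context {R : realType} {d : measure_display} {Omega : measurableType d}.
Variable P : probability Omega R.

(** Named so as to carry the instance that gives the pair a distribution. *)
Definition pair_rv (T X : {RV P >-> R}) (w : Omega) : R * R := (T w, X w).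

Lemma measurable_pair_rv T X : measurable_fun setT (pair_rv T X).
Proof. exact: measurable_fun_pair. Qed.

HB.instance Definition _ T X :=
  isMeasurableFun.Build _ _ _ _ (pair_rv T X) (@measurable_pair_rv T X).

End pair_rv.

Section censored_law.
Context {R : realType} {d : measure_display} {Omega : measurableType d}.
Variables (P : probability Omega R) (T X C : {RV P >-> R}) (F G : R -> R).
Hypotheses (T_cdf : forall t, cdf T t = (F t)%:E) (F_cont : continuous F).
Hypotheses (C_cdf : forall t, cdf C t = (G t)%:E) (G_cont : continuous G).

Local Notation mu1 := (distribution P (pair_rv T X)).
Local Notation mu2 := (distribution P C).
Local Notation Q := (mu1 \x mu2)%E.

Lemma censored_law_total : Q setT = 1%E.
Proof.
rewrite -setXTT product_measure1E//.
transitivity (mu1 setT * mu2 setT)%E; first by [].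
by rewrite !probability_setT mule1.
Qed.

Local Notation S := ((R * R) * R)%type.

Let m_t : measurable_fun setT (fun z : S => z.1.1).
Proof. exact: (measurableT_comp measurable_fst measurable_fst). Qed.

Let m_c : measurable_fun setT (fun z : S => z.2).
Proof. exact: measurable_snd. Qed.

(** Integrating out T first. *)
Lemma integral_censored (g : R -> R) :
  measurable_fun setT g -> (forall c, 0 <= g c) ->
  \int[Q]_z ((z.2 < z.1.1)%R%:R * g z.2) = \int[mu2]_c ((1 - F c) * g c).
Proof.
move=> mg g0; rewrite /Rintegral; congr fine.
have mI : measurable_fun setT (fun z : S => (z.2 < z.1.1)%R%:R : R).
  by apply: measurable_natb; exact: measurable_set_ltf.
rewrite (fubini_tonelli2 (fun z : S => ((z.2 < z.1.1)%R%:R * g z.2)%:E)); last 2 first.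
- apply/measurable_EFinP; apply: measurable_funM => //.
  exact: measurableT_comp.
- by move=> z; rewrite lee_fin mulr_ge0.
apply: eq_integral => c _; rewrite /fubini_G /=.
under eq_integral do rewrite mulrC EFinM.
have mc : measurable [set z : R * R | (c < z.1)%R].
  by apply: measurable_set_ltf.
rewrite ge0_integralZl//; last 2 first.
- by apply/measurable_EFinP; exact: measurable_natb.
- by rewrite lee_fin.
rewrite mulrC EFinM; congr (_ * _)%E.
transitivity (\int[mu1]_z (\1_[set z : R * R | (c < z.1)%R] z)%:E)%E.
  apply: eq_integral => z _; rewrite indicE; congr (nat_of_bool _)%:R%:E.
  by apply/idP/idP; rewrite inE.
by rewrite integral_indic// setIT -(law_gt T_cdf).
Qed.

(** Integrating out C first. *)
Lemma integral_uncensored (psi : R * R -> R) :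
  measurable_fun setT psi -> (forall z, 0 <= psi z) ->
  \int[Q]_z ((z.1.1 <= z.2)%R%:R * psi z.1) = \int[mu1]_z ((1 - G z.1) * psi z).
Proof.
move=> mg g0; rewrite /Rintegral; congr fine.
have mI : measurable_fun setT (fun z : S => (z.1.1 <= z.2)%R%:R : R).
  by apply: measurable_natb; exact: measurable_set_lef.
rewrite (fubini_tonelli1 (fun z : S => ((z.1.1 <= z.2)%R%:R * psi z.1)%:E)); last 2 first.
- apply/measurable_EFinP; apply: measurable_funM => //.
  exact: measurableT_comp.
- by move=> z; rewrite lee_fin mulr_ge0.
apply: eq_integral => z _; rewrite /fubini_F /=.
under eq_integral do rewrite mulrC EFinM.
have mc : measurable [set c : R | (z.1 <= c)%R] by exact: measurable_set_ge.
rewrite ge0_integralZl//; last 2 first.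
- by apply/measurable_EFinP; exact: measurable_natb.
- by rewrite lee_fin.
rewrite mulrC EFinM; congr (_ * _)%E.
transitivity (\int[mu2]_c (\1_[set c : R | (z.1 <= c)%R] c)%:E)%E.
  apply: eq_integral => c _; rewrite indicE; congr (nat_of_bool _)%:R%:E.
  by apply/idP/idP; rewrite inE.
by rewrite integral_indic// setIT -(law_ge C_cdf G_cont).
Qed.

Lemma integral_at_risk t :
  \int[Q]_z (t <= Num.min z.1.1 z.2)%R%:R = surv F G t.
Proof.
have E : [set z : S | (t <= Num.min z.1.1 z.2)%R] =
    [set z : R * R | (t <= z.1)%R] `*` [set c | (t <= c)%R].
  apply/seteqP; split => z /=; first by rewrite le_min => /andP[].
  by move=> [h1 h2]; rewrite le_min h1.
have m1 : measurable [set z : R * R | (t <= z.1)%R] by exact: measurable_set_lef.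
rewrite Rintegral_natb; last by rewrite E; apply: measurableX => //; exact: measurable_set_ge.
transitivity (fine (Q ([set z : R * R | (t <= z.1)%R] `*` [set c | (t <= c)%R]))).
  by rewrite -E.
rewrite product_measure1E//; last exact: measurable_set_ge.
transitivity (fine (distribution P T [set c | (t <= c)%R] *
   distribution P C [set c | (t <= c)%R])%E); first by [].
by rewrite (law_ge T_cdf F_cont) (law_ge C_cdf G_cont).
Qed.

Variable tau : R.
Hypotheses (F_tau : F tau = 1) (G_tau : 0 < 1 - G tau).
Local Notation g0 := (1 - G tau).
Local Notation sv := (surv F G).

(** The summand of [cens_hazard] as a function of the triple ((T, X), C). *)
Definition cens_term t (z : S) : R := (z.2 < z.1.1)%R%:R * ((z.2 <= t)%R%:R / sv z.2).

Let measF : measurable_fun setT F. Proof. exact: continuous_measurable_fun. Qed.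
Let measG : measurable_fun setT G. Proof. exact: continuous_measurable_fun. Qed.

Let meas_sv : measurable_fun setT sv.
Proof. by apply: measurable_funM; apply: measurable_funB. Qed.

Let meas_cterm t (k : nat) : measurable_fun setT (fun c : R => (c <= t)%R%:R / sv c ^+ k : R).
Proof.
apply: measurable_funM; first by apply: measurable_natb; exact: measurable_set_le.
by apply: measurable_funV; exact: measurable_funX.
Qed.

Lemma measurable_cens_term t : measurable_fun setT (cens_term t).
Proof.
apply: measurable_funM; first by apply: measurable_natb; exact: measurable_set_ltf.
exact: (measurableT_comp (meas_cterm t 1)).
Qed.

Let sv_ge0 t : 0 <= sv t.
Proof.
by apply: mulr_ge0; rewrite subr_ge0; [exact: cdf_le1_real T_cdf _|exact: cdf_le1_real C_cdf _].
Qed.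

Let sv_anti s t : s <= t -> sv t <= sv s.
Proof.
move=> st; apply: ler_pM; rewrite ?subr_ge0.
- exact: cdf_le1_real T_cdf _.
- exact: cdf_le1_real C_cdf _.
- by rewrite lerB// (cdf_mono T_cdf).
- by rewrite lerB// (cdf_mono C_cdf).
Qed.

Lemma cens_term_bound t z : 0 < sv t -> 0 <= cens_term t z <= (sv t)^-1.
Proof.
move=> st; rewrite /cens_term.
have [ct|tc] := leP z.2 t; last by rewrite mul0r mulr0 lexx invr_ge0 ltW.
have h : 0 < sv z.2 by apply: (lt_le_trans st); exact: sv_anti.
rewrite mul1r; case: (_ < _); last by rewrite mul0r lexx invr_ge0 ltW.
rewrite mul1r invr_ge0 ltW//=.
by rewrite lef_pV2 ?posrE//; exact: sv_anti.
Qed.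

Let sv_factors c t : 0 < sv t -> c <= t -> 0 < 1 - F c /\ g0 <= 1 - G c.
Proof.
move=> st ct.
have sc : 0 < sv c by apply: (lt_le_trans st); exact: sv_anti.
have F1 := cdf_le1_real T_cdf c.
have F0 : 0 < 1 - F c.
  rewrite lt_neqAle subr_ge0 F1 andbT eq_sym.
  by apply/eqP => e; move: sc; rewrite /surv e mul0r ltxx.
split=> //; rewrite lerB//; apply: (cdf_mono C_cdf).
rewrite leNgt; apply/negP => /ltW /(cdf_mono T_cdf); rewrite F_tau => h.
by move: F0; have := F1; lra.
Qed.

(** The factor 1 - F of [surv] is the probability that C is observed, and what
    remains is the hazard integral of G. *)
Lemma integral_cens_term t : 0 < sv t ->
  \int[Q]_z cens_term t z = - ln (1 - G t).
Proof.
move=> st.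
have g_pos c : 0 <= (c <= t)%R%:R / sv c by rewrite divr_ge0.
rewrite /cens_term (@integral_censored (fun c => (c <= t)%R%:R / sv c))//; last first.
  exact: (meas_cterm t 1).
have Gt : G t < 1 by have [_] := sv_factors st (lexx t); have := G_tau; lra.
rewrite -(integral_hazard C_cdf G_cont Gt); apply: eq_Rintegral => c _.
rewrite /hazard_integrand; have [ct|tc] := leP c t; last by rewrite !mul0r mulr0.
have [F0 G0] := sv_factors st ct.
have gt0 := G_tau.
by rewrite /surv !mul1r invfM mulrA divff ?mul1r// gt_eqF.
Qed.

(** The source of the fluctuation q / sqrt p of the empirical hazard. *)
Lemma integral_cens_term_sqr t : 0 < sv t ->
  \int[Q]_z cens_term t z ^+ 2 <= (sv t * g0)^-1.
Proof.
move=> st.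
have g_pos c : 0 <= (c <= t)%R%:R / sv c ^+ 2 by rewrite divr_ge0// sqr_ge0.
have gt0 := G_tau.
have -> : \int[Q]_z cens_term t z ^+ 2 =
   \int[Q]_z ((z.2 < z.1.1)%R%:R * ((z.2 <= t)%R%:R / sv z.2 ^+ 2)).
  apply: eq_Rintegral => z _; rewrite /cens_term exprMn expr_div_n.
  by case: (_ < _); case: (_ <= _); rewrite ?expr1n ?expr0n.
rewrite (@integral_censored (fun c => (c <= t)%R%:R / sv c ^+ 2))//.
have nu1 : mu2 setT = 1%E by exact: probability_setT.
have pt c : 0 <= (1 - F c) * ((c <= t)%R%:R / sv c ^+ 2) <= (sv t * g0)^-1.
  have [ct|tc] := leP c t; last first.
    by rewrite mul0r mulr0 lexx invr_ge0 mulr_ge0// ltW.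
  have [F0 G0] := sv_factors st ct.
  have sc := sv_anti ct.
  have Gc : 0 < 1 - G c by exact: lt_le_trans G0.
  have -> : (1 - F c) * (1%:R / sv c ^+ 2) = (sv c * (1 - G c))^-1.
    by rewrite /surv; field; rewrite !gt_eqF.
  have sc0 : 0 < sv c by exact: lt_le_trans sc.
  rewrite invr_ge0 mulr_ge0 ?(ltW sc0) ?(ltW Gc)//=.
  rewrite lef_pV2 ?posrE; [|exact: mulr_gt0|exact: mulr_gt0].
  by apply: ler_pM => //; exact: ltW.
apply: (@le_trans _ _ (\int[mu2]_c (sv t * g0)^-1)); last first.
  rewrite Rintegral_cst//.
  have -> : fine (mu2 setT) = 1 by rewrite nu1.
  by rewrite mulr1.
apply: le_Rintegral => //.
- apply: (bounded_Qintegrable nu1 (b := (sv t * g0)^-1)).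
    by apply: measurable_funM; [exact: measurable_funB|exact: meas_cterm].
  by move=> c; have /andP[h1 h2] := pt c; rewrite ger0_norm.
- apply: (bounded_Qintegrable nu1 (b := `|(sv t * g0)^-1|)) => //.
- by move=> c _; have /andP[] := pt c.
Qed.

End censored_law.

(** * The rate, null events and ties *)

Section rate.
Context {R : realType}.

Definition rate (n : nat) : R := Num.sqrt (ln n%:R / n%:R).

Lemma rate_sqr n : n%:R * rate n ^+ 2 = ln n%:R.
Proof.
case: n => [|n]; first by rewrite mul0r ln0.
rewrite sqr_sqrtr; first by rewrite mulrCA divff ?mulr1.
by rewrite divr_ge0// ln_ge0 ?ler1n.
Qed.

Lemma rate_gt0 n : (1 < n)%N -> 0 < rate n.
Proof.
by move=> n1; rewrite sqrtr_gt0 divr_gt0 ?ln_gt0 ?ltr1n ?ltr0n// (ltn_trans _ n1).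
Qed.

(** Because expR 1 <= 4, by [expR_le_quadratic] at 1/3. *)
Lemma ln_ge1 n : (4 <= n)%N -> 1 <= ln n%:R :> R.
Proof.
move=> n4; have n0 : 0 < n%:R :> R by rewrite ltr0n (leq_trans _ n4).
rewrite -[leLHS]expRK ler_ln ?posrE ?expR_gt0//.
have h : expR (1 : R) <= 4.
  have e3 : expR (1 : R) = expR (3^-1) ^+ 3.
    by rewrite -expRM_natl; congr expR; field.
  have : expR (3^-1 : R) <= 1 + 3^-1 + 3^-1 ^+ 2.
    by apply: expR_le_quadratic; rewrite ger0_norm.
  have := expR_ge0 (3^-1 : R); rewrite e3; move: (expR (3^-1 : R)) => x x0 x1.
  have x2 : x <= 13 / 9 by lra.
  have : x ^+ 3 <= (13 / 9) ^+ 3 by rewrite lerXn2r ?nnegrE//; lra.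
  by lra.
by apply: (le_trans h); rewrite (ler_nat _ 4 n).
Qed.

(** From ln s <= s applied to the square root of n. *)
Lemma rate_small (c : R) : 0 < c -> \forall n \near \oo, rate n <= c.
Proof.
move=> c0.
exists (Num.truncn (4 / c ^+ 4)).+1 => // n /= nN.
have n0 : (0 < n)%N by exact: leq_trans nN.
have n0' : 0 < n%:R :> R by rewrite ltr0n.
have h : 4 / c ^+ 4 <= n%:R.
  apply: ltW; apply: (lt_le_trans (truncnS_gt _)); by rewrite ler_nat.
have -> : c = Num.sqrt (c ^+ 2) by rewrite sqrtr_sqr gtr0_norm.
rewrite ler_sqrt ?sqr_ge0// ler_pdivrMr//.
pose s := Num.sqrt (n%:R : R).
have s0 : 0 < s by rewrite sqrtr_gt0.
have s2 : s ^+ 2 = n%:R by rewrite sqr_sqrtr// ltW.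
have ls : ln (n%:R : R) <= 2 * s.
  rewrite -s2 lnXn// -[_ *+ 2]mulr_natl ler_pM2l//.
  have -> : s = 1 + (s - 1) by ring.
  by apply: (le_trans (le_ln1Dx _)); lra.
apply: (le_trans ls); rewrite -s2 expr2 mulrA ler_pM2r//.
have c20 : 0 < c ^+ 2 by rewrite exprn_gt0.
rewrite mulrC -ler_pdivrMr// -(@ler_sqr _ (2 / c ^+ 2)) ?nnegrE ?(ltW s0)//; last first.
  by rewrite divr_ge0// ltW.
rewrite s2; apply: le_trans h.
by apply: eq_leR; field; rewrite gt_eqF.
Qed.

End rate.

Section null_events.
Context {R : realType} {d : measure_display} {Omega : measurableType d}.
Variable P : probability Omega R.

Lemma ae_P0 (E : set Omega) : measurable E -> P E = 0%E -> {ae P, forall w, ~ E w}.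
Proof.
move=> mE E0; exists E; split => // w /= h.
exact: contrapT.
Qed.

(** The diagonal has measure 0 for a product law one factor of which has no
    atom, since its sections are points. *)
Lemma no_tie (U V : {RV P >-> R}) :
  (forall A B, measurable A -> measurable B ->
     P (U @^-1` A `&` V @^-1` B) = (P (U @^-1` A) * P (V @^-1` B))%E) ->
  (forall v, P (V @^-1` [set v]) = 0%E) ->
  {ae P, forall w, U w <> V w}.
Proof.
move=> UV V0.
pose D := [set z : R * R | z.1 = z.2].
have mD : measurable D.
  have -> : D = [set z : R * R | (z.1 <= z.2)%R] `&` [set z | (z.2 <= z.1)%R].
    apply/seteqP; split => [z /= ->|z /= [h1 h2]]; first by rewrite lexx.
    by apply/eqP; rewrite eq_le h1 h2.
  by apply: measurableI; apply: measurable_set_lef.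
have E : P [set w | U w = V w] = 0%E.
  transitivity (distribution P (pair_rv U V) D); first by [].
  transitivity ((distribution P U \x distribution P V)%E D).
    by apply/esym; apply: (product_measure_unique (m' := distribution P (pair_rv U V))).
  rewrite /product_measure1; apply: integral0_eq => x _ /=.
  rewrite -[RHS](V0 x) /distribution /pushforward; congr (P _).
  by apply/seteqP; split => w /=; rewrite /xsection /= ?inE.
have mE : measurable [set w | U w = V w].
  have := @measurable_pair_rv _ _ _ P U V measurableT D mD.
  by rewrite setTI.
exact: ae_P0 mE E.
Qed.

End null_events.

(** * Almost sure control of the Kaplan-Meier weights *)

Section censored_iid.
Context {R : realType} {d : measure_display} {Omega : measurableType d}.
Variable P : probability Omega R.
Variables (X T : {RV P >-> R}) (X_ T_ C_ : nat -> {RV P >-> R}).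
Variables (F G : R -> R) (tau : R).
Hypotheses (T_cdf : forall t, cdf T t = (F t)%:E) (F_cont : continuous F).
Hypothesis TX_copies : forall i,
  same_law P (fun w => (T_ i w, X_ i w)) (fun w => (T w, X w)).
Hypothesis TX_indep : mutually_independent P (fun i w => (T_ i w, X_ i w)).
Hypotheses (C_cdf : forall i t, cdf (C_ i) t = (G t)%:E) (G_cont : continuous G).
Hypothesis C_indep : mutually_independent P (fun i w => C_ i w).
Hypothesis TX_C_indep :
  independent_seqs P (fun i w => (T_ i w, X_ i w)) (fun i w => C_ i w).
Hypotheses (F_tau : F tau = 1) (G_tau : 0 < 1 - G tau).

Local Notation mu1 := (distribution P (pair_rv T X)).
Local Notation mu2 := (distribution P (C_ 0)).
Local Notation Q := (mu1 \x mu2)%E.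
Local Notation S := ((R * R) * R)%type.

Definition datum i w : S := ((T_ i w, X_ i w), C_ i w).

Lemma measurable_datum i : measurable_fun setT (datum i).
Proof. by apply: measurable_fun_pair => //; exact: measurable_fun_pair. Qed.

Let mTX i : measurable_fun setT (fun w => (T_ i w, X_ i w)).
Proof. exact: measurable_fun_pair. Qed.

Let TX_law i A : measurable A -> P ((fun w => (T_ i w, X_ i w)) @^-1` A) = mu1 A.
Proof. exact: TX_copies. Qed.

Let C_law i A : measurable A -> P (C_ i @^-1` A) = mu2 A.
Proof. exact: (cdf_same_law (C_cdf i) (C_cdf 0)). Qed.

Lemma datum_prod n (f : S -> R) : measurable_fun setT f ->
  (forall z, 0 <= f z) -> (exists b, forall z, f z <= b) ->
  (\int[P]_w (\prod_(i < n) f (datum i w))%:E = ((\int[Q]_z f z)%R ^+ n)%:E)%E.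
Proof.
move=> mf f0 fb.
have := @expectation_prod _ _ _ _ _ _ _ P (fun i w => (T_ i w, X_ i w)) (fun i w => C_ i w)
  mTX (fun i => measurable_funPT (C_ i)) mu1 mu2 TX_law C_law TX_indep C_indep TX_C_indep n (fun _ => f).
move=> /(_ (fun _ => mf) (fun _ => f0) (fun _ => fb)) ->.
by rewrite prodr_const card_ord.
Qed.

Definition obs i w : R := Num.min (T_ i w) (C_ i w).

Lemma measurable_obs i : measurable_fun setT (obs i).
Proof. exact: measurable_minr. Qed.

HB.instance Definition _ i := isMeasurableFun.Build _ _ _ _ (obs i) (measurable_obs i).

Let T_point i t : P (T_ i @^-1` [set t]) = 0%E.
Proof.
have := TX_law i (_ : measurable ([set t] `*` setT)).
have -> : (fun w => (T_ i w, X_ i w)) @^-1` ([set t] `*` setT) = T_ i @^-1` [set t].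
  by apply/seteqP; split => w /=; [case|].
move=> ->; last exact: measurableX.
rewrite -(law_point T_cdf F_cont t) /distribution /pushforward; congr (P _).
by apply/seteqP; split => w /=; [case|].
Qed.

(** Two observations are independent copies of min (T, C), whose law has no
    atom since neither T nor C has one. *)
Lemma obs_no_tie : {ae P, forall w, forall i j, i != j -> obs i w <> obs j w}.
Proof.
apply: ae_foralln => i; apply: ae_foralln => j.
have [->|ij] := eqVneq i j; first by apply: aeW => w; rewrite ?eqxx.
suff h : {ae P, forall w, obs i w <> obs j w}.
  by apply: filterS h => w hw _.
apply: no_tie => [A B mA mB|v].
  pose y (z : S) := Num.min z.1.1 z.2.
  have my : measurable_fun setT y.
    apply: measurable_minr; last exact: measurable_snd.
    exact: (measurableT_comp measurable_fst measurable_fst).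
  have two := @independent_two _ _ _ _ _ _ _ P (fun i w => (T_ i w, X_ i w)) (fun i w => C_ i w)
    mTX (fun i => measurable_funPT (C_ i)) mu1 mu2 TX_law C_law TX_indep C_indep TX_C_indep.
  have my' D : measurable D -> measurable (y @^-1` D).
    by move=> mD; rewrite -[X in measurable X]setTI; exact: my.
  have law1 k D : measurable D -> P (obs k @^-1` D) = Q (y @^-1` D).
    move=> mD; have := two k k.+1 _ setT (my' D mD) measurableT.
    rewrite preimage_setT setIT (_ : k != k.+1) ?neq_ltn ?ltnSn// => /(_ isT).
    have -> : Q setT = 1%E by exact: censored_law_total.
    by rewrite mule1.
  by rewrite !law1// -(two i j _ _ (my' A mA) (my' B mB) ij).
apply/eqP; rewrite eq_le measure_ge0 andbT.
have mT : measurable (T_ j @^-1` [set v]) by exact: measurable_funPTI.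
have mC : measurable (C_ j @^-1` [set v]) by exact: measurable_funPTI.
have C0 : P (C_ j @^-1` [set v]) = 0%E by exact: (law_point (C_cdf j) G_cont).
apply: (@le_trans _ _ (P (T_ j @^-1` [set v] `|` C_ j @^-1` [set v]))).
  apply: le_measure; rewrite ?inE; first exact: measurable_funPTI.
    exact: measurableU.
  move=> w /=; rewrite /obs; case: (leP (T_ j w) (C_ j w)) => _ h; by [left|right].
apply: (le_trans (measureU2 _ mT mC)).
apply: (@le_trans _ _ (0 + 0)%E); last by rewrite adde0.
by apply: leeD; rewrite le_eqVlt; apply/orP; left; apply/eqP; [exact: T_point|exact: C0].
Qed.

Lemma ae_sample (A : set (R * R)) : measurable A -> P (pair_rv T X @^-1` A) = 0%E ->
  {ae P, forall w, forall i, ~ A (T_ i w, X_ i w)}.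
Proof.
move=> mA A0; apply: ae_foralln => i.
apply: (ae_P0 (P := P) (E := (fun w => (T_ i w, X_ i w)) @^-1` A)).
  by rewrite -[X in measurable X]setTI; exact: mTX.
by rewrite TX_law.
Qed.

Lemma ae_le_tau : {ae P, forall w, forall i, T_ i w <= tau}.
Proof.
have h : {ae P, forall w, forall i, ~ [set z : R * R | (tau < z.1)%R] (T_ i w, X_ i w)}.
  apply: ae_sample; first exact: measurable_set_ltf.
  transitivity (distribution P T [set t | (tau < t)%R]); first by [].
  by rewrite (law_gt T_cdf) F_tau subrr.
by apply: filterS h => w hw i; rewrite leNgt; apply/negP; exact: hw.
Qed.

Local Notation sv := (surv F G).

Lemma surv_continuous : continuous sv.
Proof.
move=> t; apply: cvgM; apply: cvgB; try exact: cvg_cst.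
  exact: F_cont.
exact: G_cont.
Qed.

(** [surv] is continuous, vanishes at tau and tends to 1 at -oo. *)
Lemma surv_quantile u : 0 < u < 1 -> exists t, sv t = u.
Proof.
move=> /andP[u0 u1].
have u2 : 0 < (1 - u) / 2 by rewrite divr_gt0// subr_gt0.
have [a1 h1] := cdf_small T_cdf u2.
have [a2 h2] := cdf_small (C_cdf 0) u2.
pose a := Num.min (Num.min a1 a2) tau.
have Fa : F a < (1 - u) / 2.
  by apply: le_lt_trans h1; apply: (cdf_mono T_cdf); rewrite !ge_min lexx.
have Ga : G a < (1 - u) / 2.
  by apply: le_lt_trans h2; apply: (cdf_mono (C_cdf 0)); rewrite !ge_min lexx orbT.
have sa : u <= sv a.
  have := cdf_ge0_real T_cdf a; have := cdf_ge0_real (C_cdf 0) a.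
  by rewrite /surv; nra.
have st : sv tau <= u by rewrite /surv F_tau subrr mul0r ltW.
have atau : a <= tau by rewrite ge_min lexx orbT.
have := @IVT R sv a tau u atau; case.
- by apply: continuous_subspaceT => x; exact: surv_continuous.
- by rewrite ge_min st orbT le_max sa.
- by move=> c _ e; exists c.
Qed.

(** The grid on which the empirical processes are first controlled; the default
    value 0 does not occur for 0 < k < n. *)
Definition quantile (n k : nat) : R := xget 0 [set t | sv t = 1 - k%:R / n%:R].

Lemma surv_quantileE n k : (0 < k < n)%N -> sv (quantile n k) = 1 - k%:R / n%:R.
Proof.
move=> /andP[k0 kn]; rewrite /quantile; case: xgetP => [t -> //|h].
have n0 : 0 < n%:R :> R by rewrite ltr0n (leq_trans _ kn).
have k0' : 0 < k%:R :> R by rewrite ltr0n.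
have [|t e] := @surv_quantile (1 - k%:R / n%:R); last by case: (h t).
by rewrite subr_gt0 ltr_pdivrMr// mul1r ltr_nat kn/= ltrBlDr ltrDl divr_gt0.
Qed.

Let F_mono : {homo F : x y / x <= y}. Proof. by move=> *; exact: (cdf_mono T_cdf). Qed.
Let G_mono : {homo G : x y / x <= y}. Proof. by move=> *; exact: (cdf_mono (C_cdf 0)). Qed.
Let Q1 : Q setT = 1%E. Proof. exact: censored_law_total. Qed.
Let mD := measurable_datum.
Let Dprod := datum_prod.

Local Notation g0 := (1 - G tau).

Let le_cube n : n%:R <= 1 * n%:R ^+ 3 :> R.
Proof.
rewrite mul1r -natrX ler_nat.
by case: n => // n; rewrite -[X in (X <= _)%N]expn1 leq_pexp2l.
Qed.

(** An average of indicators, with variance at most 1. *)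
Let ae_at_risk : {ae P, forall w, \forall n \near \oo, forall k, (0 < k < n)%N ->
  `|at_risk n (T_ ^~ w) (C_ ^~ w) (quantile n k) - sv (quantile n k)| <= 6 * rate n}.
Proof.
pose g n k (z : S) : R := (quantile n k <= Num.min z.1.1 z.2)%R%:R.
have mg n k : measurable_fun setT (g n k).
  apply: measurable_natb; apply: measurable_set_lef => //.
  apply: measurable_minr; last exact: measurable_snd.
  exact: (measurableT_comp measurable_fst measurable_fst).
have := @ae_deviations _ _ _ _ _ P Q datum mD Q1 Dprod 1 id g (fun n k => (0 < k)%N)
  (fun n k => rate n) (fun _ _ => 1) (fun n k => 6 * rate n) mg.
case.
- exact: le_cube.
- have : \forall n \near \oo, rate n <= 3^-1 :> R by apply: rate_small.
  move=> h; near=> n => k kn k0.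
  have r3 : rate n <= 3^-1 :> R by near: n.
  have n2 : (1 < n)%N by near: n; exists 2%N.
  split.
  + exact: rate_gt0.
  + move=> z; apply: le_trans r3; rewrite ler_piMr//; first exact/ltW/rate_gt0.
    by rewrite /g normr_nat lern1 leq_b1.
  + have -> : \int[Q]_z g n k z ^+ 2 = \int[Q]_z g n k z.
      by apply: eq_Rintegral => z _; rewrite /g -natrX; case: (_ <= _).
    rewrite (integral_at_risk X T_cdf F_cont (C_cdf 0) G_cont).
    by apply: surv_le1 => t; [exact: cdf_ge0_real T_cdf _|exact: cdf_le1_real T_cdf _|exact: cdf_ge0_real (C_cdf 0) _|exact: cdf_le1_real (C_cdf 0) _].
  + apply: eq_leR; rewrite mulr1.
    have -> : rate n * (6 * rate n) - rate n ^+ 2 = 5 * rate n ^+ 2 :> R by ring.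
    by rewrite mulrCA rate_sqr.
move=> Z [mZ Z0 hZ]; exists Z; split => // w /= h; apply: hZ => /= h'; apply: h.
move: h' => [m _ h']; exists m => // n /= mn k /andP[k0 kn].
have := h' n mn k kn k0.
by rewrite (integral_at_risk X T_cdf F_cont (C_cdf 0) G_cont) => /ltW.
Unshelve. all: by end_near. Qed.

(** The variance is at most 1 / (p g0), p being the survival probability, and
    l = rate n * sqrt p balances the two terms of the exponent.  The terms of
    the average are bounded by 1 / p, so that l is admissible where p >= 9 rate. *)
Let ae_cens_hazard : {ae P, forall w, \forall n \near \oo, forall k, (0 < k < n)%N ->
  9 * rate n <= sv (quantile n k) ->
  `|cens_hazard F G n (T_ ^~ w) (C_ ^~ w) (quantile n k) + ln (1 - G (quantile n k))|
    <= (5 + g0^-1) * rate n / Num.sqrt (sv (quantile n k))}.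
Proof.
have g00 := G_tau.
pose p n k : R := sv (quantile n k).
pose g n k (z : S) : R := cens_term F G (quantile n k) z.
have mg n k : measurable_fun setT (g n k).
  exact: measurable_cens_term.
have := @ae_deviations _ _ _ _ _ P Q datum mD Q1 Dprod 1 id g
  (fun n k => (0 < k)%N && (9 * rate n <= p n k))
  (fun n k => rate n * Num.sqrt (p n k)) (fun n k => (p n k * g0)^-1)
  (fun n k => (5 + g0^-1) * rate n / Num.sqrt (p n k)) mg.
case.
- exact: le_cube.
- have : \forall n \near \oo, rate n <= 1 :> R by apply: rate_small.
  move=> h; near=> n => k kn /andP[k0 pk].
  have r1 : rate n <= 1 :> R by near: n.
  have n2 : (1 < n)%N by near: n; exists 2%N.
  have r0 : 0 < rate n :> R by exact: rate_gt0.
  have p0 : 0 < p n k by lra.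
  have sp0 : 0 < Num.sqrt (p n k) by rewrite sqrtr_gt0.
  have sp2 : Num.sqrt (p n k) ^+ 2 = p n k by rewrite sqr_sqrtr// ltW.
  split.
  + exact: mulr_gt0.
  + move=> z; have /andP[c0 c1] := cens_term_bound T_cdf (C_cdf 0) z p0.
    rewrite ger0_norm//.
    apply: (@le_trans _ _ (rate n * Num.sqrt (p n k) * (p n k)^-1)).
      by apply: ler_wpM2l => //; rewrite mulr_ge0 ?ltW.
    rewrite ler_pdivrMr// [leRHS]mulrC ler_pdivlMr//.
    rewrite -[X in _ <= X]sp2.
    set s := Num.sqrt (p n k) in sp0 sp2 *.
    have : 3 * rate n <= s.
      rewrite -ler_sqr ?nnegrE ?(ltW sp0) ?mulr_ge0 ?(ltW r0)// sp2.
      by apply: le_trans pk; rewrite exprMn expr2; nra.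
    by rewrite expr2; nra.
  + exact: (integral_cens_term_sqr X T_cdf F_cont (C_cdf 0) G_cont F_tau G_tau p0).
  + apply: eq_leR.
    have -> : rate n * Num.sqrt (p n k) * ((5 + g0^-1) * rate n / Num.sqrt (p n k))
      - (rate n * Num.sqrt (p n k)) ^+ 2 * (p n k * g0)^-1 = 5 * rate n ^+ 2.
      rewrite [(rate n * _) ^+ 2]exprMn sp2; field.
      by rewrite (gt_eqF sp0) (gt_eqF p0) (gt_eqF g00).
    by rewrite mulrCA rate_sqr.
move=> Z [mZ Z0 hZ]; exists Z; split => // w /= h; apply: hZ => /= h'; apply: h.
move: h' => [m _ h']; exists m.+2 => // n /= mn k /andP[k0 kn] pk.
have r0 : 0 < rate n :> R by apply: rate_gt0; exact: leq_ltn_trans mn.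
have p0 : 0 < p n k by rewrite /p; lra.
have := h' n (ltnW (ltnW mn)) k kn; rewrite k0 pk => /(_ isT).
rewrite (integral_cens_term X T_cdf F_cont (C_cdf 0) G_cont F_tau G_tau p0) opprK => /ltW.
rewrite /avg /cens_hazard /g /cens_term /=.
by under eq_bigr do rewrite mulrA.
Unshelve. all: by end_near. Qed.

(** Beyond control at the quantiles, [km_weights_deviation] assumes of the sample
    only that there is no tie and that T_i <= tau, which hold almost surely. *)
Lemma ae_km_weights : exists c : R, {ae P, forall w, \forall n \near \oo,
  n%:R^-1 * \sum_(i < n) (T_ i w <= C_ i w)%R%:R *
     `|(kaplan_meier n (obs ^~ w) (fun i => T_ i w <= C_ i w) (obs i w))^-1
        - (1 - G (T_ i w))^-1| <= c * rate n}.
Proof.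
have g00 := G_tau.
(* b is the constant of ae_cens_hazard; A and B are chosen to satisfy the side
   conditions of km_weights_deviation *)
pose b := 5 + g0^-1.
have gi0 : 0 < g0^-1 by rewrite invr_gt0.
pose A := 8 + 2 * b + 2 / g0.
pose c1 := 4 + A * (ln g0^-1 + 1).
have gl : 0 <= ln g0^-1.
  by rewrite ln_ge0// invf_ge1// gerBl; exact: cdf_ge0_real (C_cdf 0) _.
have b0 : 0 < b by rewrite /b; lra.
have A8 : 8 <= A by rewrite /A; lra.
have c10 : 4 <= c1 by rewrite /c1; nra.
pose B := 2 * A + 12 * c1.
have B0 : 0 < B by rewrite /B; lra.
exists (2 / g0 * (c1 + 4 * A) + 2 * B * (4 / g0) + g0^-1).
have s1 : \forall n \near \oo, rate n <= 4^-1 :> R by apply: rate_small.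
have s2 : \forall n \near \oo, rate n <= B / (36 * A ^+ 2).
  by apply: rate_small; rewrite divr_gt0// mulr_gt0// exprn_gt0//; lra.
apply: filterS3 obs_no_tie ae_le_tau (filterI ae_at_risk ae_cens_hazard) => w tie le_tau [h1 h2].
near=> n.
have r4 : rate n <= 4^-1 :> R by near: n.
have rB : rate n <= B / (36 * A ^+ 2) by near: n.
have n4 : (4 <= n)%N by near: n; exists 4%N.
have h1n : forall k, (0 < k < n)%N ->
  `|at_risk n (T_ ^~ w) (C_ ^~ w) (quantile n k) - sv (quantile n k)| <= 6 * rate n by near: n.
have h2n : forall k, (0 < k < n)%N ->
  9 * rate n <= sv (quantile n k) ->
  `|cens_hazard F G n (T_ ^~ w) (C_ ^~ w) (quantile n k) + ln (1 - G (quantile n k))|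
    <= (5 + g0^-1) * rate n / Num.sqrt (sv (quantile n k)) by near: n.
have n0 : (0 < n)%N by exact: leq_trans n4.
have r0 : 0 < rate n :> R by apply: rate_gt0; exact: leq_trans n4.
have nr : 1 <= n%:R * rate n ^+ 2 :> R by rewrite rate_sqr; exact: ln_ge1.
have th18 : 18 * rate n <= B * rate n by rewrite ler_pM2r// /B; lra.
apply: (@km_weights_deviation _ F G tau n (T_ ^~ w) (C_ ^~ w) F_mono G_mono _ _ _ _ F_tau G_tau n0
  (quantile n) (rate n) 6 b (B * rate n) _ h1n _ r0 nr r4 _ _ _ _ _ A B) => //.
- exact: cdf_ge0_real T_cdf.
- exact: cdf_le1_real T_cdf.
- exact: cdf_ge0_real (C_cdf 0).
- exact: cdf_le1_real (C_cdf 0).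
- by move=> k; exact: surv_quantileE.
- by move=> k kn hk; apply: h2n => //; lra.
- exact: ltW.
- lra.
- move=> i j _ _ e; apply/eqP/negPn/negP => ij; exact: (tie i j ij e).
- lra.
- by rewrite /A; lra.
- by rewrite /A; lra.
- by rewrite /B; lra.
- by rewrite -/c1 /B; lra.
- rewrite mulrC -ler_pdivlMr// mulr_gt0// exprn_gt0//; lra.
Unshelve. all: by end_near. Qed.

End censored_iid.

(** * Taylor bounds and affine substitution *)

Section real_functions.
Context {R : realType}.
Implicit Types (f g K : R -> R).

Lemma continuous_bounded_on f c : continuous f ->
  exists m, forall x, `|x| <= c -> `|f x| <= m.
Proof.
move=> cf; have [c0|c0] := ltP c 0.
  by exists 0 => x xc; have := normr_ge0 x; lra.
have cc : - c <= c by lra.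
have cn : continuous (fun x => `|f x|).
  by move=> x; apply: continuous_comp; [exact: cf|exact: norm_continuous].
have [|z _ hz] := @EVT_max R (fun x => `|f x|) (- c) c cc.
  exact: continuous_subspaceT.
exists `|f z| => x xc; apply: hz; rewrite in_itv/=.
by move: xc; rewrite ler_norml.
Qed.

Lemma mvt_bound f m a b : (forall x, derivable f x 1) ->
  (forall c, Num.min a b <= c <= Num.max a b -> `|derive1 f c| <= m) ->
  `|f b - f a| <= m * `|b - a|.
Proof.
move=> df; wlog ab : a b / a <= b.
  move=> H; have [ab|ba] := boolP (a <= b); first exact: H.
  rewrite minC maxC distrC [`|b - a|]distrC; apply: H.
  by rewrite leNgt; apply: contra ba => /ltW.
rewrite (min_l ab) (max_r ab) => hm.
have [||c cab e] := @MVT_segment R f (derive1 f) a b ab.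
- by move=> x _; rewrite derive1E; apply: DeriveDef.
- apply: continuous_subspaceT => x; apply: differentiable_continuous.
  exact/derivable1_diffP.
rewrite e normrM ler_wpM2r//; apply: hm.
by move: cab; rewrite in_itv.
Qed.

(** The mean value inequality applied to g minus its tangent, whose derivative
    is bounded by the same inequality applied to the derivative of g. *)
Lemma taylor_bound g m c x y : twice_cont_diff g ->
  (forall t, `|t| <= c -> `|derive1n 2 g t| <= m) ->
  `|x| <= c -> `|x + y| <= c ->
  `|g (x + y) - g x - y * derive1 g x| <= m * y ^+ 2.
Proof.
move=> [dg ddg cg] hm xc xyc.
have seg t : Num.min x (x + y) <= t <= Num.max x (x + y) -> `|t| <= c.
  move: xc xyc; rewrite !ler_norml => /andP[? ?] /andP[? ?].
  by rewrite ge_min le_max => /andP[/orP[h1|h1] /orP[h2|h2]]; apply/andP; split; lra.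
have near_x t : Num.min x (x + y) <= t <= Num.max x (x + y) -> `|t - x| <= `|y|.
  rewrite ge_min le_max => /andP[/orP[h1|h1] /orP[h2|h2]];
    have := ler_norm y; have := ler_norm (- y); rewrite normrN;
    have := normr_ge0 y; rewrite ler_norml => *; apply/andP; split; lra.
have d1 t : Num.min x (x + y) <= t <= Num.max x (x + y) ->
    `|derive1 g t - derive1 g x| <= m * `|y|.
  move=> ht; apply: (@le_trans _ _ (m * `|t - x|)).
    have := @mvt_bound (derive1 g) m x t ddg; apply => s hs.
    have -> : derive1 (derive1 g) s = derive1n 2 g s by [].
    apply: hm; apply: seg.
    move: hs ht; rewrite !ge_min !le_max => /andP[h1 h2] /andP[h3 h4].
    apply/andP; split.
      by case/orP: h1 => h1; [rewrite h1|case/orP: h3 => h3; rewrite (le_trans h3 h1) ?orbT].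
    by case/orP: h2 => h2; [rewrite h2|case/orP: h4 => h4; rewrite (le_trans h2 h4) ?orbT].
  apply: ler_wpM2l; last exact: near_x.
  exact: le_trans (hm x xc).
pose k := derive1 g x.
pose phi t := g t - k * t.
have dphi (t : R) : is_derive t (1 : R) phi (derive1 g t - k).
  apply: is_deriveB; first by rewrite derive1E; apply: DeriveDef.
  by apply: is_derive_eq; rewrite /= scaler1 ?mulr1.
have := @mvt_bound phi (m * `|y|) x (x + y).
have -> : phi (x + y) - phi x = g (x + y) - g x - y * derive1 g x.
  by rewrite /phi /k; ring.
have -> : x + y - x = y by ring.
rewrite -mulrA -expr2 real_normK ?num_real//; apply.
  by move=> t; apply: ex_derive.
by move=> t ht; rewrite derive1E derive_val; exact: d1.
Qed.

Definition zero_outside a f := forall x, a < `|x| -> f x = 0.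

Lemma integrable_zero_outside a b f : measurable_fun setT f ->
  (forall x, `|f x| <= b) -> zero_outside a f ->
  lebesgue_measure.-integrable setT (EFin \o f).
Proof.
move=> mf fb f0.
have -> : EFin \o f = (EFin \o f) \_ `[- a, a].
  apply/funext => x; rewrite patchE; case: ifPn => //.
  rewrite notin_setE/= in_itv/= => h; rewrite f0//.
  by rewrite ltNge; apply/negP; rewrite ler_norml.
have I := @integrable_mkcond _ _ R (@lebesgue_measure R) `[- a, a]%classic (EFin \o f)
  (measurable_itv `[- a, a]).
apply: I.1.
apply: measurable_bounded_integrable; first exact: measurable_itv.
- have h : (lebesgue_measure (`[(- a)%R, a]%classic : set R) < +oo)%E.
    by rewrite lebesgue_measure_itv/=; case: ifP; rewrite -?EFinB ltry.
  exact: h.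
- exact: measurable_funTS.
exists b; split; first exact: num_real.
by move=> x bx z _; exact: le_trans (fb z) (ltW bx).
Qed.

Lemma lebesgue_measure_affine (x h : R) (A : set R) : 0 < h -> measurable A ->
  (h%:E * lebesgue_measure ((fun v => (x - h * v)%R) @^-1` A))%E = lebesgue_measure A.
Proof.
move=> h0 mA.
pose phi : R -> measurableTypeR R := fun v => x - h * v.
have mphi : measurable_fun setT phi.
  by apply: measurable_funB => //; exact: measurable_funM.
have H := @lebesgue_measure_unique R (mscale (NngNum (ltW h0)) (pushforward lebesgue_measure phi)).
rewrite (H mphi _ A mA)// => _ [[a b] _ <-].
change (lebesgue_measure `]a, b]%classic = (h%:E * lebesgue_measure (phi @^-1` `]a, b]%classic))%E).
have -> : phi @^-1` `]a, b]%classic = `[(x - b) / h, (x - a) / h[%classic.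
  apply/seteqP; split => v /=; rewrite /phi !in_itv/=.
    move=> /andP[h1 h2]; rewrite ler_pdivrMr// ltr_pdivlMr//.
    by apply/andP; split; rewrite mulrC; lra.
  rewrite ler_pdivrMr// ltr_pdivlMr// => /andP[h1 h2].
  by apply/andP; split; move: h1 h2; rewrite mulrC; lra.
rewrite !lebesgue_measure_itv/= !lte_fin ltr_pM2r ?invr_gt0// ltrD2l ltrN2.
case: ifP => _; last by rewrite mule0.
rewrite -!EFinB -EFinM; congr EFin; field.
by rewrite gt_eqF.
Qed.

Lemma ge0_integral_affine (x h : R) (f : R -> R) : 0 < h ->
  measurable_fun setT f -> (forall u, 0 <= f u) ->
  (\int[lebesgue_measure]_u (f u)%:E =
   h%:E * \int[lebesgue_measure]_v (f (x - h * v)%R)%:E)%E.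
Proof.
move=> h0 mf f0.
pose phi : R -> measurableTypeR R := fun v => x - h * v.
have mphi : measurable_fun setT phi.
  by apply: measurable_funB => //; exact: measurable_funM.
transitivity (\int[lebesgue_measure]_v (h * f (phi v))%:E)%E.
  transitivity (\int[lebesgue_measure]_u (1 * f (id u))%:E)%E.
    by apply: eq_integral => u _; rewrite mul1r.
  apply: (@ge0_integral_transfer _ _ _ _ (measurableTypeR R) (measurableTypeR R) _
    lebesgue_measure lebesgue_measure id phi (cst 1) (cst h)) => //.
    by move=> ? /=; exact: ltW.
  move=> A mA; under eq_integral do rewrite mul1r.
  rewrite integral_indic// setIT.
  have mp : measurable (phi @^-1` A) by rewrite -[X in measurable X]setTI; exact: mphi.
  transitivity (\int[lebesgue_measure]_v (h%:E * (\1_(phi @^-1` A) v)%:E))%E; last by [].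
  rewrite ge0_integralZl//; last 2 first.
  - exact/measurable_EFinP/measurable_indic.
  - by rewrite lee_fin ltW.
  by rewrite integral_indic// setIT lebesgue_measure_affine.
under eq_integral do rewrite EFinM.
rewrite ge0_integralZl//.
- by apply/measurable_EFinP; exact: measurableT_comp.
- by move=> u _; rewrite lee_fin.
- by rewrite lee_fin ltW.
Qed.

End real_functions.

(** * The kernel *)

Section kernel.
Context {R : realType}.
Variable K : R -> R.
Hypotheses (K_C1 : cont_diff K) (K_supp : compact (closure [set t | K t != 0])).
Hypothesis K_ge0 : forall t, 0 <= K t.
Hypothesis K_int1 : (\int[lebesgue_measure]_t (K t)%:E = 1)%E.
Hypothesis K_mean0 : (\int[lebesgue_measure]_t (t * K t)%:E = 0)%E.

Lemma kernel_continuous : continuous K.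
Proof.
move=> x; apply: differentiable_continuous; apply/derivable1_diffP.
by have [dK _] := K_C1.
Qed.

Lemma kernel_zero_outside : exists2 a, 0 < a & zero_outside a K.
Proof.
have /compact_bounded [m [_ hm]] := K_supp.
exists (`|m| + 1); first by have := normr_ge0 m; lra.
move=> x hx; apply: contrapT => /eqP Kx.
have := hm (`|m| + 1) _ x.
rewrite (le_lt_trans (ler_norm m)) ?ltrDl// => /(_ isT).
have cx : closure [set t | K t != 0] x.
  by apply: (@subset_closure _ [set t | K t != 0] x); exact: Kx.
by move=> /(_ cx) /=; rewrite leNgt hx.
Qed.

Lemma kernel_bounded : exists2 b, 0 < b & forall t, K t <= b.
Proof.
have [a a0 ha] := kernel_zero_outside.
have [m hm] := continuous_bounded_on a kernel_continuous.
exists (`|m| + 1); first by have := normr_ge0 m; lra.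
move=> t; have := normr_ge0 m; have := ler_norm m.
have [ta|at_] := leP `|t| a; last by rewrite ha//; lra.
by have := hm _ ta; have := ler_norm (K t); lra.
Qed.

(** Near the support by the mean value inequality; a point farther away is
    at distance at least 1 from the support, and boundedness is enough. *)
Lemma kernel_lipschitz : exists2 L, 0 < L & forall x y, `|K x - K y| <= L * `|x - y|.
Proof.
have [a a0 ha] := kernel_zero_outside.
have [b b0 hb] := kernel_bounded.
have [dK cK'] := K_C1.
have [m hm] := continuous_bounded_on (a + 1) cK'.
have m0 : 0 <= m.
  by apply: (le_trans (normr_ge0 _) (hm 0 _)); rewrite normr0; lra.
exists (m + b) => [|x y]; first lra.
wlog xy : x y / `|y| <= `|x|.
  move=> H; have [h|/ltW h] := leP `|y| `|x|; first exact: H.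
  by rewrite distrC [`|x - y|]distrC; exact: H.
have n0 : 0 <= `|x - y| by [].
have [xa|xa] := leP `|x| (a + 1).
  apply: (@le_trans _ _ (m * `|x - y|)); last by rewrite ler_wpM2r//; lra.
  apply: mvt_bound => // c /andP[c1 c2]; apply: hm.
  have ya := le_trans xy xa.
  move: xa ya c1 c2; rewrite !ler_norml ge_min le_max.
  move=> /andP[? ?] /andP[? ?] /orP[?|?] /orP[?|?]; apply/andP; split; lra.
have Kx : K x = 0 by apply: ha; lra.
have [ya|ya] := leP `|y| a; last first.
  by rewrite Kx ha// subrr normr0 mulr_ge0//; lra.
have xy1 : 1 <= `|x - y|.
  by have := ler_normD (x - y) y; rewrite subrK => ?; lra.
rewrite Kx sub0r normrN ger0_norm//.
have := hb y; nra.
Qed.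

Local Notation la := (@lebesgue_measure R).

Lemma integrable_kernel_mul (phi : R -> R) : continuous phi ->
  la.-integrable setT (EFin \o (fun v => K v * phi v)).
Proof.
move=> cphi; have [a a0 ha] := kernel_zero_outside.
have [b b0 hb] := kernel_bounded.
have [m hm] := continuous_bounded_on a cphi.
apply: (@integrable_zero_outside _ a (b * `|m|)).
- apply: measurable_funM; apply: continuous_measurable_fun => //.
  exact: kernel_continuous.
- move=> x; rewrite normrM ger0_norm//.
  have [xa|ax] := leP `|x| a; last by rewrite ha// mul0r mulr_ge0// ltW.
  apply: ler_pM => //; apply: (le_trans (hm _ xa)); exact: ler_norm.
- by move=> x ax; rewrite ha// mul0r.
Qed.

(** The substitution u = x - h v produces the factor h and Taylor's formula for
    g (x - h v), in which the linear term has integral 0 since K is centred.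
    The constant depends on g only through its second derivative near
    [-c, c], which makes the bound uniform in x. *)
Lemma kernel_bias (g : R -> R) c : (forall x, 0 <= g x) -> twice_cont_diff g ->
  exists2 D, 0 <= D & forall x h, `|x| <= c -> 0 < h <= 1 ->
    `|\int[la]_u (K ((x - u) / h) * g u) - h * g x| <= D * h ^+ 3.
Proof.
move=> g0 gC2; have [a a0 ha] := kernel_zero_outside.
have [dg ddg cg2] := gC2.
have cg : continuous g.
  by move=> x; apply: differentiable_continuous; exact/derivable1_diffP.
have [m hm] := continuous_bounded_on (c + a) cg2.
exists (`|m| * a ^+ 2) => [|x h xc /andP[h0 h1]].
  by rewrite mulr_ge0// sqr_ge0.
have hm' t : `|t| <= c + a -> `|derive1n 2 g t| <= `|m|.
  by move=> /hm /le_trans; apply; exact: ler_norm.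
have caff : continuous (fun v => g (x - h * v)).
  move=> v; apply: (@continuous_comp _ _ _ (fun v => x - h * v) g); last exact: cg.
  apply: cvgB; first exact: cvg_cst.
  by apply: cvgM; [exact: cvg_cst|exact: cvg_id].
have caffK : continuous (fun u => K ((x - u) / h)).
  move=> u; apply: (@continuous_comp _ _ _ (fun u => (x - u) / h) K); last exact: kernel_continuous.
  apply: cvgM; last exact: cvg_cst.
  by apply: cvgB; [exact: cvg_cst|exact: cvg_id].
have subst : \int[la]_u (K ((x - u) / h) * g u) = h * \int[la]_v (K v * g (x - h * v)).
  rewrite /Rintegral (ge0_integral_affine x h0); last 2 first.
  - by apply: measurable_funM; exact: continuous_measurable_fun.
  - by move=> u; rewrite mulr_ge0.
  transitivity (fine h%:E * fine (\int[la]_v (K v * g (x - h * v)%R)%:E)%E); last by [].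
  rewrite -fineM//.
    congr (fine (_ * _)%E); apply: eq_integral => v _; congr (K _ * _)%:E.
    by field; rewrite gt_eqF.
  exact/integrable_fin_num/integrable_kernel_mul.
have K1 : \int[la]_v K v = 1 by rewrite /Rintegral K_int1.
have K0 : \int[la]_v (K v * v) = 0.
  rewrite /Rintegral; under eq_integral do rewrite mulrC.
  by rewrite K_mean0.
have i1 := integrable_kernel_mul caff.
have cstc (k : R) : continuous (fun _ : R => k) by move=> v; exact: cvg_cst.
have i2 : la.-integrable setT (EFin \o K).
  have := integrable_kernel_mul (cstc 1).
  by apply: eq_integrable => // v _ /=; rewrite mulr1.
have i3 : la.-integrable setT (EFin \o (fun v => K v * v)).
  by apply: integrable_kernel_mul => v; exact: cvg_id.
have i2' k : la.-integrable setT (EFin \o (fun v => k * K v)).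
  have := integrable_kernel_mul (cstc k).
  by apply: eq_integrable => // v _ /=; rewrite mulrC.
have i3' k : la.-integrable setT (EFin \o (fun v => k * (K v * v))).
  have := @integrable_kernel_mul (fun v => k * v).
  move=> /(_ _); have -> : (fun v => k * (K v * v)) = (fun v => K v * (k * v)).
    by apply/funext => v; ring.
  by apply => v; apply: cvgM; [exact: cvg_cst|exact: cvg_id].
(* adding the linear term costs nothing, by K0 *)
pose k1 := h * derive1 g x.
have dE : \int[la]_v (K v * g (x - h * v)) - g x =
   \int[la]_v (K v * g (x - h * v) - (g x * K v - k1 * (K v * v))).
  have i4 : la.-integrable setT (EFin \o (fun v => g x * K v - k1 * (K v * v))).
    by have := integrableB measurableT (i2' (g x)) (i3' k1); apply: eq_integrable.
  rewrite (RintegralB measurableT i1 i4) (RintegralB measurableT (i2' _) (i3' _)).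
  by rewrite !RintegralZl// K1 K0 mulr1 mulr0 subr0.
have pt v : `|K v * g (x - h * v) - (g x * K v - k1 * (K v * v))|
     <= `|m| * a ^+ 2 * h ^+ 2 * K v.
  have -> : K v * g (x - h * v) - (g x * K v - k1 * (K v * v)) =
      K v * (g (x + - (h * v)) - g x - - (h * v) * derive1 g x).
    by rewrite /k1; ring.
  rewrite normrM ger0_norm// mulrC; have [va|av] := leP `|v| a; last first.
    by rewrite ha// !mulr0.
  apply: ler_wpM2r => //.
  have hv : `|h * v| <= a.
    by rewrite normrM gtr0_norm// (le_trans _ va)// ler_piMl.
  have xc' : `|x| <= c + a by rewrite (le_trans xc)// lerDl ltW.
  have xhv : `|x + - (h * v)| <= c + a.
    by apply: (le_trans (ler_normD _ _)); rewrite normrN; exact: lerD.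
  apply: (le_trans (taylor_bound gC2 hm' xc' xhv)).
  rewrite -mulrA; apply: ler_wpM2l => //.
  rewrite sqrrN exprMn mulrC ler_wpM2r ?sqr_ge0//.
  by rewrite -[v ^+ 2]real_normK ?num_real// ler_sqr ?nnegrE// ltW.
have i5 : la.-integrable setT (EFin \o (fun v => K v * g (x - h * v) - (g x * K v - k1 * (K v * v)))).
  have i4 := integrableB measurableT (i2' (g x)) (i3' k1).
  by have := integrableB measurableT i1 i4; apply: eq_integrable.
set q := `|m| * a ^+ 2 * h ^+ 2 in pt.
have dev : `|\int[la]_v (K v * g (x - h * v)) - g x| <= q.
  rewrite dE; apply: (le_trans (le_normr_Rintegral measurableT i5)).
  apply: (@le_trans _ _ (\int[la]_v (q * K v))); last by rewrite RintegralZl// K1 mulr1.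
  by apply: le_Rintegral => //; exact: (integrable_norm i5).
rewrite subst -mulrBr normrM gtr0_norm//.
have -> : `|m| * a ^+ 2 * h ^+ 3 = h * q by rewrite /q; ring.
by rewrite ler_pM2l.
Qed.

End kernel.

(** * Inverse-probability-of-censoring weights *)

Section weighted_kernel.
Context {R : realType} {d : measure_display} {Omega : measurableType d}.
Variables (P : probability Omega R) (T X C : {RV P >-> R}) (F G : R -> R).
Hypotheses (T_cdf : forall t, cdf T t = (F t)%:E) (F_cont : continuous F).
Hypotheses (C_cdf : forall t, cdf C t = (G t)%:E) (G_cont : continuous G).
Variables (tau M : R).
Hypotheses (F_tau : F tau = 1) (G_tau : 0 < 1 - G tau) (M_pos : 0 < M).
Hypothesis T_pos : forall w, 0 < T w.
Hypothesis T_bound : forall l, (1 <= l <= 2)%N -> {ae P, forall w, T w ^- l <= M}.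
Variable f_TX : R * R -> R.
Hypothesis TX_density : has_density P (lebesgue_measure \x lebesgue_measure)%E
                  (fun w => (T w, X w)) f_TX.
Variable rb : nat -> R -> R.
Hypothesis rbE : forall l x, (1 <= l <= 2)%N -> (rb l x)%:E =
  (\int[lebesgue_measure]_(t in `]0%R, +oo[) (t ^- l * f_TX (t, x))%:E)%E.

Local Notation mu1 := (distribution P (pair_rv T X)).
Local Notation mu2 := (distribution P C).
Local Notation Q := (mu1 \x mu2)%E.
Local Notation S := ((R * R) * R)%type.
Local Notation g0 := (1 - G tau).
Local Notation la := (@lebesgue_measure R).

(** The values of T excluded here have probability zero; discarding them makes
    the weights below bounded everywhere and not just almost surely. *)
Definition regular (t : R) := [&& 0 < t, t <= tau, t^-1 <= M & t ^- 2 <= M].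

Definition ipcw (l : nat) (t : R) : R := (regular t)%:R * (t ^- l / (1 - G t)).

Lemma measurable_invX (l : nat) : measurable_fun setT (fun t : R => t ^- l).
Proof. by apply: measurable_funV; exact: measurable_funX. Qed.

Lemma measurable_regular : measurable [set t | regular t].
Proof.
have -> : [set t | regular t] = [set t | (0 < t)%R] `&` ([set t | (t <= tau)%R] `&`
   ([set t | (t^-1 <= M)%R] `&` [set t | (t ^- 2 <= M)%R])).
  by apply/seteqP; split => t /=; [move=> /and4P[]|move=> [? [? [? ?]]]; apply/and4P].
apply: measurableI; first exact: measurable_set_gt.
apply: measurableI; first exact: measurable_set_le.
apply: measurableI; apply: measurable_set_lef => //; first exact: measurable_invr.
exact: measurable_invX.
Qed.

Lemma measurable_ipcw l : measurable_fun setT (ipcw l).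
Proof.
apply: measurable_funM; first by apply: measurable_natb; exact: measurable_regular.
apply: measurable_funM; first exact: measurable_invX.
apply: measurable_funV; apply: measurable_funB => //; exact: continuous_measurable_fun.
Qed.

Lemma regular_bound l t : (1 <= l <= 2)%N -> regular t -> 0 <= t ^- l <= M.
Proof.
move=> /andP[l1 l2] /and4P[t0 _ h1 h2]; rewrite invr_ge0 exprn_ge0 ?(ltW t0)//=.
by case: l l1 l2 => // -[|[|l]]// _ _; rewrite ?expr1.
Qed.

Lemma regular_G t : regular t -> g0 <= 1 - G t.
Proof. by move=> /and4P[_ h _ _]; rewrite lerB//; exact: (cdf_mono C_cdf). Qed.

Lemma ipcw_bound l t : (1 <= l <= 2)%N -> 0 <= ipcw l t <= M / g0.
Proof.
move=> l12; rewrite /ipcw; have [rt|_] := boolP (regular t); last first.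
  by rewrite mul0r lexx divr_ge0 ?ltW.
have /andP[h1 h2] := regular_bound l12 rt; have h3 := regular_G rt.
have h4 : 0 < 1 - G t by exact: lt_le_trans h3.
rewrite mul1r divr_ge0 ?(ltW h4)//=.
by apply: ler_pM => //; rewrite ?invr_ge0 ?(ltW h4)// ?lef_pV2 ?posrE.
Qed.

Lemma ae_regular : {ae P, forall w, regular (T w)}.
Proof.
have h1 := @T_bound 1 isT; have h2 := @T_bound 2 isT.
have h3 : {ae P, forall w, ~ [set t | (tau < t)%R] (T w)}.
  apply: (ae_P0 (P := P) (E := T @^-1` [set t | (tau < t)%R])).
    by apply: measurable_funPTI; exact: measurable_set_gt.
  transitivity (distribution P T [set t | (tau < t)%R]); first by [].
  by rewrite (law_gt T_cdf) F_tau subrr.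
apply: filterS3 h1 h2 h3 => w h1 h2 h3; apply/and4P; split => //.
by rewrite leNgt; apply/negP.
Qed.

Variable K : R -> R.
Hypotheses (K_cont : continuous K) (K_ge0 : forall t, 0 <= K t).
Variable Kb : R.
Hypothesis K_le : forall t, K t <= Kb.

(** The summand of the estimator with ideal weights, as a function of the triple
    z = ((T, X), C). *)
Definition kernel_term (l : nat) (x h : R) (z : S) : R :=
  (z.1.1 <= z.2)%R%:R * (ipcw l z.1.1 * K ((x - z.1.2) / h)).

Let mK (x h : R) : measurable_fun setT (fun u : R => K ((x - u) / h)).
Proof.
apply: (@measurableT_comp _ _ _ _ _ _ K); first exact: continuous_measurable_fun.
by apply: measurable_funM => //; exact: measurable_funB.
Qed.

Let m_t : measurable_fun setT (fun z : S => z.1.1).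
Proof. exact: (measurableT_comp measurable_fst measurable_fst). Qed.

Let m_weight l x h : measurable_fun setT (fun z : R * R => ipcw l z.1 * K ((x - z.2) / h)).
Proof.
apply: measurable_funM; first exact: (measurableT_comp (measurable_ipcw l) measurable_fst).
exact: (measurableT_comp (mK x h) measurable_snd).
Qed.

Lemma measurable_kernel_term l x h : measurable_fun setT (kernel_term l x h).
Proof.
apply: measurable_funM; first by apply: measurable_natb; exact: measurable_set_lef.
exact: (measurableT_comp (m_weight l x h) measurable_fst).
Qed.

Lemma kernel_term_bound l x h z : (1 <= l <= 2)%N ->
  0 <= kernel_term l x h z <= M / g0 * Kb.
Proof.
move=> l12; have /andP[h1 h2] := ipcw_bound z.1.1 l12.
rewrite /kernel_term; have k0 := K_ge0 ((x - z.1.2) / h); have k1 := K_le ((x - z.1.2) / h).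
have lb := mulr_ge0 h1 k0.
have ub : ipcw l z.1.1 * K ((x - z.1.2) / h) <= M / g0 * Kb by exact: ler_pM.
case: (z.1.1 <= z.2); first by rewrite mul1r lb ub.
by rewrite mul0r lexx (le_trans lb ub).
Qed.

(** Given (T, X), the observation is uncensored with probability 1 - G T, which
    cancels the weight.  Integrating the density over t then turns T^-l into
    rb l. *)
Lemma integral_kernel_term l x h : (1 <= l <= 2)%N ->
  \int[Q]_z kernel_term l x h z = \int[la]_u (K ((x - u) / h) * rb l u).
Proof.
move=> l12.
have [mf f0 fE] := TX_density.
have w0 z : 0 <= ipcw l z.1 * K ((x - z.2) / h).
  by rewrite mulr_ge0//; have /andP[] := ipcw_bound z.1 l12.
rewrite /kernel_term (integral_uncensored T X C_cdf G_cont (m_weight l x h) w0).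
rewrite /Rintegral; congr fine.
pose ga (z : R * R) : R := (0 < z.1)%R%:R * z.1 ^- l * K ((x - z.2) / h).
have mga : measurable_fun setT ga.
  apply: measurable_funM; last exact: (measurableT_comp (mK x h) measurable_snd).
  apply: measurable_funM; first by apply: measurable_natb; exact: measurable_set_ltf.
  exact: (measurableT_comp (measurable_invX l) measurable_fst).
have ga0 z : 0 <= ga z.
  rewrite /ga mulr_ge0//; have [z0|_] := boolP (0 < z.1); last by rewrite mul0r.
  by rewrite mul1r invr_ge0 exprn_ge0// ltW.
have mG : measurable_fun setT (fun z : R * R => (1 - G z.1) * (ipcw l z.1 * K ((x - z.2) / h))).
  apply: measurable_funM => //; apply: measurable_funB => //.
  apply: (measurableT_comp _ measurable_fst); exact: continuous_measurable_fun.
have G1 t : 0 <= 1 - G t by rewrite subr_ge0; exact: (cdf_le1_real C_cdf).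
transitivity (\int[P]_w (ga (T w, X w))%:E)%E.
  rewrite ge0_integral_distribution; last 2 first.
  - exact/measurable_EFinP.
  - by move=> z; rewrite lee_fin mulr_ge0.
  apply: ge0_ae_eq_integral => //.
  - apply/measurable_EFinP; exact: (measurableT_comp mG (measurable_pair_rv T X)).
  - apply/measurable_EFinP; exact: (measurableT_comp mga (measurable_pair_rv T X)).
  - by move=> w _; rewrite lee_fin mulr_ge0.
  - by move=> w _; rewrite lee_fin.
  apply: filterS ae_regular => w rw _ /=; congr EFin.
  have h4 : 0 < 1 - G (T w) by apply: lt_le_trans (regular_G rw).
  rewrite /ga /ipcw /pair_rv /= rw T_pos !mul1r.
  by field; rewrite !gt_eqF// exprn_gt0.
transitivity (\int[P]_w (1 * ga (T w, X w))%:E)%E.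
  by apply: eq_integral => w _; rewrite mul1r.
rewrite (@ge0_integral_transfer _ _ _ _ _ _ _ P (la \x la)%E (pair_rv T X) id (cst 1) f_TX)//; last first.
  move=> A mA.
  transitivity (P (pair_rv T X @^-1` A)).
    under eq_integral do rewrite mul1r.
    have mp : measurable (pair_rv T X @^-1` A).
      by rewrite -[X in measurable X]setTI; exact: measurable_pair_rv.
    transitivity (\int[P]_w (\1_(pair_rv T X @^-1` A) w)%:E)%E; first by [].
    by rewrite integral_indic// setIT.
  rewrite fE// [LHS]integral_mkcond; congr (integral _ _ _); apply/funext => z.
  by rewrite patchE indicE; case: ifP => _; rewrite ?mulr1 ?mulr0.
pose fga z := (f_TX z * ga (id z))%:E.
transitivity (\int[la]_u fubini_G la fga u)%E.
  apply: (@fubini_tonelli2 _ _ (measurableTypeR R) (measurableTypeR R) R la la fga).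
    by apply/measurable_EFinP; exact: measurable_funM.
  by move=> z; rewrite lee_fin mulr_ge0.
apply: eq_integral => u _; rewrite /fubini_G /fga /=.
rewrite EFinM rbE// [X in (_ * X)%E]integral_mkcond.
have mfu : measurable_fun setT (fun t => f_TX (t, u)).
  exact: (measurableT_comp mf (pair2_measurable u)).
rewrite -ge0_integralZl//; last 3 first.
- apply/(measurable_restrictT _ _).1 => //.
  apply/measurable_EFinP; apply: measurable_funM; apply: measurable_funTS => //.
  exact: measurable_invX.
- move=> t _; rewrite patchE; case: ifPn => //; rewrite inE/= in_itv/= andbT => t0.
  by rewrite lee_fin mulr_ge0// invr_ge0 exprn_ge0// ltW.
- by rewrite lee_fin.
apply: eq_integral => t _; rewrite patchE /ga /=.
case: ifPn; rewrite ?notin_setE ?inE /= in_itv/= andbT.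
  by move=> ->; rewrite -EFinM mul1r; congr EFin; ring.
by move/negP/negbTE => ->; rewrite !mul0r mulr0 mule0.
Qed.

End weighted_kernel.

(** * Uniform deviations of kernel averages *)

Section uniform_deviation.
Context {R : realType} {d d' : measure_display}.
Context {Omega : measurableType d} {S : measurableType d'}.
Variables (P : probability Omega R) (Q : {measure set S -> \bar R}).
Variable W : nat -> Omega -> S.
Hypothesis mW : forall i, measurable_fun setT (W i).
Hypothesis Q1 : Q setT = 1%E.
Hypothesis W_prod : forall n (f : S -> R), measurable_fun setT f ->
  (forall z, 0 <= f z) -> (exists b, forall z, f z <= b) ->
  (\int[P]_w (\prod_(i < n) f (W i w))%:E = ((\int[Q]_z f z)%R ^+ n)%:E)%E.

Variables (kt : R -> R -> S -> R) (b Lb c0 : R) (h : nat -> R).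
Hypotheses (b_gt0 : 0 < b) (Lb_gt0 : 0 < Lb) (c0_gt0 : 0 < c0).
Hypothesis mkt : forall x e, measurable_fun setT (kt x e).
Hypothesis kt_bound : forall x e z, 0 <= kt x e z <= b.
Hypothesis kt_lip : forall x y e z, 0 < e ->
  `|kt x e z - kt y e z| <= Lb * `|x - y| / e.
Hypothesis h_pos : forall n, (0 < n)%N -> 0 < h n.
Hypothesis nh_toy : n%:R * h n @[n --> \oo] --> +oo.
Hypothesis log_to0 : ln n%:R / (n%:R * h n) @[n --> \oo] --> 0.

Let kt_norm x e z : `|kt x e z| <= b.
Proof. by have /andP[h1 h2] := kt_bound x e z; rewrite ger0_norm. Qed.

Let ikt x e : Q.-integrable setT (EFin \o kt x e).
Proof. exact: (bounded_Qintegrable Q1 (mkt x e) (@kt_norm x e)). Qed.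

Let mean x e := \int[Q]_z kt x e z.

Let mean_lip x y e : 0 < e -> `|mean x e - mean y e| <= Lb * `|x - y| / e.
Proof.
move=> e0; rewrite /mean -RintegralB//; try exact: ikt.
set q := Lb * `|x - y| / e.
have id : Q.-integrable setT (EFin \o (fun z => kt x e z - kt y e z)).
  by have := integrableB measurableT (ikt x e) (ikt y e); apply: eq_integrable.
apply: (le_trans (le_normr_Rintegral measurableT id)).
apply: (@le_trans _ _ (\int[Q]_z (q : R))); last by rewrite Rintegral_cst// Q1 mulr1.
apply: le_Rintegral => //; first exact: (integrable_norm id).
  exact: (bounded_Qintegrable Q1 (b := `|q|)).
by move=> z _; exact: kt_lip.
Qed.

Let avg_lip n x y e w : (0 < n)%N -> 0 < e ->
  `|avg W n (kt x e) w - avg W n (kt y e) w| <= Lb * `|x - y| / e.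
Proof.
move=> n0 e0; have n0' : 0 < n%:R :> R by rewrite ltr0n.
rewrite /avg -mulrBr -sumrB normrM gtr0_norm ?invr_gt0// ler_pdivrMl//.
apply: (le_trans (ler_norm_sum _ _ _)).
apply: (@le_trans _ _ (\sum_(i < n) (Lb * `|x - y| / e))).
  by apply: ler_sum => i _; exact: kt_lip.
by rewrite sumr_const card_ord mulr_natl.
Qed.

(** Equidistant points starting at - c0; consecutive ones are 2 c0 / n^3 apart,
    close enough for any bandwidth with n h >= 1. *)
Definition mesh (n k : nat) : R := - c0 + k%:R * (2 * c0 / n%:R ^+ 3).

Let mesh_near n x : (0 < n)%N -> `|x| <= c0 ->
  exists2 k, (k < 2 * n ^ 3)%N & `|x - mesh n k| <= 2 * c0 / n%:R ^+ 3.
Proof.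
have cc0 := c0_gt0.
move=> n0; rewrite ler_norml => /andP[x1 x2].
have n0' : 0 < n%:R ^+ 3 :> R by rewrite exprn_gt0// ltr0n.
set u := 2 * c0 / n%:R ^+ 3.
have u0 : 0 < u by rewrite divr_gt0// mulr_gt0.
have q0 : 0 <= (x + c0) / u by rewrite divr_ge0 ?(ltW u0)//; lra.
have /andP[t1 t2] := truncn_itv q0.
exists (Num.truncn ((x + c0) / u)).
  have : (Num.truncn ((x + c0) / u))%:R <= (n ^ 3)%:R :> R.
    apply: (le_trans t1); rewrite ler_pdivrMr// /u natrX.
    by rewrite mulrC divfK ?gt_eqF//; lra.
  rewrite ler_nat => /leq_ltn_trans; apply.
  by rewrite mul2n -addnn -[X in (X < _)%N]addn0 ltn_add2l expn_gt0 n0.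
move: t1 t2; move: (Num.truncn _) => m.
rewrite ler_pdivlMr// ltr_pdivrMr// -[m.+1%:R]natr1 mulrDl mul1r => t1 t2.
by rewrite /mesh -/u ler_norml; apply/andP; split; lra.
Qed.

Let mesh_le n k : (0 < n)%N -> (k < 2 * n ^ 3)%N -> `|mesh n k| <= 3 * c0.
Proof.
have cc0 := c0_gt0.
move=> n0 kn; have n0' : 0 < n%:R ^+ 3 :> R by rewrite exprn_gt0// ltr0n.
have k1 : k%:R * (2 * c0 / n%:R ^+ 3) <= 4 * c0.
  rewrite mulrA ler_pdivrMr//.
  have : k%:R <= 2 * n%:R ^+ 3 :> R by rewrite -natrX -natrM ler_nat ltnW.
  by move=> h1; rewrite [4 * c0 * _](_ : _ = (2 * n%:R ^+ 3) * (2 * c0)); [rewrite ler_pM2r//; lra|ring].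
have k0 : 0 <= k%:R * (2 * c0 / n%:R ^+ 3).
  by rewrite mulr_ge0// divr_ge0 ?(ltW n0')// mulr_ge0// ltW.
by rewrite /mesh ler_norml; apply/andP; split; lra.
Qed.

Let from_mesh n w s e : (0 < n)%N -> 0 < e ->
  (forall k, (k < 2 * n ^ 3)%N ->
    `|avg W n (kt (mesh n k) e) w - mean (mesh n k) e| < s) ->
  forall x, `|x| <= c0 ->
    `|avg W n (kt x e) w - mean x e| <= s + 4 * Lb * c0 / (n%:R ^+ 3 * e).
Proof.
move=> n0 e0 hs x xc; have [k kn hk] := mesh_near n0 xc.
have n0' : 0 < n%:R ^+ 3 :> R by rewrite exprn_gt0// ltr0n.
have h1 := avg_lip x (mesh n k) w n0 e0.
have h2 := mean_lip x (mesh n k) e0.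
have h3 := hs k kn.
have h4 : Lb * `|x - mesh n k| / e <= 2 * Lb * c0 / (n%:R ^+ 3 * e).
  rewrite ler_pdivrMr//.
  have -> : 2 * Lb * c0 / (n%:R ^+ 3 * e) * e = Lb * (2 * c0 / n%:R ^+ 3).
    by field; rewrite !gt_eqF// ltr0n.
  by rewrite ler_pM2l.
have -> : 4 * Lb * c0 / (n%:R ^+ 3 * e) = 2 * (2 * Lb * c0 / (n%:R ^+ 3 * e)).
  by ring.
have -> : avg W n (kt x e) w - mean x e =
  (avg W n (kt x e) w - avg W n (kt (mesh n k) e) w)
  + (avg W n (kt (mesh n k) e) w - mean (mesh n k) e)
  + - (mean x e - mean (mesh n k) e) by ring.
apply: (le_trans (ler_normD _ _)); rewrite normrN.
apply: (le_trans (lerD (ler_normD _ _) (lexx _))).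
by lra.
Qed.

Let nh_ge c : \forall n \near \oo, c <= n%:R * h n.
Proof. by move/cvgryPge : nh_toy; apply. Qed.

Let inv_rate n : (4 <= n)%N -> rate n <= 1 :> R -> (n%:R ^+ 2)^-1 <= rate n :> R.
Proof.
move=> n4 r1; have n0 : (0 < n)%N by exact: leq_trans n4.
have n0' : 0 < n%:R :> R by rewrite ltr0n.
have n1 : 1 <= n%:R :> R by rewrite ler1n.
have r0 : 0 < rate n :> R by apply: rate_gt0; exact: leq_trans n4.
have h1 : 1 <= n%:R * rate n ^+ 2 :> R by rewrite rate_sqr; exact: ln_ge1.
rewrite -div1r ler_pdivrMr ?exprn_gt0//; apply: (le_trans h1).
rewrite expr2 mulrA [leRHS]mulrC; apply: ler_pM => //.
- by rewrite mulr_ge0// ltW.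
- exact: ltW.
rewrite expr2; apply: ler_wpM2l; first exact: ltW.
by rewrite (le_trans r1).
Qed.

(** The variance is bounded by b^2 and not by a multiple of h; this loses a
    factor sqrt h, which the rate q / h to be proved allows.  Between mesh
    points the Lipschitz bound contributes O (1 / (n^3 h)) = O (1 / n^2). *)
Lemma uniform_deviation : exists c : R, {ae P, forall w, \forall n \near \oo,
  forall x, `|x| <= c0 -> `|avg W n (kt x (h n)) w - \int[Q]_z kt x (h n) z| <= c * rate n}.
Proof.
have [b0 L0 cc0] := And3 b_gt0 Lb_gt0 c0_gt0.
exists (5 + b ^+ 2 + 4 * Lb * c0).
have := @ae_deviations _ _ _ _ _ P Q W mW Q1 W_prod 2 (fun n => 2 * n ^ 3)%N
  (fun n k => kt (mesh n k) (h n)) (fun _ _ => true)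
  (fun n _ => rate n) (fun _ _ => b ^+ 2) (fun n _ => (5 + b ^+ 2) * rate n).
case.
- by move=> n k; exact: mkt.
- by move=> n; rewrite natrM natrX.
- have s1 : \forall n \near \oo, rate n <= b^-1 / 3 :> R.
    by apply: rate_small; rewrite divr_gt0// invr_gt0.
  near=> n => k _ _.
  have n2 : (1 < n)%N by near: n; exists 2%N.
  have r1 : rate n <= b^-1 / 3 :> R by near: n.
  split.
  + exact: rate_gt0.
  + move=> z; apply: (@le_trans _ _ (b^-1 / 3 * b)).
      by apply: ler_pM => //; exact/ltW/rate_gt0.
    by rewrite mulrAC mulVf ?gt_eqF// mul1r.
  + apply: (@le_trans _ _ (\int[Q]_z (b ^+ 2))); last first.
      by rewrite Rintegral_cst// Q1 mulr1.
    apply: le_Rintegral => //.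
    * apply: (bounded_Qintegrable Q1 (b := b ^+ 2)); first exact: measurable_funX.
      by move=> z; rewrite normrX ler_sqr ?nnegrE// ltW.
    * by apply: (bounded_Qintegrable Q1 (b := `|b ^+ 2|)).
    * move=> z _; have /andP[h1 h2] := kt_bound (mesh n k) (h n) z.
      by rewrite ler_sqr ?nnegrE// ltW.
  + apply: eq_leR.
    have -> : rate n * ((5 + b ^+ 2) * rate n) - rate n ^+ 2 * b ^+ 2 = 5 * rate n ^+ 2 by ring.
    by rewrite mulrCA rate_sqr.
move=> Z [mZ Z0 hZ]; exists Z; split => // w /= hn; apply: hZ => /= h'; apply: hn.
have s1 : \forall n \near \oo, rate n <= 1 :> R by exact: rate_small.
have s2 := nh_ge 1.
near=> n => x xc.
have r1 : rate n <= 1 :> R by near: n.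
have n4 : (4 <= n)%N by near: n; exists 4%N.
have nh1 : 1 <= n%:R * h n by near: n.
have dev : forall k, (k < 2 * n ^ 3)%N -> true ->
  `|avg W n (kt (mesh n k) (h n)) w - \int[Q]_z kt (mesh n k) (h n) z| < (5 + b ^+ 2) * rate n.
  by near: n.
have n0 : (0 < n)%N by exact: leq_trans n4.
have n0' : 0 < n%:R :> R by rewrite ltr0n.
apply: (le_trans (from_mesh n0 (h_pos n0) (fun k kn => dev k kn isT) xc)).
rewrite [leRHS]mulrDl lerD2l; apply: ler_wpM2l; first by rewrite !mulr_ge0// ltW.
apply: le_trans (inv_rate n4 r1).
rewrite lef_pV2 ?posrE ?mulr_gt0 ?exprn_gt0 ?h_pos//.
have -> : n%:R ^+ 3 * h n = n%:R ^+ 2 * (n%:R * h n) by ring.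
by rewrite -[leLHS]mulr1 ler_wpM2l// exprn_ge0// ltW.
Unshelve. all: by end_near. Qed.

(** Here the variance enters: it is at most b times the mean, hence O (h), so
    that with a constant l the exponent is of order n h, which dominates ln n.
    The mean has to be controlled on [-3 c0, 3 c0], which contains the mesh. *)
Lemma uniform_lower (c2 eta : R) : 0 < c2 -> 0 < eta ->
  (\forall n \near \oo, forall x, `|x| <= 3 * c0 -> \int[Q]_z kt x (h n) z <= c2 * h n) ->
  {ae P, forall w, \forall n \near \oo, forall x, `|x| <= c0 ->
    \int[Q]_z kt x (h n) z - eta * h n <= avg W n (kt x (h n)) w}.
Proof.
move=> c20 eta0 hmean.
have [b0 L0 cc0] := And3 b_gt0 Lb_gt0 c0_gt0.
pose l := Num.min (b^-1 / 3) (eta / 2 / (2 * (b * c2))).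
have bc0 : 0 < b * c2 by exact: mulr_gt0.
have l0 : 0 < l.
  by rewrite lt_min !divr_gt0 ?invr_gt0 ?mulr_gt0.
have l1 : l <= b^-1 / 3 by rewrite ge_min lexx.
have l2 : l * (2 * (b * c2)) <= eta / 2.
  by rewrite -ler_pdivlMr ?mulr_gt0// ge_min lexx orbT.
have := @ae_deviations _ _ _ _ _ P Q W mW Q1 W_prod 2 (fun n => 2 * n ^ 3)%N
  (fun n k => kt (mesh n k) (h n)) (fun _ _ => true)
  (fun _ _ => l) (fun n _ => b * (c2 * h n)) (fun n _ => eta / 2 * h n).
case.
- by move=> n k; exact: mkt.
- by move=> n; rewrite natrM natrX.
- have s2 : \forall n \near \oo, ln n%:R / (n%:R * h n) < l * (eta / 4) / 5.
    move/cvgr_lt : log_to0; apply.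
    by rewrite divr_gt0// mulr_gt0// divr_gt0.
  near=> n => k kn _.
  have n2 : (1 < n)%N by near: n; exists 2%N.
  have n0 : (0 < n)%N by exact: ltn_trans n2.
  have n0' : 0 < n%:R :> R by rewrite ltr0n.
  have h0 := h_pos n0.
  have lnn : ln n%:R / (n%:R * h n) < l * (eta / 4) / 5 by near: n.
  have hm : forall x, `|x| <= 3 * c0 -> \int[Q]_z kt x (h n) z <= c2 * h n by near: n.
  split => //.
  + move=> z; apply: (@le_trans _ _ (b^-1 / 3 * b)).
      by apply: ler_pM => //; exact: ltW.
    by rewrite mulrAC mulVf ?gt_eqF// mul1r.
  + apply: (@le_trans _ _ (\int[Q]_z (b * kt (mesh n k) (h n) z))); last first.
      rewrite RintegralZl//; try exact: ikt.
      by rewrite ler_pM2l//; apply/hm/mesh_le.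
    apply: le_Rintegral => //.
    * apply: (bounded_Qintegrable Q1 (b := b ^+ 2)); first exact: measurable_funX.
      by move=> z; rewrite normrX ler_sqr ?nnegrE// ltW.
    * apply: (bounded_Qintegrable Q1 (b := b * b)); first exact: measurable_funM.
      by move=> z; rewrite normrM gtr0_norm// ler_pM2l.
    * move=> z _; have /andP[h1 h2] := kt_bound (mesh n k) (h n) z.
      by rewrite expr2 ler_wpM2r.
  + have e1 : l * (eta / 2 * h n) - l ^+ 2 * (b * (c2 * h n)) =
      h n * l * (eta / 2 - l * (2 * (b * c2)) / 2) by field.
    rewrite e1.
    have e2 : eta / 4 <= eta / 2 - l * (2 * (b * c2)) / 2 by lra.
    move: lnn; rewrite ltr_pdivrMr ?mulr_gt0// => lnn.
    have e3 : n%:R * (h n * l * (eta / 4)) <= n%:R * (h n * l * (eta / 2 - l * (2 * (b * c2)) / 2)).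
      by rewrite ler_pM2l// ler_pM2l// mulr_gt0.
    apply: le_trans e3.
    have -> : n%:R * (h n * l * (eta / 4)) = 5 * (l * (eta / 4) / 5 * (n%:R * h n)) by field.
    by rewrite ler_pM2l// ltW.
move=> Z [mZ Z0 hZ]; exists Z; split => // w /= hn; apply: hZ => /= h'; apply: hn.
have s2 := nh_ge 1.
have s3 : \forall n \near \oo, 4 * Lb * c0 / (eta / 2) <= n%:R :> R.
  exists (Num.truncn (4 * Lb * c0 / (eta / 2))).+1 => // m /= hm.
  by apply/ltW/(lt_le_trans (truncnS_gt _)); rewrite ler_nat.
near=> n => x xc.
have n1 : (1 <= n)%N by near: n; exists 1%N.
have nh1 : 1 <= n%:R * h n by near: n.
have nb : 4 * Lb * c0 / (eta / 2) <= n%:R by near: n.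
have dev : forall k, (k < 2 * n ^ 3)%N -> true ->
  `|avg W n (kt (mesh n k) (h n)) w - \int[Q]_z kt (mesh n k) (h n) z| < eta / 2 * h n.
  by near: n.
have h0 := h_pos n1.
have n0' : 0 < n%:R :> R by rewrite ltr0n.
have := from_mesh n1 h0 (fun k kn => dev k kn isT) xc.
have small : 4 * Lb * c0 / (n%:R ^+ 3 * h n) <= eta / 2 * h n.
  rewrite ler_pdivrMr ?mulr_gt0 ?exprn_gt0//.
  move: nb; rewrite ler_pdivrMr; last by rewrite divr_gt0.
  move=> nb; apply: (le_trans nb).
  have -> : eta / 2 * h n * (n%:R ^+ 3 * h n) = n%:R * (eta / 2) * (n%:R * h n) ^+ 2 by ring.
  by rewrite -[leLHS]mulr1 ler_pM2l ?mulr_gt0 ?divr_gt0// exprn_ege1.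
rewrite /mean ler_norml => /andP[h1 _].
move: h1 small; set A := avg _ _ _ _; set I := \int[Q]_z _.
by move: (4 * Lb * c0 / (n%:R ^+ 3 * h n)) => y; lra.
Unshelve. all: by end_near. Qed.

End uniform_deviation.

(** * Bounds on the estimator for a fixed sample *)

Section asymptotic_order.
Context {R : realType} {d : measure_display} {Omega : measurableType d}.
Variable P : probability Omega R.

Lemma sup_abs_le (C : set R) (g : R -> R) (B : R) : 0 <= B ->
  (forall x, C x -> `|g x| <= B) -> (sup_abs C g <= B%:E)%E.
Proof.
move=> B0 h; rewrite /sup_abs ge_max lee_fin B0/=.
by apply: ge_ereal_sup => _ [x Cx <-]; rewrite lee_fin; exact: h.
Qed.

Lemma sup_abs_ge0 (C : set R) (g : R -> R) : (0 <= sup_abs C g)%E.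
Proof. by rewrite /sup_abs le_max lexx. Qed.

Lemma Oas_of_bound (Z : nat -> Omega -> \bar R) (a : nat -> R) (c : R) :
  (\forall n \near \oo, 0 < a n) -> (forall n w, (0 <= Z n w)%E) ->
  {ae P, forall w, \forall n \near \oo, (Z n w <= (c * a n)%:E)%E} -> Oas P Z a.
Proof.
move=> a0 Z0; apply: filterS => w hw.
have [N _ hN] : \forall n \near \oo, (`|Z n w| * ((a n)^-1)%:E <= c%:E)%E.
  near=> n; have an : 0 < a n by near: n.
  rewrite gee0_abs//; have h : (Z n w <= (c * a n)%:E)%E by near: n.
  have -> : c%:E = ((c * a n)%:E * ((a n)^-1)%:E)%E.
    by rewrite -EFinM mulfK// gt_eqF.
  by apply: lee_wpmul2r => //; rewrite lee_fin invr_ge0 ltW.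
apply: (@le_lt_trans _ _ c%:E); last by rewrite ltry.
rewrite limn_esup_lim; apply: lime_le; first exact: is_cvg_esups.
exists N => // n /= Nn; apply: ge_ereal_sup => _ [k /= nk <-].
by apply: hN; exact: leq_trans nk.
Unshelve. all: by end_near. Qed.

End asymptotic_order.

Section endpoint.
Context {R : realType} {d : measure_display} {Omega : measurableType d}.
Variables (P : probability Omega R) (T : {RV P >-> R}) (F : R -> R).
Hypotheses (T_cdf : forall t, cdf T t = (F t)%:E) (F_cont : continuous F).
Hypothesis tauF_fin : (upper_endpoint F < +oo)%E.

(** F is 1 to the right of its endpoint, hence at the endpoint by continuity. *)
Lemma cdf_upper_endpoint : F (fine (upper_endpoint F)) = 1.
Proof.
have [a Fa] := cdf_small T_cdf ltr01.
have fin : upper_endpoint F \is a fin_num.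
  rewrite fin_numElt tauF_fin andbT; apply: (@lt_le_trans _ _ a%:E); first exact: ltNyr.
  by apply: ereal_sup_ubound; exists a.
set tau := fine _.
have above t : tau < t -> 1 <= F t.
  rewrite leNgt => taut; apply/negP => Ft.
  have : (t%:E <= upper_endpoint F)%E by apply: ereal_sup_ubound; exists t.
  by rewrite -(fineK fin) lee_fin -/tau leNgt taut.
apply/eqP; rewrite eq_le (cdf_le1_real T_cdf)/= leNgt; apply/negP => Ft.
have h : \forall t \near tau^'+, F t < 1.
  have : F x @[x --> tau^'+] --> F tau by apply: cvg_at_right_filter; exact: F_cont.
  by move=> /cvgr_lt; apply.
have h' : \forall t \near tau^'+, tau < t by exact: nbhs_right_gt.
have [t [t1 t2]] : exists t, F t < 1 /\ tau < t.
  by apply: (@filter_ex _ (tau^'+)); near=> t; split; near: t.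
by have := above t t2; rewrite leNgt t1.
Unshelve. all: by end_near. Qed.

End endpoint.

Section estimator_bounds.
Context {R : realType}.
Variables (G K : R -> R) (tau M Kb : R) (n : nat) (tt cc xs : nat -> R) (h x : R).
Hypotheses (G_mono : {homo G : x y / x <= y}) (G_ge0 : forall t, 0 <= G t).
Hypotheses (G_tau : 0 < 1 - G tau).
Hypotheses (K_ge0 : forall t, 0 <= K t) (K_le : forall t, K t <= Kb) (M_pos : 0 < M).
Hypotheses (n_gt0 : (0 < n)%N) (h_gt0 : 0 < h).
Hypothesis tt_reg : forall i, regular tau M (tt i).
Local Notation g0 := (1 - G tau).

Let yy i := Num.min (tt i) (cc i).
Let dl i := tt i <= cc i.
Let kk i := K ((x - xs i) / h).
Let km i := kaplan_meier n yy dl (yy i).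

(** The estimator, up to the factor h, with Kaplan-Meier values replaced by
    those of 1 - G. *)
Definition ipcw_mean l : R :=
  n%:R^-1 * \sum_(i < n) (dl i)%:R * (ipcw G tau M l (tt i) * kk i).

Let bar_rnE l : h * bar_rn K n h xs yy dl l x =
  n%:R^-1 * \sum_(i < n) (dl i)%:R * tt i ^- l * kk i / km i.
Proof.
have n0 : n%:R != 0 :> R by rewrite pnatr_eq0 -lt0n.
rewrite /bar_rn.
have e s : h * ((n%:R * h)^-1 * s) = n%:R^-1 * s by field; rewrite n0 gt_eqF.
rewrite e; congr (_ * _).
apply: eq_bigr => i _; rewrite -/(km i) -/(kk i).
rewrite /dl /yy; case: leP => [h1|_]; last by rewrite !mul0r.
by rewrite mulrAC.
Qed.

Let reg_pow l i : (1 <= l <= 2)%N -> 0 <= tt i ^- l <= M.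
Proof. by move=> l12; exact: regular_bound (tt_reg i). Qed.

Let ipcwE l i : ipcw G tau M l (tt i) = tt i ^- l / (1 - G (tt i)).
Proof. by rewrite /ipcw tt_reg mul1r. Qed.

Lemma bar_rn_ipcw l : (1 <= l <= 2)%N ->
  `|h * bar_rn K n h xs yy dl l x - ipcw_mean l| <= M * Kb *
    (n%:R^-1 * \sum_(i < n) (dl i)%:R * `|(km i)^-1 - (1 - G (tt i))^-1|).
Proof.
move=> l12; rewrite bar_rnE /ipcw_mean -mulrBr -sumrB.
have n0 : 0 < n%:R :> R by rewrite ltr0n.
rewrite normrM gtr0_norm ?invr_gt0// mulrCA ler_pM2l ?invr_gt0//.
apply: (le_trans (ler_norm_sum _ _ _)); rewrite mulr_sumr.
apply: ler_sum => i _; rewrite ipcwE.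
have -> : (dl i)%:R * tt i ^- l * kk i / km i - (dl i)%:R * (tt i ^- l / (1 - G (tt i)) * kk i)
  = (tt i ^- l * kk i) * ((dl i)%:R * ((km i)^-1 - (1 - G (tt i))^-1)) by ring.
have /andP[t0 t1] := reg_pow i l12.
rewrite normrM [`|(dl i)%:R * _|]normrM [`|(dl i)%:R|]normr_nat.
apply: ler_wpM2r; first by rewrite mulr_ge0.
rewrite ger0_norm; last by rewrite mulr_ge0 ?K_ge0.
by apply: ler_pM => //; [exact: K_ge0|exact: K_le].
Qed.

Hypothesis yy_inj : forall i j, (i < n)%N -> (j < n)%N -> yy i = yy j -> i = j.

(** Kaplan-Meier values lie in ]0, 1], except that the largest observation gets
    0; its term vanishes on the right and costs at most b. *)
Lemma km_inverse_sum (u : nat -> R) b : (forall i, 0 <= u i <= b) ->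
  \sum_(i < n) u i - b <= \sum_(i < n) u i / km i.
Proof.
move=> ub; rewrite (sum_rank_idx n yy) (sum_rank_idx n yy (fun i => u i / km i)).
have n1 : n = n.-1.+1 by rewrite prednK.
rewrite [X in index_iota 0 X]n1 [X in _ <= X]big_nat_recr//= [X in X - _]big_nat_recr//=.
have /andP[u0 u1] := ub (rank_idx n yy n.-1).
have last0 : km (rank_idx n yy n.-1) = 0.
  by rewrite /km kaplan_meier_rank ?ltnn// prednK.
rewrite last0 invr0 mulr0 addr0.
have : \sum_(0 <= i < n.-1) u (rank_idx n yy i) <=
   \sum_(0 <= i < n.-1) u (rank_idx n yy i) / km (rank_idx n yy i).
  apply: ler_sum_nat => k /andP[_ kn1].
  have kn : (k < n)%N by rewrite (leq_trans kn1)// leq_pred.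
  have k1n : (k.+1 < n)%N by rewrite -ltn_predRL.
  rewrite /km kaplan_meier_rank// kn1.
  have /andP[v0 _] := ub (rank_idx n yy k).
  rewrite ler_pdivlMr ?km_prod_gt0// ler_piMr// km_prod_le1//.
by lra.
Qed.

(** Kaplan-Meier weights are at least 1, and the ideal ones at most g0^-1. *)
Lemma bar_rn_lower l : (1 <= l <= 2)%N ->
  g0 * ipcw_mean l - M * Kb / n%:R <= h * bar_rn K n h xs yy dl l x.
Proof.
move=> l12; have n0 : 0 < n%:R :> R by rewrite ltr0n.
have gt0 := G_tau.
pose u i := (dl i)%:R * tt i ^- l * kk i.
have ub i : 0 <= u i <= M * Kb.
  have /andP[t0 t1] := reg_pow i l12.
  have v0 : 0 <= tt i ^- l * kk i by rewrite mulr_ge0 ?K_ge0.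
  have v1 : tt i ^- l * kk i <= M * Kb.
    by apply: ler_pM => //; [exact: K_ge0|exact: K_le].
  rewrite /u; case: (dl i); first by rewrite mul1r v0 v1.
  by rewrite !mul0r lexx (le_trans v0 v1).
rewrite bar_rnE mulrC -[X in X - _]mulrC.
have := km_inverse_sum ub.
rewrite -(ler_pM2l (_ : 0 < n%:R^-1)) ?invr_gt0// mulrBr.
apply: le_trans; rewrite [M * Kb / _]mulrC lerD2r.
rewrite /ipcw_mean mulrCA ler_pM2l ?invr_gt0// mulr_sumr.
apply: ler_sum => i _; rewrite ipcwE /u.
have gi : g0 <= 1 - G (tt i).
  by have /and4P[_ h1 _ _] := tt_reg i; rewrite lerB// G_mono.
have gi0 : 0 < 1 - G (tt i) by exact: lt_le_trans gi.
have /andP[t0 t1] := reg_pow i l12.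
have -> : g0 * ((dl i)%:R * (tt i ^- l / (1 - G (tt i)) * kk i)) =
  (dl i)%:R * tt i ^- l * kk i * (g0 / (1 - G (tt i))) by ring.
rewrite ler_piMr// ?ler_pdivrMr ?mul1r//.
by have /andP[] := ub i.
Qed.

End estimator_bounds.

Section ratios.
Context {R : realType}.

(** Of a mean above h Gam, a quarter goes to the bias, a quarter to the deviation
    and a quarter to the largest observation. *)
Lemma lower_bound_budget (N h g0 Gam D B u v r : R) :
  0 < N -> 0 < h <= 1 -> 0 < g0 -> 0 < Gam -> 0 <= D ->
  h <= Gam / 4 / (D + 1) -> 4 * B / (g0 * Gam) <= N * h -> Gam < r ->
  v - Gam / 4 * h <= u -> `|v - h * r| <= D * h ^+ 3 ->
  h * (g0 * Gam / 4) <= g0 * u - B / N.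
Proof.
move=> N0 /andP[h0 h1] gt0 G0 D0 hD NB Gr uv; rewrite ler_norml => /andP[vr _].
have D1 : 0 < D + 1 by lra.
have f1 : B / N <= h * (g0 * Gam / 4).
  by rewrite ler_pdivrMr//; move: NB; rewrite ler_pdivrMr ?mulr_gt0//; lra.
have f2 : D * h ^+ 3 <= h * (Gam / 4).
  have -> : D * h ^+ 3 = h * (D * h * h) by ring.
  rewrite ler_pM2l//; move: hD; rewrite ler_pdivlMr//; apply: le_trans.
  rewrite [leRHS]mulrC; apply: ler_pM => //; rewrite ?mulr_ge0 ?(ltW h0)//.
  by apply: (@le_trans _ _ D); [rewrite ler_piMr|rewrite lerDl].
have f3 : h * Gam <= h * r by rewrite ler_pM2l// ltW.
have f4 : h * Gam / 2 <= u by move: (h * r) (h ^+ 3) f2 f3 vr => p q; lra.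
have f5 : g0 * (h * Gam / 2) <= g0 * u by rewrite ler_pM2l.
by move: (B / N) (g0 * u) f1 f5 => p q; lra.
Qed.

Lemma ratio_deviation (a b a' b' e e' r gam Gam : R) :
  0 < gam -> 0 < Gam -> gam <= b' -> Gam <= b -> `|a| <= r ->
  `|a' - a| <= e -> `|b' - b| <= e' ->
  `|a' / b' - a / b| <= (e + r / Gam * e') / gam.
Proof.
move=> g0 G0 gb Gb ar ae be.
have b0 : 0 < b by exact: lt_le_trans Gb.
have b'0 : 0 < b' by exact: lt_le_trans gb.
have -> : a' / b' - a / b = ((a' - a) - a / b * (b' - b)) / b'.
  by field; rewrite !gt_eqF.
rewrite normrM normfV (gtr0_norm b'0).
apply: ler_pM; rewrite ?invr_ge0 ?(ltW b'0)//; last by rewrite lef_pV2.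
apply: (le_trans (ler_normB _ _)); apply: lerD => //.
rewrite normrM; apply: ler_pM => //.
rewrite normrM normfV (gtr0_norm b0); apply: ler_pM => //; first by rewrite invr_ge0 ltW.
by rewrite lef_pV2.
Qed.

End ratios.

(** * Consistency of the ratio *)

Section consistency.
Context {R : realType} {d : measure_display} {Omega : measurableType d}.
Variable P : probability Omega R.
Variables (X T : {RV P >-> R}) (X_ T_ C_ : nat -> {RV P >-> R}).
Variables (f_TX : R * R -> R) (F G : R -> R) (tau M : R) (rb : nat -> R -> R).
Variables (h : nat -> R) (K : R -> R) (Gamma c0 : R) (C : set R).
Hypothesis T_pos : forall w, 0 < T w.
Hypothesis TX_density : has_density P (lebesgue_measure \x lebesgue_measure)%E
  (fun w => (T w, X w)) f_TX.
Hypotheses (T_cdf : forall t, cdf T t = (F t)%:E) (F_cont : continuous F).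
Hypothesis TX_copies : forall i,
  same_law P (fun w => (T_ i w, X_ i w)) (fun w => (T w, X w)).
Hypothesis TX_indep : mutually_independent P (fun i w => (T_ i w, X_ i w)).
Hypotheses (C_cdf : forall i t, cdf (C_ i) t = (G t)%:E) (G_cont : continuous G).
Hypothesis C_indep : mutually_independent P (fun i w => C_ i w).
Hypothesis TX_C_indep :
  independent_seqs P (fun i w => (T_ i w, X_ i w)) (fun i w => C_ i w).
Hypotheses (F_tau : F tau = 1) (G_tau : 0 < 1 - G tau) (M_pos : 0 < M).
Hypothesis T_bound : forall l, (1 <= l <= 2)%N -> {ae P, forall w, T w ^- l <= M}.
Hypothesis rbE : forall l x, (1 <= l <= 2)%N -> (rb l x)%:E =
  (\int[lebesgue_measure]_(t in `]0%R, +oo[) (t ^- l * f_TX (t, x))%:E)%E.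
Hypothesis rb_C2 : forall l, (1 <= l <= 2)%N -> twice_cont_diff (rb l).
Hypothesis h_pos : forall n, (0 < n)%N -> 0 < h n.
Hypothesis h_to0 : h n @[n --> \oo] --> 0.
Hypothesis nh_toy : n%:R * h n @[n --> \oo] --> +oo.
Hypothesis log_to0 : ln n%:R / (n%:R * h n) @[n --> \oo] --> 0.
Hypotheses (K_C1 : cont_diff K) (K_supp : compact (closure [set t | K t != 0])).
Hypothesis K_ge0 : forall t, 0 <= K t.
Hypothesis K_int1 : (\int[lebesgue_measure]_t (K t)%:E = 1)%E.
Hypothesis K_mean0 : (\int[lebesgue_measure]_t (t * K t)%:E = 0)%E.
Hypothesis Gamma_pos : 0 < Gamma.
Hypothesis c0_gt0 : 0 < c0.
Hypothesis C_sub : forall x, C x -> `|x| <= c0.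
Hypothesis rb2_lb : forall x, C x -> Gamma < rb 2 x.

Local Notation g0 := (1 - G tau).
Local Notation Q := (distribution P (pair_rv T X) \x distribution P (C_ 0))%E.
Local Notation S := ((R * R) * R)%type.
Local Notation kt := (kernel_term G tau M K).

Let K_cont : continuous K := kernel_continuous K_C1.
Let l1 : (1 <= 1 <= 2)%N := isT.
Let l2 : (1 <= 2 <= 2)%N := isT.

Let rb_ge0 l x : (1 <= l <= 2)%N -> 0 <= rb l x.
Proof.
move=> l12; rewrite -lee_fin rbE//; apply: integral_ge0 => t /=.
rewrite in_itv/= andbT => t0; have [_ f0 _] := TX_density.
by rewrite lee_fin mulr_ge0// invr_ge0 exprn_ge0// ltW.
Qed.

Let rb_bounded l c : (1 <= l <= 2)%N -> exists2 r, 0 < r & forall x, `|x| <= c -> `|rb l x| <= r.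
Proof.
move=> l12; have [drb _ _] := rb_C2 l12.
have rb_cont : continuous (rb l).
  by move=> x; apply: differentiable_continuous; apply/derivable1_diffP.
have [m hm] := continuous_bounded_on c rb_cont.
exists (`|m| + 1) => [|x xc]; first by have := normr_ge0 m; lra.
by have := hm x xc; have := ler_norm m; lra.
Qed.

Let h_le (e : R) : 0 < e -> \forall n \near \oo, h n <= e.
Proof.
move=> e0; have : \forall n \near \oo, h n < e by move/cvgr_lt : h_to0; apply.
by apply: filterS => n /ltW.
Qed.

Let nh_ge (c : R) : \forall n \near \oo, c <= n%:R * h n.
Proof. by move/cvgryPge : nh_toy; apply. Qed.

Lemma mean_kernel_term l c : (1 <= l <= 2)%N -> exists2 D, 0 <= D &
  \forall n \near \oo, forall x, `|x| <= c ->
    `|\int[Q]_z kt l x (h n) z - h n * rb l x| <= D * h n ^+ 3.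
Proof.
move=> l12.
have [D D0 hD] := kernel_bias K_C1 K_supp K_ge0 K_int1 K_mean0 c
  (fun x => rb_ge0 x l12) (rb_C2 l12).
exists D => //; have h1 := h_le ltr01.
near=> n => x xc.
have n0 : (0 < n)%N by near: n; exists 1%N.
have hn1 : h n <= 1 by near: n.
rewrite (integral_kernel_term T_cdf (C_cdf 0) G_cont F_tau G_tau M_pos T_pos T_bound
  TX_density rbE K_cont K_ge0 x (h n) l12).
by apply: hD => //; rewrite h_pos.
Unshelve. all: by end_near. Qed.

Let mkt l x e : measurable_fun setT (kt l x e).
Proof. exact: measurable_kernel_term. Qed.

Let kt_lip L l x y e z : (1 <= l <= 2)%N -> 0 < L -> (forall u v, `|K u - K v| <= L * `|u - v|) ->
  0 < e -> `|kt l x e z - kt l y e z| <= M / g0 * L * `|x - y| / e.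
Proof.
move=> l12 L0 hL e0; rewrite /kernel_term -mulrBr -mulrBr.
rewrite normrM normr_nat normrM.
have /andP[w0 w1] := ipcw_bound (C_cdf 0) G_tau M_pos z.1.1 l12.
set k := (X in _ * (_ * X)).
have hk : k <= L * `|x - y| / e.
  rewrite /k; apply: (le_trans (hL _ _)).
  rewrite -mulrBl normrM normfV (gtr0_norm e0) mulrA.
  by have -> : x - z.1.2 - (y - z.1.2) = x - y by ring.
have k0 : 0 <= k by exact: normr_ge0.
apply: (@le_trans _ _ (M / g0 * k)).
  rewrite (ger0_norm w0); case: (z.1.1 <= z.2)%R; last by rewrite mul0r mulr_ge0// divr_ge0// ltW.
  by rewrite mul1r ler_wpM2r.
rewrite -(mulrA _ L) -(mulrA _ (L * _)).
by apply: ler_wpM2l => //; rewrite divr_ge0// ltW.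
Qed.

Let rate_h n : (0 < n)%N ->
  rate n / h n <= Num.max (Num.sqrt (ln n%:R / (n%:R * h n ^+ 2))) (h n ^+ 2).
Proof.
move=> n0; rewrite le_max; apply/orP; left; apply: eq_leR.
have h0 := h_pos n0.
have -> : ln n%:R / (n%:R * h n ^+ 2) = ln n%:R / n%:R * (h n)^-1 ^+ 2.
  by rewrite exprVn invfM mulrA.
by rewrite sqrtrM ?divr_ge0 ?ln_ge0 ?ler1n// sqrtr_sqr gtr0_norm ?invr_gt0.
Qed.

Local Notation bar l n w := (bar_rn K n (h n) (X_ ^~ w)
  (fun i => Num.min (T_ i w) (C_ i w)) (fun i => T_ i w <= C_ i w) l).

Let ae_sample_regular : {ae P, forall w, forall i, regular tau M (T_ i w)}.
Proof.
have h1 : {ae P, forall w, forall i, ~ [set z : R * R | ~~ regular tau M z.1] (T_ i w, X_ i w)}.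
  apply: (ae_sample TX_copies).
    have -> : [set z : R * R | ~~ regular tau M z.1] = fst @^-1` (~` [set t | regular tau M t]).
      by apply/seteqP; split => z /= /negP.
    rewrite -[X in measurable X]setTI; apply: measurable_fst => //.
    by apply: measurableC; exact: measurable_regular.
  have mE : measurable (T @^-1` ~` [set t | regular tau M t]).
    by apply: measurable_funPTI; apply: measurableC; exact: measurable_regular.
  have [Z [mZ Z0 hZ]] := ae_regular T_cdf F_tau T_pos T_bound.
  apply/eqP; rewrite eq_le measure_ge0 andbT -Z0.
  have -> : pair_rv T X @^-1` [set z | ~~ regular tau M z.1] = T @^-1` ~` [set t | regular tau M t].
    by apply/seteqP; split => w /= /negP.
  by apply: le_measure; rewrite ?inE.
by apply: filterS h1 => w hw i; apply: contrapT => /negP; exact: hw.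
Qed.

(** The sum of the three errors: censoring, fluctuation and bias. *)
Lemma bar_rn_rate l : (1 <= l <= 2)%N -> exists2 c, 0 <= c & {ae P, forall w,
  \forall n \near \oo, forall x, `|x| <= c0 -> `|bar l n w x - rb l x| <=
    c * Num.max (Num.sqrt (ln n%:R / (n%:R * h n ^+ 2))) (h n ^+ 2)}.
Proof.
move=> l12; have gt0 := G_tau.
have [Kb Kb0 K_le] := kernel_bounded K_C1 K_supp.
have [L L0 hL] := kernel_lipschitz K_C1 K_supp K_ge0.
have [c1 hc1] := ae_km_weights T_cdf F_cont TX_copies TX_indep C_cdf G_cont C_indep TX_C_indep
  F_tau G_tau.
have Mg0 : 0 < M / g0 by rewrite divr_gt0.
have [c2 hc2] := uniform_deviation (measurable_datum X_ T_ C_) (censored_law_total T X (C_ 0))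
  (datum_prod TX_copies TX_indep C_cdf C_indep TX_C_indep) (mulr_gt0 Mg0 Kb0) (mulr_gt0 Mg0 L0)
  c0_gt0 (mkt l) (fun x e z => kernel_term_bound (C_cdf 0) G_tau M_pos K_ge0 K_le x e z l12)
  (fun x y e z => @kt_lip L l x y e z l12 L0 hL) h_pos nh_toy.
have [D D0 hD] := mean_kernel_term c0 l12.
exists (M * Kb * `|c1| + `|c2| + D); first by rewrite addr_ge0// addr_ge0// mulr_ge0// mulr_ge0// ltW.
apply: filterS3 hc1 hc2 ae_sample_regular => w h1 h2 reg.
near=> n => x xc.
have n2 : (1 < n)%N by near: n; exists 2%N.
have n0 : (0 < n)%N by exact: ltn_trans n2.
have hn := h_pos n0.
have r0 : 0 <= rate n :> R by exact/ltW/rate_gt0.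
have e1 := bar_rn_ipcw G (C_ ^~ w) (X_ ^~ w) x K_ge0 K_le n0 hn reg l12.
have e2 : n%:R^-1 * \sum_(i < n) (T_ i w <= C_ i w)%R%:R *
     `|(kaplan_meier n (obs T_ C_ ^~ w) (fun i => T_ i w <= C_ i w) (obs T_ C_ i w))^-1
        - (1 - G (T_ i w))^-1| <= c1 * rate n by near: n.
have e3 : `|avg (datum X_ T_ C_) n (kt l x (h n)) w - \int[Q]_z kt l x (h n) z| <= c2 * rate n.
  by move: x xc {e1}; near: n.
have e4 : `|\int[Q]_z kt l x (h n) z - h n * rb l x| <= D * h n ^+ 3.
  by move: x xc {e1 e3}; near: n.
have {}e1 : `|h n * bar l n w x - avg (datum X_ T_ C_) n (kt l x (h n)) w| <= M * Kb * (c1 * rate n).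
  by apply: (le_trans e1); rewrite ler_pM2l ?mulr_gt0.
rewrite -(ler_pM2l hn) -[X in X * `|_|](gtr0_norm hn) -normrM mulrBr.
set a := Num.max _ _.
have ra : rate n <= h n * a by rewrite -ler_pdivrMl// mulrC; exact: rate_h.
have ha : h n ^+ 3 <= h n * a by rewrite exprS ler_pM2l// /a le_max lexx orbT.
move: e1 e3 e4; move: (avg _ _ _ _) (\int[_]_z _) (h n * bar _ _ _ _) (h n * rb _ _) => u v y z e1 e3 e4.
have -> : y - z = (y - u) + (u - v) + (v - z) by ring.
apply: (le_trans (ler_normD _ _)); apply: (le_trans (lerD (ler_normD _ _) (lexx _))).
have -> : h n * ((M * Kb * `|c1| + `|c2| + D) * a) =
  M * Kb * (`|c1| * (h n * a)) + `|c2| * (h n * a) + D * (h n * a) by ring.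
apply: lerD; last by apply: (le_trans e4); rewrite ler_wpM2l.
have rc c : c * rate n <= `|c| * (h n * a).
  by apply: (@le_trans _ _ (`|c| * rate n)); [rewrite ler_wpM2r// ler_norm|rewrite ler_wpM2l].
apply: lerD; last by apply: (le_trans e3).
by apply: (le_trans e1); rewrite ler_wpM2l// mulr_ge0// ltW.
Unshelve. all: by end_near. Qed.

(** [bar_rn_rate] gives no lower bound when q / h stays large, hence the recourse
    to [uniform_lower]. *)
Lemma bar_rn2_lower : {ae P, forall w, \forall n \near \oo, forall x, C x ->
  g0 * Gamma / 4 <= bar 2 n w x}.
Proof.
have gt0 := G_tau; have Ga := Gamma_pos.
have [Kb Kb0 K_le] := kernel_bounded K_C1 K_supp.
have [L L0 hL] := kernel_lipschitz K_C1 K_supp K_ge0.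
have Mg0 : 0 < M / g0 by rewrite divr_gt0.
have [D D0 hD] := mean_kernel_term (3 * c0) l2.
have [r r0 hr] := rb_bounded (3 * c0) l2.
have h1 := h_le ltr01.
have mean_le : \forall n \near \oo, forall x, `|x| <= 3 * c0 ->
    \int[Q]_z kt 2 x (h n) z <= (r + D) * h n.
  near=> n => x xc; have n0 : (0 < n)%N by near: n; exists 1%N.
  have hn := h_pos n0; have hn1 : h n <= 1 by near: n.
  have : `|\int[Q]_z kt 2 x (h n) z - h n * rb 2 x| <= D * h n ^+ 3 by move: x xc; near: n.
  have := hr x xc; move: (\int[_]_z _) (rb 2 x) => u v; rewrite !ler_norml => /andP[_ a1] /andP[_ a2].
  have b1 : h n * v <= h n * r by rewrite ler_pM2l.
  have b2 : D * h n ^+ 3 <= D * h n.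
    by rewrite ler_wpM2l// exprS ler_piMr ?exprn_ile1 ?(ltW hn)//.
  by lra.
have := uniform_lower (measurable_datum X_ T_ C_) (censored_law_total T X (C_ 0))
  (datum_prod TX_copies TX_indep C_cdf C_indep TX_C_indep) (mulr_gt0 Mg0 Kb0) (mulr_gt0 Mg0 L0)
  c0_gt0 (mkt 2) (fun x e z => kernel_term_bound (C_cdf 0) G_tau M_pos K_ge0 K_le x e z l2)
  (fun x y e z => @kt_lip L 2 x y e z isT L0 hL) h_pos nh_toy log_to0
  (ltr_wpDr D0 r0) (divr_gt0 Ga (ltr0Sn _ 3)) mean_le.
have no_tie := obs_no_tie T_cdf F_cont TX_copies TX_indep C_cdf G_cont C_indep TX_C_indep.
apply: filterS3 no_tie ae_sample_regular => w tie reg low.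
have D1 : 0 < D + 1 by lra.
have h2 : \forall n \near \oo, h n <= Gamma / 4 / (D + 1) by apply: h_le; rewrite !divr_gt0.
have nh1 := nh_ge (4 * M * Kb / (g0 * Gamma)).
near=> n => x Cx; have n0 : (0 < n)%N by near: n; exists 1%N.
have hn := h_pos n0; have hn1 : h n <= 1 by near: n.
have xc := C_sub Cx.
have xc3 : `|x| <= 3 * c0 by have := c0_gt0; lra.
have tie' i j : (i < n)%N -> (j < n)%N ->
    Num.min (T_ i w) (C_ i w) = Num.min (T_ j w) (C_ j w) -> i = j.
  by move=> _ _ e; apply/eqP/negPn/negP => ij; exact: (tie i j ij e).
have e1 := bar_rn_lower (X_ ^~ w) x (cdf_mono (C_cdf 0)) G_tau K_ge0 K_le n0 hn reg tie' l2.
have e2 : \int[Q]_z kt 2 x (h n) z - Gamma / 4 * h n <= avg (datum X_ T_ C_) n (kt 2 x (h n)) w.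
  by move: x xc {Cx xc3 e1}; near: n.
have e3 : `|\int[Q]_z kt 2 x (h n) z - h n * rb 2 x| <= D * h n ^+ 3.
  by move: x xc3 {Cx xc e1 e2}; near: n.
rewrite -(ler_pM2l hn); apply: le_trans e1.
apply: (lower_bound_budget _ _ gt0 Ga D0 _ _ (rb2_lb Cx) e2 e3).
- by rewrite ltr0n.
- by rewrite hn.
- by near: n.
- by rewrite mulrA; near: n.
Unshelve. all: by end_near. Qed.

Lemma rn_rate : Oas P
  (fun n w => sup_abs C (fun x =>
     rn K n (h n) (fun i => X_ i w) (fun i => Num.min (T_ i w) (C_ i w))
       (fun i => T_ i w <= C_ i w) x - rb 1 x / rb 2 x))
  (fun n => Num.max (Num.sqrt (ln n%:R / (n%:R * h n ^+ 2))) (h n ^+ 2)).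
Proof.
have gt0 := G_tau; have Ga := Gamma_pos.
have [c1 c10 hc1] := bar_rn_rate l1.
have [c2 c20 hc2] := bar_rn_rate l2.
have [r r0 hr] := rb_bounded c0 l1.
have gam0 : 0 < g0 * Gamma / 4 by rewrite divr_gt0// mulr_gt0.
apply: (@Oas_of_bound _ _ _ _ _ _ ((c1 + r / Gamma * c2) / (g0 * Gamma / 4))).
- near=> n; have n0 : (0 < n)%N by near: n; exists 1%N.
  by rewrite lt_max exprn_gt0 ?h_pos// orbT.
- by move=> n w; exact: sup_abs_ge0.
apply: filterS3 hc1 hc2 bar_rn2_lower => w h1 h2 low.
near=> n; have n0 : (0 < n)%N by near: n; exists 1%N.
set a := Num.max _ _.
have a0 : 0 <= a by rewrite /a le_max sqrtr_ge0.
apply: sup_abs_le => [|x Cx].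
  by rewrite mulr_ge0// divr_ge0 ?(ltW gam0)// addr_ge0// mulr_ge0// divr_ge0// ltW.
have xc := C_sub Cx.
have -> : (c1 + r / Gamma * c2) / (g0 * Gamma / 4) * a =
   (c1 * a + r / Gamma * (c2 * a)) / (g0 * Gamma / 4) by ring.
apply: ratio_deviation => //.
- by move: x Cx {xc a a0}; near: n.
- exact/ltW/rb2_lb.
- exact: hr.
- by rewrite /a; move: x xc {Cx a a0}; near: n.
- by rewrite /a; move: x xc {Cx a a0}; near: n.
Unshelve. all: by end_near. Qed.

End consistency.

Theorem theorem1 (R : realType) (d : measure_display) (Omega : measurableType d)
  (P : probability Omega R)
  (X T : {RV P >-> R}) (X_ T_ C_ : nat -> {RV P >-> R})
  (f_TX : R * R -> R) (f F G : R -> R) (M : R)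
  (r_ : nat -> R -> R) (C : set R)
  (h : nat -> R) (K : R -> R) (Gamma : R)
  (* the generic vector *)
  (T_pos : forall w, 0 < T w)
  (TX_density : has_density P (lebesgue_measure \x lebesgue_measure)%E
                  (fun w => (T w, X w)) f_TX)
  (X_density : has_density P lebesgue_measure X f)
  (T_df : forall t, cdf T t = (F t)%:E) (F_cont : continuous F)
  (* the sample and the censoring variables *)
  (TX_copies : forall i,
     same_law P (fun w => (T_ i w, X_ i w)) (fun w => (T w, X w)))
  (TX_indep : mutually_independent P (fun i w => (T_ i w, X_ i w)))
  (C_df : forall i t, cdf (C_ i) t = (G t)%:E) (G_cont : continuous G)
  (C_indep : mutually_independent P (fun i w => C_ i w))
  (TX_C_indep :
     independent_seqs P (fun i w => (T_ i w, X_ i w)) (fun i w => C_ i w))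
  (* standing assumptions *)
  (tauF_fin : (upper_endpoint F < +oo)%E)
  (G_tauF : 0 < 1 - G (fine (upper_endpoint F)))
  (M_pos : 0 < M)
  (T_bound : forall l, (1 <= l <= 2)%N -> {ae P, forall w, T w ^- l <= M})
  (C0_open : open [set x | 0 < f x])
  (C_compact : compact C) (C_sub : C `<=` [set x | 0 < f x])
  (* r_l(x) = E[T^-l | X = x] and r_l(x) f(x) = int t^-l f_TX(t, x) dt *)
  (r_regression : forall l, (1 <= l <= 2)%N ->
     is_regression X (fun w => T w ^- l) (r_ l))
  (bar_r_int : forall l x, (1 <= l <= 2)%N ->
     (bar_r r_ f l x)%:E =
     (\int[lebesgue_measure]_(t in `]0%R, +oo[) (t ^- l * f_TX (t, x))%:E)%E)
  (* bandwidth *)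
  (h_pos : forall n, (0 < n)%N -> 0 < h n)
  (h_to0 : h n @[n --> \oo] --> 0)
  (nh_toy : n%:R * h n @[n --> \oo] --> +oo)
  (log_to0 : ln n%:R / (n%:R * h n) @[n --> \oo] --> 0)
  (* kernel *)
  (K_C1 : cont_diff K)
  (K_supp : compact (closure [set t | K t != 0]))
  (K_ge0 : forall t, 0 <= K t)
  (K_int1 : (\int[lebesgue_measure]_t (K t)%:E = 1)%E)
  (K_mean0 : (\int[lebesgue_measure]_t (t * K t)%:E = 0)%E)
  (K_var : (\int[lebesgue_measure]_t (t ^+ 2 * K t)%:E < +oo)%E)
  (K_sq : (\int[lebesgue_measure]_t (t * K t ^+ 2)%:E < +oo)%E)
  (* smoothness of the target *)
  (bar_r_C2 : forall l, (1 <= l <= 2)%N -> twice_cont_diff (bar_r r_ f l))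
  (bar_r_bound : forall l, (1 <= l <= 2)%N ->
     (sup_abs C (derive1n 2 (bar_r r_ f l)) < +oo)%E)
  (Gamma_pos : 0 < Gamma)
  (bar_r2_lb : forall x, C x -> Gamma < bar_r r_ f 2 x) :
  Oas P
    (fun n w =>
       sup_abs C (fun x =>
         rn K n (h n) (fun i => X_ i w)
           (fun i => Num.min (T_ i w) (C_ i w))
           (fun i => T_ i w <= C_ i w) x
         - rel_regression r_ f x))
    (fun n => Num.max (Num.sqrt (ln n%:R / (n%:R * h n ^+ 2))) (h n ^+ 2)).
Proof.
have [m [_ hm]] := compact_bounded C_compact.
have C_le x : C x -> `|x| <= `|m| + 1.
  by move=> Cx; apply: (hm (`|m| + 1)) => //; rewrite (le_lt_trans (ler_norm m)) ?ltrDl.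
exact: (rn_rate T_pos TX_density T_df F_cont TX_copies TX_indep C_df G_cont C_indep TX_C_indep
  (cdf_upper_endpoint T_df F_cont tauF_fin) G_tauF M_pos T_bound bar_r_int bar_r_C2
  h_pos h_to0 nh_toy log_to0 K_C1 K_supp K_ge0 K_int1 K_mean0 Gamma_pos
  (ltr_wpDl (normr_ge0 m) ltr01) C_le bar_r2_lb).
Qed.
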